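(* Let $N\ge 2$, let $\Omega\subset\mathbb{R}^N$ be a bounded Lipschitz domain, let $\alpha>0$, $0<s<1<p<\infty$, $\delta\in(0,1)$, let $H$ be a Finsler--Minkowski norm on $\mathbb{R}^N$, and let $w\in A_p^t$ with $t\in I$. Let $f\in L^m(\Omega)\setminus\{0\}$ be a nonnegative function, where $m$ is the exponent defined in the context, and let $u_\delta\in W_0^{1,p}(\Omega,w)$ be the unique weak solution of $$\mathcal{M}_\alpha u=f(x)u^{-\delta}\ \text{in }\Omega,\qquad u>0\ \text{in }\Omega,\qquad u=0\ \text{in }\mathbb{R}^N\setminus\Omega.$$ Define $$S_\delta:=\Big\{v\in W_0^{1,p}(\Omega,w):\int_\Omega|v|^{1-\delta}f\,dx=1\Big\},\qquad \zeta_\delta:=\Big(\int_\Omega u_\delta^{1-\delta}f\,dx\Big)^{-\frac1{1-\delta}},\qquad V_\delta:=\zeta_\delta u_\delta,$$ $$\Theta(\Omega):=\inf_{v\in S_\delta}\Big\{\int_\Omega H(\nabla v)^p\,w\,dx+\alpha\int_{\mathbb{R}^N}\int_{\mathbb{R}^N}|v(x)-v(y)|^p\,d\mu\Big\}.$$ Then $V_\delta\in S_\delta$ and $$\Theta(\Omega)=\int_\Omega H(\nabla V_\delta)^p\,w\,dx+\alpha\int_{\mathbb{R}^N}\int_{\mathbb{R}^N}|V_\delta(x)-V_\delta(y)|^p\,d\mu.$$ In particular, $V_\delta$ is an extremal for the inequality $$\Theta(\Omega)\Big(\int_\Omega|v|^{1-\delta}f\,dx\Big)^{\frac p{1-\delta}}\le\int_\Omega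 H(\nabla v)^p\,w\,dx+\alpha\int_{\mathbb{R}^N}\int_{\mathbb{R}^N}|v(x)-v(y)|^p\,d\mu,\qquad v\in W_0^{1,p}(\Omega,w),$$ that is, equality holds for $v=V_\delta$. Moreover, $V_\delta$ is the unique weak solution of $$\mathcal{M}_\alpha V_\delta=\Theta(\Omega)\,f\,V_\delta^{-\delta}\ \text{in }\Omega,\qquad V_\delta>0\ \text{in }\Omega,\qquad V_\delta=0\ \text{in }\mathbb{R}^N\setminus\Omega.$$
   Context: Finsler--Minkowski norm: a function $H:\mathbb{R}^N\to[0,\infty)$, $H\in C^1(\mathbb{R}^N\setminus\{0\})$, which is convex with strictly convex unit ball (i.e. $H(\xi+\eta)<H(\xi)+H(\eta)$ unless one of $\xi,\eta$ is a nonnegative multiple of the other), satisfies $H(\xi)=0\iff\xi=0$, $H(t\xi)=|t|H(\xi)$ for all $t\in\mathbb{R}$, $\xi\in\mathbb{R}^N$, and $c_1|\xi|\le H(\xi)\le c_2|\xi|$ for some constants $c_1,c_2>0$. $\nabla H(\nabla u)$ denotes the gradient of $H$ evaluated at $\nabla u(x)$; $H(\xi)^{p-1}\nabla H(\xi):=0$ at $\xi=0$. Weights: a weight is $w\in L^1_{\mathrm{loc}}(\mathbb{R}^N)$ with $0<w<\infty$ a.e. It belongs to $A_p$ if there is $C>0$ with $\big(\frac1{|B|}\int_B w\,dx\big)\big(\frac1{|B|}\int_B w^{-1/(p-1)}dx\big)^{p-1}\le C$ for every ball $B\subset\mathbb{R}^N$. Let $I:=(\frac1{p-1},\infty)\cap(\frac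 Np,\infty)$. We write $w\in A_p^t$, $t\in I$, if $w\in A_p$ and $w^{-t}\in L^1(\Omega)$. Put $p_t:=\frac{pt}{t+1}\in[1,p)$ and $p_t^*:=\frac{Np_t}{N-p_t}$ if $p_t<N$. The exponent $m$ is: $m=\big(\frac{p_t^*}{1-\delta}\big)'$ if $1\le p_t<N$; $m=l$ for some $l>1$ if $p_t=N$; $m=1$ if $p_t>N$; here $l'=l/(l-1)$. Nonlocal measure: $w(B):=\int_B w\,dx$, $B_{x,y}$ is the open ball with center $\frac{x+y}2$ and radius $\frac{|x-y|}2$, $K(x,y):=\frac{w(x)w(y)}{w(B_{x,y})}$, and $d\mu:=\frac{K(x,y)}{|x-y|^{sp}}\,dx\,dy$ on $\mathbb{R}^N\times\mathbb{R}^N$. $J_p(\tau):=|\tau|^{p-2}\tau$ for $\tau\in\mathbb{R}$ (with $J_p(0)=0$). Space: $W_0^{1,p}(\Omega,w)$ is the closure of $C_c^\infty(\Omega)$ (functions extended by zero outside $\Omega$) with respect to the norm $\|u\|:=\Big(\int_\Omega H(\nabla u)^p\,w\,dx+\alpha\int_{\mathbb{R}^N}\int_{\mathbb{R}^N}|u(x)-u(y)|^p\,d\mu\Big)^{1/p}$. Operator: $\mathcal{M}_\alpha u=-\mathrm{div}\big(w\,H(\nabla u)^{p-1}\nabla H(\nabla u)\big)+\alpha\,\mathrm{P.V.}\int_{\mathbb{R}^N}\frac{J_p(u(x)-u(y))}{|x-y|^{sp}}K(x,y)\,dy$, understood in the following weak sense. Weak solution: for a nonnegative $g\in L^1(\Omega)\setminus\{0\}$,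 $u\in W_0^{1,p}(\Omega,w)$ is a weak solution of $\mathcal{M}_\alpha u=g u^{-\delta}$ in $\Omega$, $u>0$ in $\Omega$, $u=0$ in $\mathbb{R}^N\setminus\Omega$, if (1) for every compactly contained $\omega\Subset\Omega$ there is a constant $C(\omega)>0$ with $u\ge C(\omega)$ a.e. in $\omega$; and (2) for every $\varphi\in C_c^1(\Omega)$, $$\int_\Omega H(\nabla u)^{p-1}\nabla H(\nabla u)\cdot\nabla\varphi\,w\,dx+\alpha\int_{\mathbb{R}^N}\int_{\mathbb{R}^N}J_p(u(x)-u(y))(\varphi(x)-\varphi(y))\,d\mu=\int_\Omega g\,u^{-\delta}\varphi\,dx.$$ Under the hypotheses of the claim the weak solution $u_\delta$ (with $g=f$) exists and is unique. *)

(* Defs.v *)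
From HB Require Import structures.
From mathcomp Require Import all_boot all_order all_algebra.
From mathcomp Require Import all_classical all_reals all_analysis.

Set Implicit Arguments.
Unset Strict Implicit.
Unset Printing Implicit Defensive.

Import Order.TTheory GRing.Theory Num.Theory.
Import numFieldNormedType.Exports.

Local Open Scope classical_set_scope.
Local Open Scope ring_scope.

Section measurable_rV.
Context {R : realType} {n : nat}.

Let coord : 'I_n -> 'rV[R]_n -> R := fun i x => x 0 i.

Let rV_set0 : g_sigma_preimage coord set0.
Proof. exact: sigma_algebra0. Qed.

Let rV_setC A : g_sigma_preimage coord A -> g_sigma_preimage coord (~` A).
Proof. exact: sigma_algebraC. Qed.

Let rV_bigcup (F : _^nat) : (forall i, g_sigma_preimage coord (F i)) ->
  g_sigma_preimage coord (\bigcup_i (F i)).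
Proof. exact: sigma_algebra_bigcup. Qed.

(* The sigma-algebra generated by the coordinates, i.e. the Borel sets. *)
HB.instance Definition _ := @isMeasurable.Build
  (measure_tuple_display default_measure_display) 'rV[R]_n
  (g_sigma_preimage coord) rV_set0 rV_setC rV_bigcup.

End measurable_rV.

Section measurable_rV_theory.
Context {R : realType} {n : nat}.

Lemma measurable_coord (i : 'I_n) :
  measurable_fun [set: 'rV[R]_n] (fun x : 'rV[R]_n => x 0 i).
Proof.
move=> _ Y mY; rewrite setTI; apply: sub_sigma_algebra => /=.
rewrite -bigcup_seq/=; exists i => /=; first by rewrite mem_index_enum.
by exists Y => //; rewrite setTI.
Qed.

Lemma measurable_fun_rV d (T : measurableType d) (f : T -> 'rV[R]_n) :
  (forall i, measurable_fun [set: T] (fun x => f x 0 i)) ->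
  measurable_fun [set: T] f.
Proof.
move=> mf _ A mA; rewrite setTI.
pose G := [set B : set 'rV[R]_n | measurable (f @^-1` B)].
suff: G A by [].
move: A mA; apply: smallest_sub.
  split=> [|B mB|F mF]; rewrite /G/=.
  - by rewrite preimage_set0.
  - by rewrite setTD preimage_setC; exact: measurableC.
  - by rewrite preimage_bigcup; apply: bigcup_measurable => i _; exact: mF.
rewrite -bigcup_seq => B [i _ [C mC <-]] /=.
by rewrite /G/= setTI; have := mf i measurableT C mC; rewrite setTI.
Qed.

End measurable_rV_theory.

Section lebesgue_rVS.
Context {R : realType} {n : nat}.

Definition cons_rV (z : measurableTypeR R * 'rV[R]_n) : 'rV[R]_n.+1 :=
  row_mx (z.1%:M : 'rV[R]_1) z.2.

Lemma cons_rV0 z : cons_rV z 0 ord0 = z.1.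
Proof.
rewrite /cons_rV (_ : ord0 = lshift n ord0 :> 'I_(1 + n)); last exact: val_inj.
by rewrite (@row_mxEl _ 1 1 n) mxE eqxx.
Qed.

Lemma cons_rVS z i : cons_rV z 0 (lift ord0 i) = z.2 0 i.
Proof.
rewrite /cons_rV (_ : lift ord0 i = rshift 1 i :> 'I_(1 + n)); last exact: val_inj.
by rewrite (@row_mxEr _ 1 1 n).
Qed.

Lemma measurable_cons_rV : measurable_fun setT cons_rV.
Proof.
apply: measurable_fun_rV => i; case: (unliftP ord0 i) => [j|] ->.
  under eq_fun do rewrite cons_rVS.
  exact: (measurableT_comp (measurable_coord j) measurable_snd).
under eq_fun do rewrite cons_rV0.
exact: measurable_fst.
Qed.

Variable m : {sigma_finite_measure set 'rV[R]_n -> \bar R}.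

Definition lebesgue_rVS : set 'rV[R]_n.+1 -> \bar R :=
  pushforward (lebesgue_measure \x m)%E cons_rV.

Let lebesgue_rVS0 : lebesgue_rVS set0 = 0%E.
Proof. by apply: measure0; exact: measurable_cons_rV. Qed.

Let lebesgue_rVS_ge0 A : (0 <= lebesgue_rVS A)%E.
Proof. by apply: measure_ge0; exact: measurable_cons_rV. Qed.

Let lebesgue_rVS_sigma_additive : semi_sigma_additive lebesgue_rVS.
Proof. by apply: measure_semi_sigma_additive; exact: measurable_cons_rV. Qed.

HB.instance Definition _ := isMeasure.Build _ _ _ lebesgue_rVS
  lebesgue_rVS0 lebesgue_rVS_ge0 lebesgue_rVS_sigma_additive.

Let uncons_rV (x : 'rV[R]_n.+1) : measurableTypeR R * 'rV[R]_n :=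
  (x 0 ord0, @rsubmx _ 1 1 n x).

Let cons_rVK : cancel cons_rV uncons_rV.
Proof.
by move=> z; rewrite /uncons_rV cons_rV0 [cons_rV _]/cons_rV row_mxKr; case: z.
Qed.

Let measurable_uncons_rV : measurable_fun setT uncons_rV.
Proof.
apply/measurable_fun_pair; first exact: measurable_coord.
apply: measurable_fun_rV => i.
under eq_fun do rewrite mxE.
exact: measurable_coord.
Qed.

Let lebesgue_rVS_sigma_finite : sigma_finite setT lebesgue_rVS.
Proof.
have /sigma_finiteP[F [FT ndF Foo]] := sigma_finiteT (@lebesgue_measure R).
have /sigma_finiteP[G [GT ndG Goo]] := sigma_finiteT m.
exists (fun k => uncons_rV @^-1` (F k `*` G k)).
  apply/seteqP; split=> // x _.
  have [k _ Fk] : (\bigcup_k F k) (uncons_rV x).1 by rewrite -FT.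
  have [l _ Gl] : (\bigcup_k G k) (uncons_rV x).2 by rewrite -GT.
  exists (maxn k l) => //; split.
    by move: Fk; exact/subsetPset/ndF/leq_maxl.
  by move: Gl; exact/subsetPset/ndG/leq_maxr.
move=> k; have [mF Fk] := Foo k; have [mG Gk] := Goo k; split.
  rewrite -[X in measurable X]setTI; apply: measurable_uncons_rV => //.
  exact: measurableX.
rewrite /lebesgue_rVS /pushforward -comp_preimage.
rewrite (_ : uncons_rV \o cons_rV = id); last exact/funext.
by rewrite product_measure1E// lte_mul_pinfty// ge0_fin_numE.
Qed.

HB.instance Definition _ := Measure_isSigmaFinite.Build _ _ _ lebesgue_rVS
  lebesgue_rVS_sigma_finite.

End lebesgue_rVS.

Fixpoint lebesgue_rV {R : realType} n :
    {sigma_finite_measure set 'rV[R]_n -> \bar R} :=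
  if n is k.+1 return {sigma_finite_measure set 'rV[R]_n -> \bar R}
  then lebesgue_rVS (lebesgue_rV k)
  else \d_(0 : 'rV[R]_0).

Lemma lebesgue_rV_box (R : realType) n (A : 'I_n -> set (measurableTypeR R)) :
  (forall i, measurable (A i)) ->
  lebesgue_rV n [set x : 'rV[R]_n | forall i, A i (x 0 i)] =
  (\prod_(i < n) lebesgue_measure (A i))%E.
Proof.
elim: n A => [A mA|n IHn A mA].
  by rewrite big_ord0 /= diracE mem_set//= => -[].
rewrite big_ord_recl/= -IHn// -product_measure1E//; last first.
  rewrite (_ : mkset _ =
      \bigcap_(i in setT) [set x : 'rV[R]_n | A (lift ord0 i) (x 0 i)]).
    apply: fin_bigcap_measurable => // i _.
    rewrite -[X in measurable X]setTI.
    exact: (measurable_coord i measurableT (mA (lift ord0 i))).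
  by apply/seteqP; split=> [x Ax i _|x Ax i]; [exact: Ax|exact: (Ax i I)].
rewrite /lebesgue_rVS /pushforward; congr (_ _).
apply/seteqP; split=> [z /= Az|z /= [A0 AS] i].
  by split=> [|i]; [have := Az ord0; rewrite cons_rV0|
                    have := Az (lift ord0 i); rewrite cons_rVS].
by case: (unliftP ord0 i) => [j|] ->; [rewrite cons_rVS; exact: AS|rewrite cons_rV0].
Qed.

Section euclidean.
Context {R : realType} {n : nat}.
Implicit Types (x y c : 'rV[R]_n) (r : R).

Definition edot x y : R := \sum_i x 0 i * y 0 i.

(* The library norm of 'rV[R]_n is the sup norm. *)
Definition enorm x : R := Num.sqrt (edot x x).

Definition eball c r : set 'rV[R]_n := [set y | enorm (y - c) < r].

Definition basis_rV (i : 'I_n) : 'rV[R]_n := delta_mx 0 i.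

Definition grad (f : 'rV[R]_n -> R) x : 'rV[R]_n :=
  \row_i 'D_(basis_rV i) f x.

(* Class C^k through continuous iterated partial derivatives; D is meant to be
   open. *)
Fixpoint class_C (k : nat) (D : set 'rV[R]_n) (f : 'rV[R]_n -> R) : Prop :=
  (forall x, D x -> {for x, continuous f}) /\
  (if k is k'.+1 then
     forall i, (forall x, D x -> derivable f x (basis_rV i)) /\
               class_C k' D ('D_(basis_rV i) f)
   else True).

(* Elements of C_c^k(D) are identified with their extensions by zero. *)
Definition class_Cc (k : nat) (D : set 'rV[R]_n) (f : 'rV[R]_n -> R) : Prop :=
  [/\ class_C k setT f, compact (closure [set x | f x != 0]) &
      closure [set x | f x != 0] `<=` D].

Definition class_Cc_oo (D : set 'rV[R]_n) (f : 'rV[R]_n -> R) : Prop :=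
  forall k, class_Cc k D f.

(* Bounded Lipschitz domain: near every boundary point the domain is the
   strict epigraph, in some direction e, of a Lipschitz function of the
   component orthogonal to e.  This is the usual condition "x_n > gamma(x')
   after a rigid motion", the last coordinate axis being carried by e. *)
Definition bounded_lipschitz_domain (D : set 'rV[R]_n) : Prop :=
  [/\ D !=set0, open D, connected D, bounded_set D &
      forall x0, (closure D `\` D) x0 ->
      exists e : 'rV[R]_n, exists gamma : 'rV[R]_n -> R, exists r L : R,
        [/\ enorm e = 1, 0 < r,
            forall y z, `|gamma y - gamma z| <= L * enorm (y - z) &
            forall x, eball x0 r x ->
              (D x <-> gamma (x - edot x e *: e) < edot x e)]].

Record finsler_minkowski (H : 'rV[R]_n -> R) : Prop := {
  finsler_ge0 : forall xi, 0 <= H xi ;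
  finsler_C1 : class_C 1 [set xi | xi != 0] H ;
  finsler_convex : forall (xi eta : 'rV[R]_n) (t : R), 0 <= t <= 1 ->
    H (t *: xi + (1 - t) *: eta) <= t * H xi + (1 - t) * H eta ;
  finsler_strict : forall xi eta : 'rV[R]_n,
    ~ (exists2 t : R, 0 <= t & xi = t *: eta) ->
    ~ (exists2 t : R, 0 <= t & eta = t *: xi) ->
    H (xi + eta) < H xi + H eta ;
  finsler_eq0 : forall xi, H xi = 0 <-> xi = 0 ;
  finsler_homog : forall (t : R) (xi : 'rV[R]_n), H (t *: xi) = `|t| * H xi ;
  finsler_equiv : exists c1 c2 : R, [/\ 0 < c1, 0 < c2 &
    forall xi, c1 * enorm xi <= H xi <= c2 * enorm xi]
}.

End euclidean.

Section weights.
Context {R : realType} {N : nat}.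
Local Notation leb := (lebesgue_rV N).
Implicit Types (w : 'rV[R]_N -> R) (D : set 'rV[R]_N).

Definition L1 D (f : 'rV[R]_N -> R) : Prop :=
  leb.-integrable D (EFin \o f).

Definition L1loc D (f : 'rV[R]_N -> R) : Prop :=
  measurable_fun D f /\
  (forall K, K `<=` D -> compact K -> (\int[leb]_(x in K) `|f x|%:E < +oo)%E).

Definition Lp (m : R) D (f : 'rV[R]_N -> R) : Prop :=
  measurable_fun D f /\ (\int[leb]_(x in D) (`|f x| `^ m)%:E < +oo)%E.

Definition weight w : Prop :=
  L1loc setT w /\ {ae leb, forall x, 0 < w x}.

Definition average D (f : 'rV[R]_N -> R) : \bar R :=
  (((fine (leb D))^-1)%:E * \int[leb]_(x in D) (f x)%:E)%E.

Definition Ap (p : R) w : Prop :=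
  weight w /\
  exists2 C : R, 0 < C & forall (c : 'rV[R]_N) (r : R), 0 < r ->
    (average (eball c r) w *
     average (eball c r) (fun x => w x `^ (- (p - 1)^-1))%R `^ (p - 1)
       <= C%:E)%E.

Definition Apt (p t : R) D w : Prop :=
  Ap p w /\ L1 D (fun x => w x `^ (- t)).

Definition range_t (p : R) : set R :=
  [set t | (p - 1)^-1 < t /\ N%:R / p < t].

Definition exponent_pt (p t : R) : R := p * t / (t + 1).

Definition sobolev_conj (q : R) : R := N%:R * q / (N%:R - q).

Definition conj_exponent (l : R) : R := l / (l - 1).

(* The exponent m; for p_t = N it may be any real number l > 1. *)
Definition admissible_m (p t delta m : R) : Prop :=
  let pt := exponent_pt p t in
  [/\ pt < N%:R -> m = conj_exponent (sobolev_conj pt / (1 - delta)),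
      pt = N%:R -> 1 < m &
      N%:R < pt -> m = 1].

End weights.

Arguments range_t {R} N p.
Arguments sobolev_conj {R} N q.
Arguments admissible_m {R} N p t delta m.

Section problem.
Context {R : realType} {N : nat}.
Local Notation leb := (lebesgue_rV N).
Implicit Types (u v g : 'rV[R]_N -> R).
Variables (Omega : set 'rV[R]_N) (p s alpha : R).
Variables (H w : 'rV[R]_N -> R).

Definition is_weak_grad u (G : 'rV[R]_N -> 'rV[R]_N) : Prop :=
  [/\ L1loc Omega u, forall i, L1loc Omega (fun x => G x 0 i) &
      forall phi, class_Cc_oo Omega phi -> forall i,
        (\int[leb]_(x in Omega) (u x * grad phi x 0 i)%:E =
         - \int[leb]_(x in Omega) (G x 0 i * phi x)%:E)%E].

(* A choice of weak gradient, which is determined up to a null set; it is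
   meaningful only if u has one. *)
Definition wgrad u : 'rV[R]_N -> 'rV[R]_N := get (is_weak_grad u).

Definition wmeas (B : set 'rV[R]_N) : R :=
  fine (\int[leb]_(x in B) (w x)%:E)%E.

Definition kernel_K (x y : 'rV[R]_N) : R :=
  w x * w y / wmeas (eball (2^-1 *: (x + y)) (enorm (x - y) / 2)).

(* The density of mu with respect to dx dy. *)
Definition mu_density (x y : 'rV[R]_N) : R :=
  kernel_K x y / enorm (x - y) `^ (s * p).

Definition nonlocal_energy u : \bar R :=
  (\int[leb \x leb]_z
     (`|u z.1 - u z.2| `^ p * mu_density z.1 z.2)%:E)%E.

Definition energy u : \bar R :=
  (\int[leb]_(x in Omega) (H (wgrad u x) `^ p * w x)%:E
   + alpha%:E * nonlocal_energy u)%E.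

Definition Wnorm u : \bar R := (energy u `^ p^-1)%E.

Definition W_finite u : Prop :=
  [/\ measurable_fun setT u, {ae leb, forall x, ~ Omega x -> u x = 0},
      exists G, is_weak_grad u G & (Wnorm u < +oo)%E].

(* The closure of C_c^oo(Omega) is taken inside W_finite. *)
Definition W0 u : Prop :=
  W_finite u /\
  forall e : R, 0 < e ->
    exists2 phi, class_Cc_oo Omega phi & (Wnorm (u \- phi)%R < e%:E)%E.

Definition J_p (tau : R) : R := `|tau| `^ (p - 2) * tau.

(* H(xi)^(p-1) grad H (xi), set to 0 at xi = 0 where grad H is undefined. *)
Definition flux (xi : 'rV[R]_N) : 'rV[R]_N :=
  if xi == 0 then 0 else H xi `^ (p - 1) *: grad H xi.

(* Weak solutions of M_alpha u = g u^(-delta) in Omega, u > 0 in Omega,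
   u = 0 outside Omega, for a nonnegative g in L^1(Omega) \ {0}. *)
Definition weak_solution (delta : R) g u : Prop :=
  [/\ [/\ L1 Omega g, {ae leb, forall x, Omega x -> 0 <= g x} &
          ~ {ae leb, forall x, Omega x -> g x = 0}],
      W0 u,
      forall omega : set 'rV[R]_N,
        compact (closure omega) -> closure omega `<=` Omega ->
        exists2 C : R, 0 < C & {ae leb, forall x, omega x -> C <= u x} &
      forall phi, class_Cc 1 Omega phi ->
        (\int[leb]_(x in Omega)
             (edot (flux (wgrad u x)) (grad phi x) * w x)%:E
         + alpha%:E * \int[leb \x leb]_z
             (J_p (u z.1 - u z.2) * (phi z.1 - phi z.2)
                * mu_density z.1 z.2)%:E
         = \int[leb]_(x in Omega) (g x * u x `^ (- delta) * phi x)%:E)%E].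

Variables (delta : R) (f : 'rV[R]_N -> R).

Definition constraint v : \bar R :=
  (\int[leb]_(x in Omega) (`|v x| `^ (1 - delta) * f x)%:E)%E.

Definition S_delta : set ('rV[R]_N -> R) :=
  [set v | W0 v /\ constraint v = 1%E].

Definition Theta : \bar R := ereal_inf [set energy v | v in S_delta].

Definition zeta_delta u : R :=
  fine (\int[leb]_(x in Omega) (u x `^ (1 - delta) * f x)%:E)%E
    `^ (- (1 - delta)^-1).

Definition V_delta u : 'rV[R]_N -> R := fun x => zeta_delta u * u x.

End problem.

(* Main.v *)
Require Import Defs.
From HB Require Import structures.
From mathcomp Require Import all_boot all_order all_algebra.
From mathcomp Require Import all_classical all_reals all_analysis.
From mathcomp Require Import measurable_realfun.
From mathcomp Require Import ring lra zify.

(* Write E(v) for the energy and c for E(u).  Testing the weak formulation with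
   smooth approximations of |v|, Young's inequality and Fatou's lemma give
     \int f u^-delta |v| <= (p - 1)/p E(u) + E(v)/p
   first for smooth v, then for all v in W0 by approximation; hence the weak
   formulation holds for all test functions in W0.  With v = u this reads
   \int f u^(1 - delta) = c.  The AM-GM inequality
   |v|^(1 - delta) u^delta <= (1 - delta) |v| + delta u, multiplied by
   f u^-delta and integrated, then shows that E(v) <= c implies
   \int f |v|^(1 - delta) <= c, and the minimality of V_delta follows by
   homogeneity.  Uniqueness comes from the monotonicity of the flux of H, the
   strict monotonicity of J_p, and the fact that tau^-delta is decreasing. *)

Set Implicit Arguments.
Unset Strict Implicit.
Unset Printing Implicit Defensive.

Import Order.TTheory GRing.Theory Num.Theory.
Import numFieldNormedType.Exports.

Local Open Scope classical_set_scope.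
Local Open Scope ring_scope.

(** * Borel sets and Lebesgue measure of R^N *)

Section rV_borel.
Context {R : realType} {n : nat}.
Implicit Types (A D : set 'rV[R]_n) (x y c a b : 'rV[R]_n).

(** The density [f u^-delta] may be singular at the boundary, so its integrability against functions
    of [W0] has to be drawn from the equation itself. This is why nonnegative approximations of
    [|v|] serve as test functions: Fatou's lemma then asks only for almost everywhere convergence
    and a bound on the energies. The convergence comes from the nonlocal term. With one variable
    frozen at a point [x0] outside [Omega], where all functions vanish, the energy dominates an
    [L^p] norm with the positive weight [mu_density x0]. The same anchoring turns a vanishing
    nonlocal gap into equality of two solutions, so strict monotonicity is asked of [J_p] alone. The
    bound on the energies comes from the convexity of [t^p], used with a free parameter. Weak
    gradients are arbitrary choices; integration by parts and the du Bois-Reymond lemma make them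
    unique almost everywhere. Functions of finite energy are handled with real-valued integrals, but
    the equation of [V_delta] is checked in the extended reals, because its test functions range
    over all of [C_c^1]. *)

Lemma rV_ballP x (e : R) y : 0 < e ->
  ball x e y <-> forall i, `|x 0 i - y 0 i| < e.
Proof.
move=> e0; split=> [[_ h] i|h]; first exact: h.
by split=> // i j; rewrite (ord1 i); exact: h.
Qed.

Definition obox (a b : 'rV[R]_n) : set 'rV[R]_n :=
  [set x | forall i, `]a 0 i, b 0 i[%classic (x 0 i)].

Definition cbox (a b : 'rV[R]_n) : set 'rV[R]_n :=
  [set x | forall i, `[a 0 i, b 0 i]%classic (x 0 i)].

Lemma measurable_rV_prod (B : 'I_n -> set (measurableTypeR R)) :
  (forall i, measurable (B i)) ->
  measurable [set x : 'rV[R]_n | forall i, B i (x 0 i)].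
Proof.
move=> mB; rewrite (_ : mkset _ =
    \bigcap_(i in setT) [set x : 'rV[R]_n | B i (x 0 i)]); last first.
  by apply/seteqP; split=> [x Ax i _|x Ax i]; [exact: Ax|exact: (Ax i I)].
apply: fin_bigcap_measurable => // i _.
rewrite -[X in measurable X]setTI; exact: (measurable_coord i measurableT (mB i)).
Qed.

Lemma measurable_obox a b : measurable (obox a b).
Proof.
apply: (@measurable_rV_prod (fun i => `]a 0 i, b 0 i[%classic)) => i.
exact: measurable_itv.
Qed.

Lemma measurable_cbox a b : measurable (cbox a b).
Proof.
apply: (@measurable_rV_prod (fun i => `[a 0 i, b 0 i]%classic)) => i.
exact: measurable_itv.
Qed.

Definition ratrV (q : 'rV[rat]_n) : 'rV[R]_n := map_mx ratr q.

Lemma ratrV_dense x (e : R) : 0 < e ->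
  exists q, forall i, `|x 0 i - ratrV q 0 i| < e.
Proof.
move=> e0.
have /choice[q hq] : forall i, exists q : rat, `|x 0 i - ratr q| < e.
  move=> i; have /rat_in_itvoo[q] : x 0 i - e < x 0 i + e by lra.
  rewrite in_itv/= => /andP[h1 h2]; exists q.
  by rewrite distrC ltr_norml; apply/andP; split; lra.
by exists (\row_i q i) => i; rewrite !mxE.
Qed.

(** Rational corners keep the family countable, as almost everywhere arguments require. The open box
    serves for covering; the closed one is a compact subset of [D], on which local integrability and
    cutoffs are available. *)
Lemma obox_dense D x : open D -> D x ->
  exists ab : 'rV[rat]_n * 'rV[rat]_n,
    [/\ forall i, ratrV ab.1 0 i < ratrV ab.2 0 i,
        obox (ratrV ab.1) (ratrV ab.2) x &
        cbox (ratrV ab.1) (ratrV ab.2) `<=` D].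
Proof.
move=> oD Dx; have := open_nbhs_nbhs (conj oD Dx).
move=> /nbhs_ballP[e /= e0 eD].
have e4 : 0 < e / 4 by rewrite divr_gt0.
(* Approximating [x] shifted by [e / 4] with error below [e / 4] puts each rational corner strictly
   on its own side of [x], at distance less than [e / 2]. *)
have [q1 h1] := ratrV_dense (x - const_mx (e / 4)) e4.
have [q2 h2] := ratrV_dense (x + const_mx (e / 4)) e4.
have {}h1 i : x 0 i - e / 2 < ratrV q1 0 i < x 0 i.
  have := h1 i; rewrite 2![in X in `|X|]mxE [in X in `|X|]mxE ltr_norml.
  by move=> /andP[? ?]; apply/andP; split; lra.
have {}h2 i : x 0 i < ratrV q2 0 i < x 0 i + e / 2.
  have := h2 i; rewrite [in X in `|X|]mxE [in X in `|X|]mxE ltr_norml.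
  by move=> /andP[? ?]; apply/andP; split; lra.
exists (q1, q2); split => /= [i|i|y hy].
- by have := h1 i; have := h2 i; lra.
- by rewrite /= in_itv/=; have := h1 i; have := h2 i; lra.
apply: eD; apply/rV_ballP => // i; rewrite ltr_norml.
by have := hy i; rewrite /= in_itv/=; have := h1 i; have := h2 i; lra.
Qed.

Lemma open_bigcup_obox D : open D ->
  D = \bigcup_(ab in [set ab | cbox (ratrV ab.1) (ratrV ab.2) `<=` D])
        obox (ratrV ab.1) (ratrV ab.2).
Proof.
move=> oD; apply/seteqP; split=> [x /(obox_dense oD)[ab [_ h1 h2]]|x [ab abD h]].
  by exists ab.
by apply: abD => i; have := h i; rewrite /= !in_itv/=; lra.
Qed.

(** The sigma-algebra is generated by the coordinates, so open sets enter it through the countable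
    base of rational boxes. *)
Lemma open_measurable_rV D : open D -> measurable D.
Proof.
move=> oD; rewrite (open_bigcup_obox oD) bigcup_mkcond.
apply: countable_bigcupT_measurable; first exact: countableP.
by move=> ab; case: ifP => _; [exact: measurable_obox|exact: measurable0].
Qed.

Lemma closed_measurable_rV D : closed D -> measurable D.
Proof.
by move=> cD; rewrite -(setCK D); apply: measurableC; apply: open_measurable_rV;
  rewrite openC.
Qed.

Lemma continuous_on_measurable D (f : 'rV[R]_n -> R) : open D ->
  (forall x, D x -> {for x, continuous f}) -> measurable_fun D f.
Proof.
move=> oD cf; apply: (measurability _ (RGenOInfty.measurableE R)).
move=> /= _ [_ [a ->]] <-; apply: open_measurable_rV.
rewrite openE => x [Dx fx]; rewrite /interior.
apply: filterI; first exact: open_nbhs_nbhs.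
by apply: cf => //; apply: open_nbhs_nbhs; split => //; exact: interval_open.
Qed.

Lemma continuous_measurable_rV (f : 'rV[R]_n -> R) :
  continuous f -> measurable_fun setT f.
Proof.
move=> cf; apply: continuous_on_measurable; first exact: openT.
by move=> x _; exact: cf.
Qed.

Lemma measurable_fun_rV_on d (T : measurableType d) (B : set T)
    (f : T -> 'rV[R]_n) :
  measurable B -> (forall i, measurable_fun B (fun z => f z 0 i)) ->
  measurable_fun B f.
Proof.
move=> mB mf; pose coord := fun (i : 'I_n) (x : 'rV[R]_n) => x 0 i.
apply: (measurability (\big[setU/set0]_i
  (preimage_set_system setT (coord i) measurable)) erefl).
move=> _ [A + <-]; rewrite -bigcup_seq => -[i _ [C mC <-]] /=.
by rewrite setTI; have := mf i mB C mC.
Qed.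

Lemma compact_cbox a b : compact (cbox a b).
Proof.
apply: (@rV_compact _ _ (fun i => `[a 0 i, b 0 i]%classic)) => i.
exact: segment_compact.
Qed.

Lemma closed_cbox a b : closed (cbox a b).
Proof. by apply: compact_closed; [exact: norm_hausdorff|exact: compact_cbox]. Qed.

Lemma obox_sub_cbox a b : obox a b `<=` cbox a b.
Proof. by move=> x h i; have := h i; rewrite /= !in_itv/=; lra. Qed.

Lemma lebesgue_obox a b : (forall i, a 0 i < b 0 i) ->
  lebesgue_rV n (obox a b) = (\prod_i (b 0 i - a 0 i))%:E.
Proof.
move=> ab; rewrite (lebesgue_rV_box (A := fun i => `]a 0 i, b 0 i[%classic)).
  by rewrite -prodEFin; apply: eq_bigr => i _; rewrite lebesgue_measure_itv/= lte_fin ab.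
by move=> i; exact: measurable_itv.
Qed.

Lemma lebesgue_cbox a b : (forall i, a 0 i < b 0 i) ->
  lebesgue_rV n (cbox a b) = (\prod_i (b 0 i - a 0 i))%:E.
Proof.
move=> ab; rewrite (lebesgue_rV_box (A := fun i => `[a 0 i, b 0 i]%classic)).
  by rewrite -prodEFin; apply: eq_bigr => i _; rewrite lebesgue_measure_itv/= lte_fin ab.
by move=> i; exact: measurable_itv.
Qed.

Lemma lebesgue_obox_gt0 a b : (forall i, a 0 i < b 0 i) ->
  (0 < lebesgue_rV n (obox a b))%E.
Proof.
move=> ab; rewrite lebesgue_obox// lte_fin; apply: prodr_gt0 => i _.
by rewrite subr_gt0.
Qed.

Lemma coord_le_norm x i : `|x 0 i| <= `|x|.
Proof.
rewrite [leRHS]/Num.norm/= mx_normrE; apply/bigmax_geP; right => /=.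
by exists (0, i).
Qed.

Lemma bounded_cbox D : bounded_set D ->
  exists2 M : R, 0 < M & D `<=` cbox (const_mx (- M)) (const_mx M).
Proof.
move=> [M [_ hM]]; exists (`|M| + 1); first by rewrite ltr_wpDl.
have h : M < `|M| + 1 by rewrite (le_lt_trans (ler_norm _))// ltrDl.
move=> x /(hM _ h)/= xM i; rewrite /= !mxE in_itv/= -ler_norml.
exact: le_trans (coord_le_norm x i) xM.
Qed.

Lemma edot_measurable d (T : measurableType d) (B : set T) (f g : T -> 'rV[R]_n) :
  measurable B ->
  (forall i, measurable_fun B (fun z => f z 0 i)) ->
  (forall i, measurable_fun B (fun z => g z 0 i)) ->
  measurable_fun B (fun z => edot (f z) (g z)).
Proof.
move=> mB mf mg; rewrite /edot.
by apply: measurable_sum => i; apply: measurable_funM.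
Qed.

Lemma enorm_measurable d (T : measurableType d) (B : set T) (f : T -> 'rV[R]_n) :
  measurable B -> (forall i, measurable_fun B (fun z => f z 0 i)) ->
  measurable_fun B (fun z => enorm (f z)).
Proof.
move=> mB mf; rewrite /enorm.
apply: (measurableT_comp (f := @Num.sqrt R)) => //.
  by apply: continuous_measurable_fun; exact: sqrt_continuous.
exact: edot_measurable.
Qed.

Lemma coord_le_enorm x i : `|x 0 i| <= enorm x.
Proof.
rewrite /enorm -sqrtr_sqr ler_wsqrtr// /edot (bigD1 i)//= expr2 lerDl.
by apply: sumr_ge0 => j _; rewrite -expr2 sqr_ge0.
Qed.

Lemma enorm_gt0 x : (0 < enorm x) = (x != 0).
Proof.
apply/idP/idP => [|x0].
  apply: contraTneq => ->; rewrite /enorm /edot big1 ?sqrtr0 ?ltxx// => i _.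
  by rewrite mxE mulr0.
have [i xi] : exists i, x 0 i != 0.
  apply/existsP; apply: contraNT x0; rewrite negb_exists => /forallP h.
  by apply/eqP/rowP => i; rewrite mxE; have := h i; rewrite negbK => /eqP.
by apply: lt_le_trans (coord_le_enorm x i); rewrite normr_gt0.
Qed.

(** The divisor [n.+1] is meaningful in dimension 0 and leaves room for the strict inequality, as
    [n < (n + 1)^2]. *)
Lemma enorm_lt x (r : R) : 0 < r -> (forall i, `|x 0 i| < r / n.+1%:R) -> enorm x < r.
Proof.
move=> r0 h; rewrite /enorm -[ltRHS](gtr0_norm r0) -sqrtr_sqr ltr_sqrt ?exprn_gt0//.
have r1 : 0 < r / n.+1%:R by rewrite divr_gt0.
apply: (@le_lt_trans _ _ (\sum_(i < n) (r / n.+1%:R) ^+ 2)).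
  apply: ler_sum => i _; rewrite -expr2 -(real_normK (num_real (x 0 i))).
  by apply: lerXn2r; rewrite ?nnegrE ?normr_ge0 ?(ltW r1) ?(ltW (h i)).
rewrite sumr_const card_ord -[ltLHS]mulr_natl expr_div_n.
rewrite mulrCA gtr_pMr ?exprn_gt0// ltr_pdivrMr ?exprn_gt0// mul1r.
by rewrite -natrX ltr_nat expnS expn1 mulSn; lia.
Qed.

Lemma measurable_eball c (r : R) : measurable (eball c r).
Proof.
rewrite -[X in measurable X]setTI.
have : measurable_fun setT (fun y => enorm (y - c)).
  apply: enorm_measurable => // i; under eq_fun do rewrite !mxE.
  by apply: measurable_funB => //; exact: measurable_coord.
move=> /(_ measurableT `]-oo, r[%classic (measurable_itv _)).
by rewrite (_ : _ @^-1` _ = eball c r)//; apply/seteqP; split => x; rewrite /eball/= in_itv/=.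
Qed.

Lemma eball_obox c (r : R) : 0 < r -> exists a b,
  [/\ forall i, a 0 i < b 0 i, obox a b `<=` eball c r &
      eball c r `<=` cbox (c - const_mx r) (c + const_mx r)].
Proof.
move=> r0; pose e := r / n.+1%:R; have e0 : 0 < e by rewrite divr_gt0.
exists (c - const_mx e), (c + const_mx e); split => [i|x h|x /= h i].
- by rewrite !mxE; lra.
- rewrite /eball/=; apply: enorm_lt => // i; rewrite !mxE.
  by have := h i; rewrite /= in_itv/= !mxE ltr_norml -/e; lra.
- have := le_lt_trans (coord_le_enorm _ i) h.
  by rewrite /= !mxE in_itv/= ltr_norml; lra.
Qed.

Lemma eball_gt0 c (r : R) : 0 < r -> (0 < lebesgue_rV n (eball c r))%E.
Proof.
move=> r0; have [a [b [ab abr _]]] := eball_obox c r0.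
apply: (lt_le_trans (lebesgue_obox_gt0 ab)); apply: le_measure => //;
  rewrite inE; [exact: measurable_obox|exact: measurable_eball].
Qed.

End rV_borel.

(** * Calculus of C^k functions and smooth bumps *)

Section directional.
Context {R : realType} {V : normedModType R}.
Implicit Types (f g : V -> R) (x v : V).

(** A directional derivative is the derivative at 0 along a line, so the rules of one real variable,
    the chain rule among them, become available in every direction. *)
Lemma is_derive_line f x v (df : R) :
  is_derive x v f df <-> is_derive (0 : R) 1 (fun h => f (h *: v + x)) df.
Proof.
have E : (fun h => h^-1 *: ((f \o shift x) (h *: v) - f x)) =
    (fun h : R => h^-1 *: (((fun h => f (h *: v + x)) \o shift 0) (h *: 1)
                     - f (0 *: v + x))).
  by apply/funext => h /=; rewrite addr0 scale0r add0r; congr (_ *: (f (_ *: _ + _) - _));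
    rewrite /GRing.scale/= mulr1.
by split=> -[h1 h2]; split; rewrite /derivable /derive ?E -?E// in h1 h2 *.
Qed.

Lemma is_derive_chain f (g : R -> R) x v (df dg : R) :
  is_derive x v f df -> is_derive (f x) 1 g dg ->
  is_derive x v (fun y => g (f y)) (dg * df).
Proof.
move=> /is_derive_line hf hg; apply/is_derive_line.
apply: (@is_derive1_comp _ g (fun h => f (h *: v + x))).
by rewrite /= scale0r add0r.
Qed.

Lemma is_deriveMf f g x v (df dg : R) :
  is_derive x v f df -> is_derive x v g dg ->
  is_derive x v (fun y => f y * g y) (f x * dg + g x * df).
Proof. exact: is_deriveM. Qed.

End directional.

Section class_C_calculus.
Context {R : realType} {n : nat}.
Implicit Types (f g : 'rV[R]_n -> R) (D : set 'rV[R]_n) (k : nat).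

Lemma is_derive_coord (i : 'I_n) (x v : 'rV[R]_n) :
  is_derive x v (fun y => y 0 i) (v 0 i).
Proof.
apply/is_derive_line.
rewrite (_ : (fun h : R => _) = (fun h : R => h) * cst (v 0 i) + cst (x 0 i)); last first.
  by apply/funext => h; rewrite !mxE.
have := is_deriveD (is_deriveM (is_derive_id (0 : R) 1)
  (is_derive_cst (v 0 i) (0 : R) 1)) (is_derive_cst (x 0 i) (0 : R) 1).
by rewrite /= scaler0 add0r addr0 /GRing.scale/= mulr1.
Qed.

Lemma continuous_coord (i : 'I_n) : continuous (fun y : 'rV[R]_n => y 0 i).
Proof. exact: coord_continuous. Qed.

Lemma class_C_continuous k f : class_C k setT f -> continuous f.
Proof. by case: k => [|k] [cf _] x; exact: cf. Qed.

Lemma class_C0 f : continuous f -> class_C 0 setT f.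
Proof. by move=> cf; split; [move=> x _; exact: (cf x)|]. Qed.

Lemma continuousDf f g : continuous f -> continuous g ->
  continuous (fun x => f x + g x).
Proof. by move=> cf cg x; exact: (cvgD (cf x) (cg x)). Qed.

Lemma continuousMf f g : continuous f -> continuous g ->
  continuous (fun x => f x * g x).
Proof. by move=> cf cg x; exact: (cvgM (cf x) (cg x)). Qed.

Lemma class_CS k f : class_C k.+1 setT f -> class_C k setT f.
Proof.
elim: k f => [f [cf _]|k IH f [cf Hf]]; first by split.
by split=> // i; have [d1 d2] := Hf i; split=> //; exact: IH.
Qed.

Lemma class_C_derivable k f x i :
  class_C k.+1 setT f -> is_derive x (basis_rV i) f ('D_(basis_rV i) f x).
Proof. by move=> [_ h]; apply/derivableP; exact: (h i).1. Qed.

Lemma class_CI k f (df : 'I_n -> 'rV[R]_n -> R) :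
  (forall i x, is_derive x (basis_rV i) f (df i x)) ->
  continuous f -> (forall i, class_C k setT (df i)) -> class_C k.+1 setT f.
Proof.
move=> hf cf hdf; split=> [x _|i]; first exact: (cf x).
split=> [x _|]; first by have := hf i x; case.
have -> : 'D_(basis_rV i) f = df i; last exact: hdf.
by apply/funext => x; have := hf i x => -[].
Qed.

Lemma class_C_cst k (c : R) : @class_C R n k setT (fun=> c).
Proof.
elim: k c => [|k IH] c; first by split=> // x _; exact: cst_continuous.
apply: (@class_CI _ _ (fun _ _ => 0)) => //.
by move=> x; exact: cst_continuous.
Qed.

Lemma class_CD k f g : class_C k setT f -> class_C k setT g ->
  class_C k setT (fun x => f x + g x).
Proof.
elim: k f g => [|k IH] f g Cf Cg.
  apply: class_C0; apply: continuousDf; first exact: class_C_continuous Cf.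
  exact: class_C_continuous Cg.
apply: (@class_CI _ _
  (fun i x => 'D_(basis_rV i) f x + 'D_(basis_rV i) g x)).
- by move=> i x; exact: (is_deriveD (class_C_derivable x i Cf) (class_C_derivable x i Cg)).
- by apply: continuousDf; [exact: class_C_continuous Cf|exact: class_C_continuous Cg].
- by move=> i; apply: IH; [exact: (Cf.2 i).2|exact: (Cg.2 i).2].
Qed.

Lemma class_CM k f g : class_C k setT f -> class_C k setT g ->
  class_C k setT (fun x => f x * g x).
Proof.
elim: k f g => [|k IH] f g Cf Cg.
  apply: class_C0; apply: continuousMf; first exact: class_C_continuous Cf.
  exact: class_C_continuous Cg.
apply: (@class_CI _ _
  (fun i x => f x * 'D_(basis_rV i) g x + g x * 'D_(basis_rV i) f x)).
- by move=> i x; exact: (is_deriveMf (class_C_derivable x i Cf) (class_C_derivable x i Cg)).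
- by apply: continuousMf; [exact: class_C_continuous Cf|exact: class_C_continuous Cg].
- move=> i; apply: class_CD; apply: IH; try exact: class_CS.
    exact: (Cg.2 i).2.
  exact: (Cf.2 i).2.
Qed.

Lemma class_CN k f : class_C k setT f -> class_C k setT (fun x => - f x).
Proof.
move=> Cf; rewrite (_ : (fun _ => _) = (fun x => -1 * f x)).
  by apply: class_CM => //; exact: class_C_cst.
by apply/funext => x; rewrite mulN1r.
Qed.

Lemma class_CB k f g : class_C k setT f -> class_C k setT g ->
  class_C k setT (fun x => f x - g x).
Proof. by move=> Cf Cg; apply: class_CD => //; exact: class_CN. Qed.

Lemma class_CX k f m : class_C k setT f -> class_C k setT (fun x => f x ^+ m).
Proof.
move=> Cf; elim: m => [|m IH]; first exact: class_C_cst.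
by under eq_fun do rewrite exprS; exact: class_CM.
Qed.

Lemma class_C_prod k m (F : 'I_m -> 'rV[R]_n -> R) :
  (forall i, class_C k setT (F i)) -> class_C k setT (fun x => \prod_i F i x).
Proof.
elim: m F => [|m IH] F CF.
  by under eq_fun do rewrite big_ord0; exact: class_C_cst.
by under eq_fun do rewrite big_ord_recl; apply: class_CM => //; exact: IH.
Qed.

End class_C_calculus.

(** * Flat functions and smooth cutoffs of boxes *)

Section bump.
Context {R : realType}.

(** The functions [t^-m exp(-1/t)], extended by 0. Derivatives of members are linear combinations of
    members, so smoothness of [flat 0] is proved by an induction over the whole family. *)
Definition flat (m : nat) (t : R) : R :=
  if 0 < t then t^-1 ^+ m * expR (- t^-1) else 0.

Lemma flat_ge0 m t : 0 <= flat m t.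
Proof.
rewrite /flat; case: ifP => // t0.
by rewrite mulr_ge0 ?expR_ge0 ?exprn_ge0 ?invr_ge0 ?ltW.
Qed.

Lemma flat0_lt1 t : flat 0 t < 1.
Proof.
rewrite /flat; case: ifP => // t0.
by rewrite expr0 mul1r expR_lt1 oppr_lt0 invr_gt0.
Qed.

Lemma flat0_eq0 t : (flat 0 t != 0) = (0 < t).
Proof.
rewrite /flat; case: ifP => // t0; last by rewrite eqxx.
by rewrite expr0 mul1r gt_eqF ?expR_gt0.
Qed.

(** This is [exp y >= y^(m+2) / (m+2)!] at [y = 1/t]. The bound is quadratic in order that the
    difference quotient at 0 tend to 0. *)
Lemma flat_le m t : 0 < t -> flat m t <= (m.+2)`!%:R * t ^+ 2.
Proof.
move=> t0; rewrite /flat t0 expRN.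
have ti0 : 0 < t^-1 by rewrite invr_gt0.
have := expR_ge1Dxn m.+1 (ltW ti0) => h.
have {}h : t^-1 ^+ m.+2 / (m.+2)`!%:R <= expR t^-1.
  by apply: le_trans h; rewrite lerDr.
have f0 : 0 < (m.+2)`!%:R :> R by rewrite ltr0n fact_gt0.
rewrite ler_pdivrMr ?expR_gt0//.
apply: le_trans (ler_wpM2l _ h); last by rewrite mulr_ge0 ?sqr_ge0 ?ltW.
rewrite (exprS t^-1 m.+1) (exprS t^-1 m); move: (t^-1 ^+ m) => y.
rewrite (_ : _ * (_ / _) = y)//.
by field; rewrite !gt_eqF.
Qed.

Lemma is_derive_flat m (t : R) :
  is_derive t 1 (flat m) (flat m.+2 t - m%:R * flat m.+1 t).
Proof.
have [t0|t0|t0] := ltgtP t 0.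
- apply: (@near_eq_is_derive _ _ _ (cst 0)).
    near=> s; rewrite /flat ifF//; apply/negbTE; rewrite -leNgt ltW//.
    by near: s; exact: lt_nbhsl.
  rewrite /flat ltNge (ltW t0)/= mulr0 subr0; exact: is_derive_cst.
- apply: (@near_eq_is_derive _ _ _ (fun s : R => s^-1 ^+ m * expR (- s^-1))).
    near=> s; rewrite /flat ifT//.
    by near: s; exact: lt_nbhsr.
  rewrite /flat t0.
  have d1 : is_derive t 1 (fun s : R => s^-1) (- t ^- 2 *: 1).
    by apply: is_deriveV; rewrite gt_eqF.
  have d2 : is_derive t 1 (fun s : R => s^-1 ^+ m)
      ((m%:R * t^-1 ^+ m.-1) * (- t ^- 2)).
    have := is_deriveX m d1; rewrite exprfctE => /is_derive_eq; apply.
    by rewrite /GRing.scale/= mulr1.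
  have d3 := @is_derive1_comp R expR (fun s : R => - s^-1) t _ _
    (is_derive_expR (- t^-1)) (is_deriveN d1).
  apply: (is_derive_eq (is_deriveMf d2 d3)).
  rewrite /= /GRing.scale/= -!exprVn mulr1.
  case: m {d2} => [|m]; rewrite ?exprS/=; ring.
- rewrite t0; have -> : flat m.+2 (0:R) - m%:R * flat m.+1 0 = 0.
    by rewrite /flat ltxx mulr0 subr0.
  (* At the junction the quotient is 0 for [h <= 0] and at most [(m+2)! * h] for [h > 0]. *)
  have h : h^-1 *: ((flat m \o shift (0:R)) (h *: 1) - flat m 0) @[h --> 0^'] --> (0:R).
    apply/cvgr0Pnorm_le => e e0.
    have f0 : 0 < (m.+2)`!%:R :> R by rewrite ltr0n fact_gt0.
    near=> h.
    have h0 : h != 0 by near: h; exact: nbhs_dnbhs_neq.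
    have hs : `|h| < e / (m.+2)`!%:R.
      near: h; apply: dnbhs0_lt; exact: divr_gt0.
    rewrite /= /GRing.scale/= mulr1 addr0 {2}/flat ltxx subr0.
    have [hn|hp] := leP h 0; first by rewrite /flat ltNge hn/= mulr0 normr0 ltW.
    rewrite ger0_norm ?mulr_ge0 ?flat_ge0 ?invr_ge0 ?(ltW hp)//.
    rewrite ler_pdivrMl//; apply: le_trans (flat_le m hp) _.
    move: hs; rewrite gtr0_norm// ltr_pdivlMr// => hs.
    rewrite expr2 mulrA mulrC ler_pM2l// mulrC; exact: ltW.
  by split; [apply/cvg_ex; exists 0|apply/cvg_lim].
Unshelve. all: by end_near. Qed.

Lemma continuous_flat m : continuous (flat m).
Proof.
move=> t; apply: differentiable_continuous; apply/derivable1_diffP.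
by have [] := is_derive_flat m t.
Qed.

Context {n : nat}.

(** The index [m] stays general in the induction on [k], because each derivative raises it by one or
    two. *)
Lemma class_C_flat_affine k m (c d : R) (i : 'I_n) :
  class_C k setT (fun x : 'rV[R]_n => flat m (c * x 0 i + d)).
Proof.
have ca : continuous (fun x : 'rV[R]_n => c * x 0 i + d).
  apply: continuousDf; last by move=> x; exact: cst_continuous.
  apply: continuousMf; first by move=> x; exact: cst_continuous.
  exact: continuous_coord.
have cc j : continuous (fun x : 'rV[R]_n => flat j (c * x 0 i + d)).
  by move=> x; apply: (continuous_comp (ca x)); exact: continuous_flat.
elim: k m => [|k IH] m; first exact: class_C0.
apply: (@class_CI _ _ _ _ (fun j x => (flat m.+2 (c * x 0 i + d) -
   m%:R * flat m.+1 (c * x 0 i + d)) * (c * (basis_rV j : 'rV[R]_n) 0 i))).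
- move=> j x.
  apply: (is_derive_chain (f := fun x : 'rV[R]_n => c * x 0 i + d)); last exact: is_derive_flat.
  have := is_deriveD (is_deriveMf (is_derive_cst c x (basis_rV j))
    (is_derive_coord i x (basis_rV j))) (is_derive_cst d x (basis_rV j)).
  by rewrite mulr0 !addr0.
- exact: cc.
- move=> j; apply: class_CM; last exact: class_C_cst.
  apply: class_CB; first exact: IH.
  by apply: class_CM; [exact: class_C_cst|exact: IH].
Qed.

Definition bump (a b : 'rV[R]_n) (x : 'rV[R]_n) : R :=
  \prod_i (flat 0 (x 0 i - a 0 i) * flat 0 (b 0 i - x 0 i)).

Lemma class_C_bump k a b : class_C k setT (bump a b).
Proof.
apply: class_C_prod => i; apply: class_CM.
  have := class_C_flat_affine k 0 1 (- a 0 i) i.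
  by under eq_fun do rewrite mul1r.
have := class_C_flat_affine k 0 (-1) (b 0 i) i.
by under eq_fun do rewrite mulN1r addrC.
Qed.

Lemma bump_ge0 a b x : 0 <= bump a b x.
Proof. by apply: prodr_ge0 => i _; rewrite mulr_ge0 ?flat_ge0. Qed.

Lemma bump_le1 a b x : bump a b x <= 1.
Proof.
apply: prodr_ile1 => i _; rewrite mulr_ge0 ?flat_ge0//=.
by rewrite mulr_ile1 ?flat_ge0 ?(ltW (flat0_lt1 _)).
Qed.

Lemma bump_neq0 a b x : (bump a b x != 0) <-> obox a b x.
Proof.
rewrite /bump; split=> [h i|h].
  move: h; rewrite prodf_seq_neq0 => /allP/(_ i (mem_index_enum i))/=.
  by rewrite mulf_eq0 negb_or !flat0_eq0 in_itv/= !subr_gt0.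
apply/prodf_neq0 => i _; have := h i.
by rewrite /= mulf_eq0 negb_or !flat0_eq0 in_itv/= !subr_gt0.
Qed.

(** Since [0 < bump <= 1] exactly on the open box, [(1 - bump)^m] tends to 0 there and stays equal
    to 1 elsewhere. The indicator of the box is thus a pointwise limit of smooth functions sharing
    one compact support. *)
Definition box_cutoff (a b : 'rV[R]_n) (m : nat) (x : 'rV[R]_n) : R :=
  1 - (1 - bump a b x) ^+ m.

Lemma box_cutoff_ge0 a b m x : 0 <= box_cutoff a b m x.
Proof.
by rewrite subr_ge0 exprn_ile1 ?subr_ge0 ?bump_le1// lerBlDr lerDl bump_ge0.
Qed.

Lemma box_cutoff_le1 a b m x : box_cutoff a b m x <= 1.
Proof. by rewrite lerBlDr lerDl exprn_ge0 ?subr_ge0 ?bump_le1. Qed.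

Lemma box_cutoff_out a b m x : ~ obox a b x -> box_cutoff a b m x = 0.
Proof.
move=> h; have /eqP b0 : bump a b x == 0.
  by apply/negP => /negP /bump_neq0.
by rewrite /box_cutoff b0 subr0 expr1n subrr.
Qed.

Lemma box_cutoff_cvg a b x :
  box_cutoff a b m x @[m --> \oo] --> (\1_(obox a b) x : R).
Proof.
rewrite indicE; case: (boolP (x \in obox a b)) => xab; last first.
  rewrite (_ : (fun m => _) = (fun=> 0)); last first.
    by apply/funext => m; apply: box_cutoff_out; rewrite notin_setE in xab.
  exact: cvg_cst.
rewrite inE in xab; rewrite -[X in _ --> X]subr0; apply: cvgB; first exact: cvg_cst.
apply: cvg_expr; rewrite ger0_norm ?subr_ge0 ?bump_le1//.
by rewrite ltrBlDr ltrDl lt_neqAle eq_sym bump_ge0 andbT; exact/bump_neq0.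
Qed.

Lemma box_cutoff_Cc_oo (D : set 'rV[R]_n) a b m :
  cbox a b `<=` D -> class_Cc_oo D (box_cutoff a b m).
Proof.
move=> abD k.
have sub : closure [set x | box_cutoff a b m x != 0] `<=` cbox a b.
  have /closure_id cE := closed_cbox (a := a) (b := b); rewrite [X in _ `<=` X]cE.
  apply: closure_subset => x /= h; apply: obox_sub_cbox.
  by apply: contrapT => /box_cutoff_out xx; rewrite xx eqxx in h.
split.
- apply: class_CB; first exact: class_C_cst.
  apply: class_CX; apply: class_CB; first exact: class_C_cst.
  exact: class_C_bump.
- by apply: (subclosed_compact _ _ sub); [exact: closed_closure|exact: compact_cbox].
- exact: subset_trans sub abD.
Qed.

End bump.

Section class_Cc_theory.
Context {R : realType} {n : nat}.
Implicit Types (f g : 'rV[R]_n -> R) (D : set 'rV[R]_n) (k : nat).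

Lemma class_Cc_sub k l D f g : class_Cc k D f -> class_C l setT g ->
  (forall x, g x != 0 -> closure [set y | f y != 0] x) -> class_Cc l D g.
Proof.
move=> [_ cptf suppf] Cg sub.
have cl : closure [set y | g y != 0] `<=` closure [set y | f y != 0].
  have /closure_id cE := @closed_closure _ [set y : 'rV[R]_n | f y != 0].
  by rewrite [X in _ `<=` X]cE; apply: closure_subset.
split=> //; last exact: subset_trans cl suppf.
by apply: (subclosed_compact _ cptf cl); exact: closed_closure.
Qed.

Lemma class_CcB k D f g : class_Cc k D f -> class_Cc k D g ->
  class_Cc k D (fun x => f x - g x).
Proof.
move=> [Cf cptf sf] [Cg cptg sg].
have sub : closure [set x | f x - g x != 0] `<=`
    closure [set x | f x != 0] `|` closure [set x | g x != 0].
  rewrite -closureU; apply: closure_subset => x /=; apply: contraPP.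
  move=> /not_orP[/negP + /negP]; rewrite !negbK => /eqP -> /eqP ->.
  by rewrite subrr eqxx.
split.
- exact: class_CB.
- apply: (subclosed_compact _ _ sub); first exact: closed_closure.
  exact: compactU.
- by apply: subset_trans sub _ => x [/sf|/sg].
Qed.

Lemma class_CcM k D f g : class_Cc k D f -> class_C k setT g ->
  class_Cc k D (fun x => f x * g x).
Proof.
move=> Cf Cg; apply: (class_Cc_sub Cf); first by apply: class_CM => //; case: Cf.
by move=> x h; apply: subset_closure => /=; apply: contraNneq h => ->; rewrite mul0r.
Qed.

Lemma class_Cc_S k D f : class_Cc k.+1 D f -> class_Cc k D f.
Proof. by move=> [Cf cf sf]; split=> //; exact: class_CS. Qed.

Lemma class_Cc_out k D f x : class_Cc k D f ->
  ~ closure [set y | f y != 0] x -> f x = 0.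
Proof.
move=> _ h; apply/eqP/negPn/negP => fx; apply: h.
exact: subset_closure.
Qed.

Lemma class_Cc_derive k D f i :
  class_Cc k.+1 D f -> class_Cc k D ('D_(basis_rV i) f).
Proof.
move=> Cf; apply: (class_Cc_sub Cf); first by have [Cf1 _ _] := Cf; exact: (Cf1.2 i).2.
move=> x; apply: contraNP => h.
rewrite (_ : 'D_(basis_rV i) f x = 'D_(basis_rV i) (cst 0) x).
  by rewrite derive_cst.
apply: near_eq_derive.
have /open_nbhs_nbhs : open_nbhs x (~` closure [set y | f y != 0]).
  by split=> //; rewrite openC; exact: closed_closure.
by apply: filterS => y /= hy; exact: class_Cc_out Cf hy.
Qed.

Lemma class_Cc_bounded k D f : class_Cc k D f ->
  exists2 M : R, 0 < M & forall x, `|f x| <= M.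
Proof.
move=> Cf; have [Cf1 cf sf] := Cf.
have /compact_bounded[M [_ hM]] : compact (f @` closure [set x | f x != 0]).
  apply: continuous_compact => //; apply: continuous_subspaceT.
  exact: class_C_continuous Cf1.
exists (`|M| + 1); first by rewrite ltr_wpDl.
have h : M < `|M| + 1 by rewrite (le_lt_trans (ler_norm _))// ltrDl.
move=> x; have [fx|fx] := pselect (closure [set x | f x != 0] x).
  by apply: (hM _ h); exists x.
by rewrite (class_Cc_out Cf fx) normr0 addr_ge0.
Qed.

Lemma class_Cc_support_box k D f : class_Cc k D f ->
  exists2 M : R, 0 < M &
    forall x, ~ cbox (const_mx (- M)) (const_mx M) x -> f x = 0.
Proof.
move=> Cf; have [_ /compact_bounded/bounded_cbox[M M0 h] _] := Cf.
by exists M => // x hx; apply: (class_Cc_out Cf) => /h.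
Qed.

Lemma class_Cc_out_dom k D f x : class_Cc k D f -> ~ D x -> f x = 0.
Proof. by move=> Cf Dx; apply: (class_Cc_out Cf); have [_ _ sf] := Cf => /sf. Qed.

End class_Cc_theory.

(** * A smooth approximation of the absolute value *)

Section smooth_abs.
Context {R : realType}.
Implicit Types (e a b : R).

(** Subtracting [e] makes the function vanish at 0, so composition with it preserves compact
    supports, and keeps it between 0 and [|a|]. *)
Definition smooth_abs e a : R := Num.sqrt (a ^+ 2 + e ^+ 2) - e.

Lemma sqrt_sqrD_gt0 e a : 0 < e -> 0 < Num.sqrt (a ^+ 2 + e ^+ 2).
Proof. by move=> e0; rewrite sqrtr_gt0 ltr_wpDl ?sqr_ge0 ?exprn_gt0. Qed.

Lemma smooth_abs_ge0 e a : 0 < e -> 0 <= smooth_abs e a.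
Proof.
move=> e0; rewrite subr_ge0 -[leLHS](gtr0_norm e0) -sqrtr_sqr.
by rewrite ler_wsqrtr// lerDr sqr_ge0.
Qed.

Lemma smooth_abs_le e a : 0 < e -> smooth_abs e a <= `|a|.
Proof.
move=> e0; rewrite lerBlDr -[leRHS]ger0_norm ?addr_ge0 ?(ltW e0)//.
rewrite -sqrtr_sqr ler_wsqrtr// sqrrD real_normK ?num_real//.
by rewrite -addrA lerD2l lerDr mulrn_wge0// mulr_ge0 ?(ltW e0).
Qed.

Lemma smooth_abs_ge e a : 0 < e -> `|a| - e <= smooth_abs e a.
Proof. by move=> e0; rewrite lerD2r -sqrtr_sqr ler_wsqrtr// lerDl sqr_ge0. Qed.

(** The reverse triangle inequality in the plane for the points [(a, e)] and [(b, e)]. *)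
Lemma smooth_abs_lip e a b : 0 < e ->
  `|smooth_abs e a - smooth_abs e b| <= `|a - b|.
Proof.
move=> e0; rewrite /smooth_abs opprB addrA subrK.
set s := Num.sqrt _; set t := Num.sqrt _.
have s0 : 0 < s by exact: sqrt_sqrD_gt0.
have t0 : 0 < t by exact: sqrt_sqrD_gt0.
have sE : s ^+ 2 = a ^+ 2 + e ^+ 2 by rewrite sqr_sqrtr// addr_ge0 ?sqr_ge0.
have tE : t ^+ 2 = b ^+ 2 + e ^+ 2 by rewrite sqr_sqrtr// addr_ge0 ?sqr_ge0.
(* Cauchy-Schwarz for [(a, e)] and [(b, e)]; the difference of the squares is [(a e - b e)^2]. *)
have st : a * b + e ^+ 2 <= s * t.
  have [h|h] := leP (a * b + e ^+ 2) 0.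
    by apply: le_trans h _; rewrite mulr_ge0 ?ltW.
  rewrite -(@ler_sqr _ _ (s * t)) ?nnegrE ?(ltW h) ?(mulr_ge0 (ltW s0) (ltW t0))//.
  rewrite exprMn sE tE -subr_ge0.
  rewrite (_ : _ - _ = (a * e - b * e) ^+ 2) ?sqr_ge0//; ring.
rewrite -(@ler_sqr _ _ `|a - b|) ?nnegrE// !real_normK ?num_real//.
rewrite !sqrrB sE tE -subr_ge0.
rewrite (_ : _ - _ = 2 * (s * t - (a * b + e ^+ 2))); last by clear; ring.
by rewrite mulr_ge0// subr_ge0.
Qed.

Lemma smooth_abs0 e : 0 < e -> smooth_abs e 0 = 0.
Proof. by move=> e0; rewrite /smooth_abs expr0n add0r sqrtr_sqr gtr0_norm// subrr. Qed.

Lemma smooth_abs_cvg a :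
  smooth_abs (m.+1%:R^-1) a @[m --> \oo] --> `|a|.
Proof.
apply: (@squeeze_cvgr _ _ _ _ (fun m => `|a| - m.+1%:R^-1) (cst `|a|)).
- near=> m; rewrite smooth_abs_le ?invr_gt0// andbT.
  by apply: smooth_abs_ge; rewrite invr_gt0.
- rewrite -[X in _ --> X]subr0; apply: cvgB; first exact: cvg_cst.
  exact: cvg_harmonic.
- exact: cvg_cst.
Unshelve. all: by end_near. Qed.

Context {n : nat}.

Lemma is_derive_smooth_abs e (f : 'rV[R]_n -> R) x v df : 0 < e ->
  is_derive x v f df ->
  is_derive x v (fun y => smooth_abs e (f y))
    (f x / Num.sqrt (f x ^+ 2 + e ^+ 2) * df).
Proof.
move=> e0 hf; set s := Num.sqrt _.
have s0 : 0 < s by exact: sqrt_sqrD_gt0.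
apply: is_derive_chain => //.
have d1 : is_derive (f x) 1 (fun a : R => a ^+ 2 + e ^+ 2) (2 * f x).
  have := is_deriveD (is_deriveMf (is_derive_id (f x) 1) (is_derive_id (f x) 1))
    (is_derive_cst (e ^+ 2) (f x) 1).
  move=> /is_derive_eq; apply; rewrite /=; ring.
have e2 : 0 < f x ^+ 2 + e ^+ 2 by rewrite ltr_wpDl ?sqr_ge0 ?exprn_gt0.
have d2 := @is_derive1_comp R Num.sqrt _ (f x) _ _ (is_derive1_sqrt e2) d1.
have := is_deriveB d2 (is_derive_cst e (f x) 1).
move=> /is_derive_eq; apply; rewrite /= subr0 -/s.
by field; rewrite gt_eqF.
Qed.

Lemma continuous_smooth_abs e : continuous (smooth_abs e).
Proof.
move=> a; apply: cvgB; last exact: cvg_cst.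
apply: continuous_comp; last exact: sqrt_continuous.
by apply: cvgD; [exact: exprn_continuous|exact: cvg_cst].
Qed.

Lemma class_Cc_smooth_abs e D (f : 'rV[R]_n -> R) : 0 < e ->
  class_Cc 1 D f -> class_Cc 1 D (fun x => smooth_abs e (f x)).
Proof.
move=> e0 Cf; have [Cf1 _ _] := Cf; have cf := class_C_continuous Cf1.
apply: (class_Cc_sub Cf); last first.
  move=> x h; apply: subset_closure => /=; apply: contraNneq h => ->.
  by rewrite smooth_abs0.
apply: (@class_CI _ _ _ _ (fun i x =>
    f x / Num.sqrt (f x ^+ 2 + e ^+ 2) * 'D_(basis_rV i) f x)).
- by move=> i x; apply: is_derive_smooth_abs => //; exact: class_C_derivable Cf1.
- by move=> x; apply: (continuous_comp (cf x)); exact: continuous_smooth_abs.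
- move=> i; apply: class_C0; apply: continuousMf.
    apply: continuousMf => //.
    have cs : continuous (fun x => Num.sqrt (f x ^+ 2 + e ^+ 2)).
      move=> x; apply: (continuous_comp (cf x) (g := fun a => Num.sqrt (a ^+ 2 + e ^+ 2))).
      apply: continuous_comp; last exact: sqrt_continuous.
      by apply: cvgD; [exact: exprn_continuous|exact: cvg_cst].
    by move=> x; exact: (cvgV (lt0r_neq0 (sqrt_sqrD_gt0 (f x) e0)) (cs x)).
  exact: (class_C_continuous (k := 0) (Cf1.2 i).2).
Qed.

Lemma grad_smooth_abs e (f : 'rV[R]_n -> R) x : 0 < e ->
  class_C 1 setT f -> grad (fun y => smooth_abs e (f y)) x =
    (f x / Num.sqrt (f x ^+ 2 + e ^+ 2)) *: grad f x.
Proof.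
move=> e0 Cf; apply/rowP => i; rewrite !mxE.
by have [_] := is_derive_smooth_abs e0 (class_C_derivable x i Cf).
Qed.

Lemma smooth_abs_slope e a : 0 < e ->
  `|a / Num.sqrt (a ^+ 2 + e ^+ 2)| <= 1.
Proof.
move=> e0; have s0 := sqrt_sqrD_gt0 a e0.
rewrite normrM normfV (gtr0_norm s0) ler_pdivrMr// mul1r -sqrtr_sqr.
by rewrite ler_wsqrtr// lerDl sqr_ge0.
Qed.

End smooth_abs.

(** * Integration by parts and weak gradients *)

Section box_supported.
Context {R : realType} {n : nat}.
Implicit Types (f g : 'rV[R]_n -> R) (M : R).
Local Notation leb := (lebesgue_rV n).

(** A condition on a fixed cube passes to the slices of a function with the same [M], which suits an
    induction on the dimension. *)
Definition box_supported M f : Prop :=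
  forall x, ~ cbox (const_mx (- M)) (const_mx M) x -> f x = 0.

Lemma box_supported_bounded M f : continuous f -> box_supported M f ->
  exists2 K : R, 0 <= K & forall x, `|f x| <= K.
Proof.
move=> cf sf; pose Q : set 'rV[R]_n := cbox (const_mx (- M)) (const_mx M).
have /compact_bounded[K [_ hK]] : compact (f @` Q).
  apply: continuous_compact; last exact: compact_cbox.
  exact: continuous_subspaceT.
exists (`|K| + 1); first by rewrite addr_ge0.
have h : K < `|K| + 1 by rewrite (le_lt_trans (ler_norm _))// ltrDl.
move=> x; have [xQ|xQ] := pselect (Q x); first by apply: (hK _ h); exists x.
by rewrite sf// normr0 addr_ge0.
Qed.

Lemma box_supported_integrable M f : 0 < M -> continuous f ->
  box_supported M f -> leb.-integrable setT (EFin \o f).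
Proof.
move=> M0 cf sf; pose Q : set 'rV[R]_n := cbox (const_mx (- M)) (const_mx M).
have [K K0 hK] := box_supported_bounded cf sf.
have mQ : measurable Q by exact: measurable_cbox.
have -> : EFin \o f = (EFin \o f) \_ Q.
  apply/funext => x; rewrite patchE; case: ifPn => //= xQ.
  by rewrite sf// => /mem_set; apply/negP.
apply/(integrable_mkcond _ mQ); apply: measurable_bounded_integrable => //.
- have : (lebesgue_rV n Q < +oo)%E; last by [].
  by rewrite /Q lebesgue_cbox ?ltry// => i; rewrite !mxE; lra.
- exact: (measurable_funS measurableT (@subsetT _ Q) (continuous_measurable_rV cf)).
- by exists K; split; [exact: num_real|move=> z Kz x _; exact: le_trans (hK x) (ltW Kz)].
Qed.

Lemma box_supported_derive M f v : box_supported M f ->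
  box_supported M ('D_v f).
Proof.
move=> sf x xQ; rewrite (_ : 'D_v f x = 'D_v (cst 0) x); first by rewrite derive_cst.
apply: near_eq_derive.
have /open_nbhs_nbhs : open_nbhs x (~` cbox (const_mx (- M)) (const_mx M)).
  by split=> //; rewrite openC; exact: closed_cbox.
by apply: filterS => y; exact: sf.
Qed.

End box_supported.

Section integral_derive.
Context {R : realType}.

Lemma cons_rV_line (n : nat) (t s : R) (y z : 'rV[R]_n) (h : R) :
  cons_rV (h * s + t, h *: z + y) = h *: cons_rV (s, z) + cons_rV (t, y).
Proof.
apply/rowP => i; rewrite [RHS]mxE [X in _ = X + _]mxE.
by case: (unliftP ord0 i) => [j|] ->; rewrite ?cons_rVS ?cons_rV0 // !mxE.
Qed.

Lemma basis_rV0 (n : nat) : basis_rV (ord0 : 'I_n.+1) = cons_rV (1 : R, 0).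
Proof.
apply/rowP => i; rewrite [LHS]mxE; case: (unliftP ord0 i) => [j|] ->.
  by rewrite cons_rVS mxE eqxx.
by rewrite cons_rV0 !eqxx.
Qed.

Lemma basis_rVS (n : nat) (j : 'I_n) :
  basis_rV (lift ord0 j) = cons_rV (0 : R, basis_rV j).
Proof.
apply/rowP => i; rewrite [LHS]mxE; case: (unliftP ord0 i) => [k|] ->.
  by rewrite cons_rVS mxE eqxx/= (inj_eq lift_inj).
by rewrite cons_rV0 eqxx.
Qed.

Lemma continuous_cons_rV2 (n : nat) (t : R) :
  continuous (fun y : 'rV[R]_n => cons_rV (t, y)).
Proof.
move=> y A /= /nbhs_ballP[e /= e0 eA].
apply/nbhs_ballP; exists e => //= z yz; apply: eA.
apply/rV_ballP => // i; case: (unliftP ord0 i) => [j|] ->.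
  by rewrite !cons_rVS; move/(rV_ballP _ _ e0) : yz; exact.
by rewrite !cons_rV0 subrr normr0.
Qed.

Lemma continuous_cons_rV1 (n : nat) (y : 'rV[R]_n) :
  continuous (fun t : R => cons_rV (t, y)).
Proof.
move=> t A /= /nbhs_ballP[e /= e0 eA].
apply/nbhs_ballP; exists e => //= z yz; apply: eA.
apply/rV_ballP => // i; case: (unliftP ord0 i) => [j|] ->.
  by rewrite !cons_rVS subrr normr0.
by rewrite !cons_rV0.
Qed.

Lemma cbox_cons_rV (n : nat) (M t : R) (y : 'rV[R]_n) :
  cbox (const_mx (- M)) (const_mx M) (cons_rV (t, y)) <->
  - M <= t <= M /\ cbox (const_mx (- M)) (const_mx M) y.
Proof.
split=> [h|[h1 h2] i].
  split=> [|i]; first by have := h ord0; rewrite /= cons_rV0 !mxE in_itv/=.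
  by have := h (lift ord0 i); rewrite /= cons_rVS !mxE in_itv/=.
case: (unliftP ord0 i) => [j|] ->; rewrite /= ?cons_rVS ?cons_rV0 !mxE in_itv//=.
by have := h2 j; rewrite /= !mxE in_itv/=.
Qed.

Lemma integral_derive_line (F f : R -> R) (M : R) : 0 < M ->
  (forall t : R, is_derive t 1 F (f t)) -> continuous f ->
  (forall t, ~ (- M <= t <= M) -> F t = 0) ->
  (\int[lebesgue_measure]_t (f t)%:E = 0)%E.
Proof.
move=> M0 dF cf F0.
(* On the interval widened by 1, [F] vanishes at the endpoints by hypothesis, so the fundamental
   theorem of calculus gives 0 at once. *)
have f0 t : ~ (- (M + 1) <= t <= M + 1) -> f t = 0.
  move=> tM; have <- : 'D_1 F t = f t by have [_] := dF t.
  rewrite (_ : 'D_1 F t = 'D_1 (cst 0) t); first by rewrite derive_cst.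
  apply: near_eq_derive.
  have h1 : 0 < `|t| - M.
    rewrite subr_gt0 ltNge; apply/negP => h; apply: tM.
    by move: h; rewrite ler_norml; lra.
  near=> s; apply: F0 => hs.
  have : `|t - s| < `|t| - M by near: s; exact: nbhsx_ballx.
  have : `|s| <= M by rewrite ler_norml.
  have := lerB_dist t s; lra.
have cF : continuous F.
  move=> t; apply: differentiable_continuous; apply/derivable1_diffP.
  by have [] := dF t.
have -> : (fun t => (f t)%:E) = (EFin \o f) \_ `[- (M + 1), M + 1].
  apply/funext => t; rewrite patchE; case: ifPn => //= tM.
  by rewrite f0// => h; move/negP: tM; apply; rewrite inE/= in_itv/=.
rewrite -integral_mkcond (@continuous_FTC2 _ f F)//; last 4 first.
- by lra.
- exact: continuous_subspaceT.
- split; [by move=> t _; have [] := dF t|exact: cvg_at_right_filter (cF _)|].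
  exact: cvg_at_left_filter (cF _).
- by move=> t _; rewrite derive1E; have [_] := dF t.
by rewrite !F0 ?subee//; lra.
Unshelve. all: by end_near. Qed.

Local Open Scope ereal_scope.

Lemma integrable_cons_rV (n : nat) (g : 'rV[R]_n.+1 -> \bar R) :
  (lebesgue_rV n.+1).-integrable setT g ->
  (lebesgue_measure \x lebesgue_rV n).-integrable setT (g \o cons_rV).
Proof.
move=> /integrableP[mg gfin]; apply/integrableP; split.
  exact: measurableT_comp mg measurable_cons_rV.
apply: le_lt_trans gfin.
rewrite (_ : \int[lebesgue_rV n.+1]_x `|g x| =
  \int[pushforward (lebesgue_measure \x lebesgue_rV n) cons_rV]_x `|g x|)//.
rewrite ge0_integral_pushforward//; first exact: measurable_cons_rV.
exact: measurableT_comp.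
Qed.

Lemma integral_cons_rV (n : nat) (g : 'rV[R]_n.+1 -> \bar R) :
  (lebesgue_rV n.+1).-integrable setT g ->
  \int[lebesgue_rV n.+1]_x g x =
  \int[lebesgue_measure \x lebesgue_rV n]_z g (cons_rV z).
Proof.
move=> ig; have [mg _] := (integrableP _ _ _ ig).
exact: (integral_pushforward (@measurable_cons_rV R n) mg (integrable_cons_rV ig) measurableT).
Qed.

Local Open Scope ring_scope.

(** Lebesgue measure in dimension [n + 1] is the image under [cons_rV] of a product, and Fubini's
    theorem is used in the order that puts the differentiated variable inside: for the first
    coordinate the inner integral is one-dimensional, for the others the induction hypothesis
    applies to it. *)
Lemma integral_derive_rV (n : nat) (i : 'I_n) (h : 'rV[R]_n -> R) (M : R) :
  0 < M -> (forall x, derivable h x (basis_rV i)) ->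
  continuous ('D_(basis_rV i) h) -> box_supported M h ->
  (\int[lebesgue_rV n]_x ('D_(basis_rV i) h x)%:E = 0)%E.
Proof.
elim: n i h => [[]//|n IH i h M0 dh cdh sh].
have := box_supported_integrable M0 cdh (box_supported_derive (basis_rV i) sh).
move=> ig; rewrite (integral_cons_rV ig).
have ig' := integrable_cons_rV ig.
case: (unliftP ord0 i) => [j|] ij.
- rewrite -(integral12_prod_meas1 ig'); apply: integral0_eq => t _.
  rewrite /fubini_F/=.
  pose ht (y : 'rV[R]_n) := h (cons_rV (t, y)).
  have dE (y : 'rV[R]_n) : is_derive y (basis_rV j) ht
      ('D_(basis_rV i) h (cons_rV (t, y))).
    have /derivableP/is_derive_line := dh (cons_rV (t, y)).
    rewrite {1}ij basis_rVS => dd; apply/is_derive_line.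
    rewrite (_ : (fun _ => _) = (fun s : R =>
      h (s *: cons_rV (0, basis_rV j) + cons_rV (t, y))))//.
    by apply/funext => s; rewrite -cons_rV_line mulr0 add0r.
  have DE : 'D_(basis_rV j) ht =
      (fun y => 'D_(basis_rV i) h (cons_rV (t, y))).
    by apply/funext => y; have [_] := dE y.
  transitivity (\int[lebesgue_rV n]_y ('D_(basis_rV j) ht y)%:E)%E.
    by apply: eq_integral => y _; have [_ ->] := dE y.
  apply: IH; first exact: M0.
  + by move=> y; have [] := dE y.
  + rewrite DE => y.
    exact: (continuous_comp (@continuous_cons_rV2 n t y) (cdh _)).
  + by move=> y yM; apply: sh => /cbox_cons_rV[].
- rewrite -(integral21_prod_meas1 ig'); apply: integral0_eq => y _.
  rewrite /fubini_G/=.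
  apply: (@integral_derive_line (fun t => h (cons_rV (t, y))) _ M M0).
  + move=> t; have /derivableP/is_derive_line := dh (cons_rV (t, y)).
    rewrite {1}ij basis_rV0 => dd; apply/is_derive_line.
    rewrite (_ : (fun _ => _) = (fun s : R =>
      h (s *: cons_rV (1, 0) + cons_rV (t, y))))//.
    by apply/funext => s; rewrite -cons_rV_line scaler0 add0r.
  + by move=> t; exact: (continuous_comp (@continuous_cons_rV1 n y t) (cdh _)).
  + by move=> t tM; apply: sh => /cbox_cons_rV[].
Qed.

End integral_derive.

Section ae_countable.
Context d (T : measurableType d) (R : realType) (mu : {measure set T -> \bar R}).

Lemma ae_forall_countable (I : countType) (P : I -> set T) :
  (forall i, {ae mu, forall x, P i x}) -> {ae mu, forall x, forall i, P i x}.
Proof.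
move=> aeP.
have : {ae mu, forall x, forall k : nat,
    if @unpickle I k is Some i then P i x else True}.
  apply: ae_foralln => k; case: (unpickle k) => [i|]; first exact: aeP.
  exact: aeW.
by apply: filterS => x h i; have := h (pickle i); rewrite pickleK.
Qed.

End ae_countable.

Section open_boxes_generate.
Context {R : realType} {n : nat}.

Definition oboxes : set (set 'rV[R]_n) := [set A | exists a b, A = obox a b].

Lemma oboxI (a b c d : 'rV[R]_n) :
  obox a b `&` obox c d =
  obox (\row_i Num.max (a 0 i) (c 0 i)) (\row_i Num.min (b 0 i) (d 0 i)).
Proof.
apply/seteqP; split => [x [h1 h2] i|x h].
  have := h1 i; have := h2 i; rewrite /= !in_itv/= !mxE gt_max lt_min.
  by move=> /andP[-> ->] /andP[-> ->].
by split=> i; have := h i; rewrite /= !in_itv/= !mxE gt_max lt_min;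
  move=> /andP[/andP[? ?] /andP[? ?]]; apply/andP.
Qed.

Lemma setI_closed_oboxes : setI_closed oboxes.
Proof. by move=> _ _ [a [b ->]] [c [d ->]]; rewrite oboxI; do 2 eexists. Qed.

(** Open boxes form a generating family stable under intersection, as Dynkin induction requires. *)
Lemma measurable_oboxes : @measurable _ 'rV[R]_n = <<s oboxes >>.
Proof.
apply/seteqP; split => [A|A]; last first.
  apply: smallest_sub; first exact: sigma_algebra_measurable.
  by move=> _ [a [b ->]]; exact: measurable_obox.
apply: smallest_sub; first exact: smallest_sigma_algebra.
rewrite -bigcup_seq => _ [i _ [C mC <-]]; rewrite setTI.
pose S := [set C : set R | <<s oboxes >> ((fun x : 'rV[R]_n => x 0 i) @^-1` C)].
suff : S C by [].
have mS : (@RGenOpens.G R).-sigma.-measurable C.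
  by rewrite -RGenOpens.measurableE.
move: C mS {mC}; apply: smallest_sub.
  have [sa0 saC saU] := smallest_sigma_algebra setT oboxes.
  split => [|B SB|F SF]; rewrite /S/=.
  - by rewrite preimage_set0.
  - by rewrite setTD preimage_setC -setTD; exact: saC.
  - by rewrite preimage_bigcup; exact: saU.
move=> _ [x [y ->]].
(* The slab between [x] and [y] in direction [i] is the union of the boxes whose other sides are
   []-k, k[]. *)
have -> : S `]x, y[%classic = <<s oboxes >> (\bigcup_k
   obox (\row_j if j == i then x else - k%:R) (\row_j if j == i then y else k%:R)).
  rewrite /S/=; congr (<<s _ >> _); apply/seteqP; split => [z /= zxy|z [k _ h]].
    have [M M0 hM] : exists2 M : R, 0 < M & forall j, `|z 0 j| < M.
      exists (`|z| + 1) => [|j]; first by rewrite ltr_wpDl.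
      by rewrite (le_lt_trans (coord_le_norm z j))// ltrDl.
    exists (Num.truncn M).+1 => // j; rewrite /= !mxE; case: eqP => [->//|_].
    rewrite in_itv/= -ltr_norml (lt_trans (hM j))//; exact: truncnS_gt.
  by have := h i; rewrite /= !mxE eqxx.
have [_ _ saU] := smallest_sigma_algebra setT oboxes; apply: saU => k.
by apply: sub_gen_smallest; do 2 eexists.
Qed.

End open_boxes_generate.

(** * Local integrability and the du Bois-Reymond lemma *)

Section local_integrability.
Context {R : realType} {n : nat}.
Local Notation leb := (lebesgue_rV n).
Implicit Types (f g : 'rV[R]_n -> R) (D : set 'rV[R]_n).

Lemma class_Cc_box_supported k D f : class_Cc k D f ->
  exists2 M : R, 0 < M & box_supported M f.
Proof. by move=> /class_Cc_support_box[M M0 h]; exists M. Qed.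

Lemma class_Cc_measurable k D f : class_Cc k D f -> measurable_fun setT f.
Proof.
by move=> [/class_C_continuous cf _ _]; exact: continuous_measurable_rV.
Qed.

Lemma class_Cc_integrable k D f : class_Cc k D f ->
  leb.-integrable setT (EFin \o f).
Proof.
move=> Cf; have [M M0 h] := class_Cc_box_supported Cf.
by apply: (box_supported_integrable M0) => //; case: Cf => /class_C_continuous.
Qed.

Lemma integral_vanishing_out D (f : 'rV[R]_n -> \bar R) :
  (forall x, ~ D x -> f x = 0%E) ->
  (\int[leb]_(x in D) f x = \int[leb]_x f x)%E.
Proof.
move=> f0; rewrite integral_mkcond; congr (integral _ _ _).
apply/funext => x; rewrite patchE; case: ifPn => // xD.
by rewrite f0// => /mem_set; apply/negP.
Qed.

Lemma compact_measurable_rV D : compact D -> measurable D.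
Proof.
by move=> cD; apply: closed_measurable_rV; apply: compact_closed cD;
  exact: norm_hausdorff.
Qed.

Lemma L1locM_integrable k D f g : open D ->
  L1loc D f -> class_Cc k D g -> leb.-integrable D (EFin \o (fun x => f x * g x)).
Proof.
move=> oD [mf fK] Cg; have mD := open_measurable_rV oD.
have [M M0 gM] := class_Cc_bounded Cg; have [_ cg sg] := Cg.
set K := closure _ in cg sg; have mK := compact_measurable_rV cg.
have mg : measurable_fun D g.
  by apply: measurable_funS (class_Cc_measurable Cg).
have fi : leb.-integrable K (EFin \o f).
  apply/integrableP; split; last exact: fK.
  by apply/measurable_EFinP; apply: measurable_funS mf.
apply/(integrable_mkcond _ mD).
have -> : (EFin \o (fun x => f x * g x)) \_ D = (EFin \o (fun x => f x * g x)) \_ K.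
  apply/funext => x; rewrite !patchE; case: ifPn => xD; case: ifPn => xK //=.
    by rewrite (class_Cc_out Cg) ?mulr0// => /mem_set; apply/negP.
  by move: xD; rewrite (mem_set (sg x (set_mem xK))).
apply/(integrable_mkcond _ mK).
apply: (@le_integrable _ _ _ _ _ _ _ (fun x => M%:E * (EFin \o f) x)%E) => //.
- apply/measurable_EFinP; apply: measurable_funM; first exact: measurable_funS mf.
  exact: measurable_funS mg.
- move=> x Kx; rewrite lee_fin !normrM mulrC ler_wpM2r//.
  exact: le_trans (gM x) (ler_norm _).
- exact: integrableZl.
Qed.

Lemma L1loc_lin D f g (a b : R) : L1loc D f -> L1loc D g ->
  open D -> L1loc D (fun x => a * f x + b * g x).
Proof.
move=> [mf fK] [mg gK] oD; split.
  by apply: measurable_funD; apply: measurable_funM.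
move=> K KD cK; have mK := compact_measurable_rV cK.
have i1 : leb.-integrable K (EFin \o f).
  apply/integrableP; split; last exact: fK.
  by apply/measurable_EFinP; exact: (measurable_funS (open_measurable_rV oD) KD).
have i2 : leb.-integrable K (EFin \o g).
  apply/integrableP; split; last exact: gK.
  by apply/measurable_EFinP; exact: (measurable_funS (open_measurable_rV oD) KD).
by have /integrableP[_] := integrableD mK (integrableZl mK a i1) (integrableZl mK b i2).
Qed.

Lemma class_Cc_L1loc k D f : open D -> class_Cc k D f -> L1loc D f.
Proof.
move=> oD Cf; split.
  exact: (measurable_funS measurableT (@subsetT _ D) (class_Cc_measurable Cf)).
move=> K KD cK; have /integrableP[_] := integrableS measurableT
  (compact_measurable_rV cK) (@subsetT _ K) (class_Cc_integrable Cf).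
by [].
Qed.

(** The cutoffs are admissible test functions tending to the indicator of the box; [|f|], integrable
    on the compact closed box, dominates. *)
Lemma integral_obox_eq0 D f (a b : 'rV[R]_n) : open D -> L1loc D f ->
  (forall phi, class_Cc_oo D phi -> (\int[leb]_(x in D) (f x * phi x)%:E = 0)%E) ->
  cbox a b `<=` D -> (\int[leb]_(x in obox a b) (f x)%:E = 0)%E.
Proof.
move=> oD fD f0 abD; have mD := open_measurable_rV oD.
have [mf fK] := fD; have mQ := measurable_obox a b.
have QD : obox a b `<=` D by apply: subset_trans abD; exact: obox_sub_cbox.
have fi : leb.-integrable (obox a b) (EFin \o f).
  apply: (@integrableS _ _ _ _ (cbox a b)) => //.
  - exact: measurable_cbox.
  - exact: obox_sub_cbox.
  apply/integrableP; split; last by apply: fK => //; exact: compact_cbox.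
  by apply/measurable_EFinP; apply: measurable_funS mf.
have E0 m : (\int[leb]_(x in obox a b) (f x * box_cutoff a b m x)%:E = 0)%E.
  rewrite -[RHS](f0 (box_cutoff a b m)); last exact: box_cutoff_Cc_oo.
  rewrite integral_vanishing_out; last first.
    by move=> x h; rewrite box_cutoff_out// mulr0.
  rewrite [RHS]integral_vanishing_out// => x h.
  by rewrite box_cutoff_out ?mulr0// => /QD.
have mfQ : measurable_fun (obox a b) (EFin \o f).
  by apply/measurable_EFinP; exact: measurable_funS mf.
have mfm m : measurable_fun (obox a b) (fun x => (f x * box_cutoff a b m x)%:E).
  apply/measurable_EFinP; apply: measurable_funM.
    exact: measurable_funS mf.
  apply: (measurable_funS measurableT (@subsetT _ _)).
  exact: class_Cc_measurable (box_cutoff_Cc_oo m abD 0).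
have cv : {ae leb, forall x, obox a b x ->
    (fun m => (f x * box_cutoff a b m x)%:E) @ \oo --> (EFin \o f) x}.
  apply: aeW => x Qx; apply/fine_cvgP; split; first by near=> m.
  rewrite -[X in _ --> X]mulr1; apply: cvgM; first exact: cvg_cst.
  by have := @box_cutoff_cvg R n a b x; rewrite indicE mem_set.
have dom : {ae leb, forall x m, obox a b x ->
    (`|(f x * box_cutoff a b m x)%:E| <= `|(EFin \o f) x|)%E}.
  apply: aeW => x m Qx; rewrite /= lee_fin normrM ler_piMr//.
  by rewrite ger0_norm ?box_cutoff_ge0 ?box_cutoff_le1.
have [_ _ h] := dominated_convergence mQ mfm mfQ cv (integrable_abse fi) dom.
rewrite -(cvg_lim _ h)//; apply/cvg_lim => //.
rewrite (_ : (fun _ => _) = cst 0%E); first exact: cvg_cst.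
by apply/funext => m; exact: E0.
Unshelve. all: by end_near. Qed.

(** Integrals over boxes vanish, hence by Dynkin induction those over all measurable subsets of a
    box, which gives [f = 0] almost everywhere in that box. Countably many rational boxes cover
    [D]. *)
Lemma du_bois_reymond D f : open D -> L1loc D f ->
  (forall phi, class_Cc_oo D phi -> (\int[leb]_(x in D) (f x * phi x)%:E = 0)%E) ->
  {ae leb, forall x, D x -> f x = 0}.
Proof.
move=> oD fD f0; have mD := open_measurable_rV oD; have [mf fK] := fD.
have H (ab : 'rV[rat]_n * 'rV[rat]_n) : cbox (ratrV ab.1) (ratrV ab.2) `<=` D ->
   {ae leb, forall x, obox (ratrV ab.1) (ratrV ab.2) x -> f x = 0}.
  move: (ratrV ab.1) (ratrV ab.2) => a b abD.
  have mQ := measurable_obox a b.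
  have QD : obox a b `<=` D by apply: subset_trans abD; exact: obox_sub_cbox.
  have fi : leb.-integrable (obox a b) (EFin \o f).
    apply: (@integrableS _ _ _ _ (cbox a b)) => //.
    - exact: measurable_cbox.
    - exact: obox_sub_cbox.
    apply/integrableP; split; last by apply: fK => //; exact: compact_cbox.
    by apply/measurable_EFinP; apply: measurable_funS mf.
  have fiS (S : set 'rV[R]_n) : measurable S ->
      leb.-integrable (obox a b `&` S) (EFin \o f).
    by move=> mS; apply: integrableS fi => //; exact: measurableI.
  have PQ : forall S, <<s oboxes >> S ->
      (\int[leb]_(x in obox a b `&` S) (EFin \o f) x = 0)%E.
    apply: dynkin_induction.
    - exact: measurable_oboxes.
    - exact: setI_closed_oboxes.
    - by rewrite setIT; exact: integral_obox_eq0 abD.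
    - move=> _ [c [e ->]]; rewrite oboxI; apply: (integral_obox_eq0 oD fD f0).
      apply: subset_trans abD => x h i; have := h i.
      by rewrite /= !in_itv/= !mxE ge_max le_min => /andP[/andP[-> _] /andP[-> _]].
    - move=> S mS S0; have := integral_obox_eq0 oD fD f0 abD.
      have -> : obox a b = (obox a b `&` S) `|` (obox a b `&` ~` S).
        by rewrite -setIUr setUv setIT.
      rewrite integral_setU.
      + rewrite -setIUr setUv setIT.
        by rewrite [X in (X + _)%E](_ : _ = 0%E)// add0e.
      + exact: measurableI.
      + by apply: measurableI => //; exact: measurableC.
      + by rewrite -setIUr setUv setIT; exact: measurable_int fi.
      + by apply/disj_setPS => x [[_ ?] [_ ?]].
    - move=> F mF tF F0; rewrite setI_bigcupr integral_bigcup.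
      + by rewrite eseries0// => k _ _; exact: F0.
      + exact: trivIset_setIl.
      + by move=> k; exact: measurableI.
      + by rewrite -setI_bigcupr; apply: fiS; exact: bigcupT_measurable.
  have : ae_eq leb (obox a b) (EFin \o f) (cst 0%E).
    apply: integral_ae_eq => // E EQ mE; rewrite integral_cst//= mul0e.
    by rewrite -(PQ E) ?(setIidr EQ)// -measurable_oboxes.
  by apply: filterS => x h /h [].
have {}H (ab : 'rV[rat]_n * 'rV[rat]_n) : {ae leb, forall x,
    cbox (ratrV ab.1) (ratrV ab.2) `<=` D ->
    obox (ratrV ab.1) (ratrV ab.2) x -> f x = 0}.
  have [abD|abD] := pselect (cbox (@ratrV R n ab.1) (ratrV ab.2) `<=` D).
    by have := H ab abD; apply: filterS => x hx _.
  exact: aeW.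
have := ae_forall_countable H; apply: filterS.
by move=> x h Dx; have [ab [_ h1 h2]] := obox_dense oD Dx; exact: (h ab h2 h1).
Qed.

End local_integrability.

(** * Weak gradients *)

Section weak_gradient.
Context {R : realType} {n : nat}.
Local Notation leb := (lebesgue_rV n).
Variable D : set 'rV[R]_n.
Hypothesis oD : open D.
Implicit Types (u v phi : 'rV[R]_n -> R) (G : 'rV[R]_n -> 'rV[R]_n).

Let mD : measurable D := open_measurable_rV oD.

Lemma class_Cc_grad k phi i : class_Cc k.+1 D phi ->
  class_Cc k D (fun x => grad phi x 0 i).
Proof.
move=> /(class_Cc_derive i); have -> // : (fun x => grad phi x 0 i) = 'D_(basis_rV i) phi.
by apply/funext => x; rewrite mxE.
Qed.

(** By the product rule this says that the integral of a partial derivative of [phi * psi] is 0, and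
    the product is supported in a cube. *)
Lemma is_weak_grad_classic phi : class_Cc 1 D phi ->
  is_weak_grad D phi (grad phi).
Proof.
move=> Cphi; split.
- exact: class_Cc_L1loc oD Cphi.
- move=> i; exact: (class_Cc_L1loc oD (class_Cc_grad i Cphi)).
move=> psi Cpsi i; have Cpsi1 := Cpsi 1%N.
have [Cphi1 _ _] := Cphi; have [Cpsi1' _ _] := Cpsi1.
have i1 : leb.-integrable setT (EFin \o (fun x => phi x * grad psi x 0 i)).
  apply: (class_Cc_integrable (k := 0) (D := D)).
  apply: class_CcM; first exact: class_Cc_S.
  by have [] := class_Cc_grad i Cpsi1.
have i2 : leb.-integrable setT (EFin \o (fun x => grad phi x 0 i * psi x)).
  apply: (class_Cc_integrable (k := 0) (D := D)).
  apply: class_CcM; first exact: class_Cc_grad.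
  exact: class_CS.
rewrite integral_vanishing_out; last first.
  by move=> x Dx; rewrite (class_Cc_out_dom Cphi Dx) mul0r.
rewrite [in RHS]integral_vanishing_out; last first.
  by move=> x Dx; rewrite (class_Cc_out_dom (class_Cc_grad i Cphi) Dx) mul0r.
have [M M0 sphi] := class_Cc_box_supported Cphi.
pose F (y : 'rV[R]_n) := phi y * psi y.
have Dprod x : is_derive x (basis_rV i) F
    (phi x * grad psi x 0 i + grad phi x 0 i * psi x).
  have := is_deriveMf (class_C_derivable x i Cphi1) (class_C_derivable x i Cpsi1').
  by rewrite !mxE [X in _ + X]mulrC.
have DE : 'D_(basis_rV i) F =
    (fun x => phi x * grad psi x 0 i + grad phi x 0 i * psi x).
  by apply/funext => x; have [_] := Dprod x.
have H0 : (\int[leb]_x (phi x * grad psi x 0 i + grad phi x 0 i * psi x)%:E = 0)%E.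
  transitivity (\int[leb]_x ('D_(basis_rV i) F x)%:E)%E.
    by apply: eq_integral => x _; have [_ ->] := Dprod x.
  apply: (integral_derive_rV M0).
  + by move=> x; have [] := Dprod x.
  + rewrite DE; apply: continuousDf; apply: continuousMf.
    * exact: class_C_continuous Cphi1.
    * by have [/class_C_continuous] := class_Cc_grad i Cpsi1.
    * by have [/class_C_continuous] := class_Cc_grad i Cphi.
    * exact: class_C_continuous Cpsi1'.
  + by move=> x xM; rewrite /F sphi// mul0r.
move: H0; rewrite (integralD_EFin measurableT i1 i2).
have f2 := integrable_fin_num measurableT i2.
set A := (X in (X + _)%E = _); move=> AB0.
by rewrite -[LHS](addeK A f2) AB0 add0e.
Qed.

Lemma is_weak_grad_lin u v G G' (a b : R) :
  is_weak_grad D u G -> is_weak_grad D v G' ->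
  is_weak_grad D (fun x => a * u x + b * v x) (fun x => a *: G x + b *: G' x).
Proof.
move=> [Lu LG wu] [Lv LG' wv]; split.
- exact: L1loc_lin.
- move=> i; rewrite (_ : (fun x => _) = (fun x => a * G x 0 i + b * G' x 0 i)).
    exact: L1loc_lin.
  by apply/funext => x; rewrite !mxE.
move=> phi Cphi i.
have iu := L1locM_integrable oD Lu (class_Cc_grad i (Cphi 1%N)).
have iv := L1locM_integrable oD Lv (class_Cc_grad i (Cphi 1%N)).
have iG := L1locM_integrable oD (LG i) (Cphi 0%N).
have iG' := L1locM_integrable oD (LG' i) (Cphi 0%N).
have L1 : (\int[leb]_(x in D) ((a * u x + b * v x) * grad phi x 0 i)%:E =
   a%:E * \int[leb]_(x in D) (u x * grad phi x 0 i)%:E +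
   b%:E * \int[leb]_(x in D) (v x * grad phi x 0 i)%:E)%E.
  rewrite -!integralZl// -integralD//; try exact: integrableZl.
  by apply: eq_integral => x _; rewrite /= -!EFinM -EFinD; congr (_%:E); ring.
have L2 : (\int[leb]_(x in D) ((a *: G x + b *: G' x) 0 i * phi x)%:E =
   a%:E * \int[leb]_(x in D) (G x 0 i * phi x)%:E +
   b%:E * \int[leb]_(x in D) (G' x 0 i * phi x)%:E)%E.
  rewrite -!integralZl// -integralD//; try exact: integrableZl.
  apply: eq_integral => x _; rewrite /= !mxE -!EFinM -EFinD; congr (_%:E); ring.
rewrite L1 L2 wu// wv// !muleN fin_num_oppeD//.
by rewrite fin_numM//; first [exact: (integrable_fin_num mD iG')|exact: (integrable_fin_num mD iG)].
Qed.

Lemma is_weak_grad_unique u G G' : is_weak_grad D u G -> is_weak_grad D u G' ->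
  {ae leb, forall x, D x -> G x = G' x}.
Proof.
move=> uG uG'; have := is_weak_grad_lin 1 (-1) uG uG'.
rewrite (_ : (fun x => _) = cst 0); last by apply/funext => x; rewrite mul1r mulN1r subrr.
move=> [_ LG wG].
have h i : {ae leb, forall x, D x -> (1 *: G x + -1 *: G' x) 0 i = 0}.
  apply: (du_bois_reymond oD (LG i)) => phi Cphi.
  have := wG phi Cphi i; rewrite integral0_eq; last by move=> x _; rewrite mul0r.
  by move=> /esym/eqP; rewrite oppe_eq0 => /eqP.
have := ae_forall_countable h; apply: filterS => x hx Dx.
by apply/rowP => i; have := hx i Dx; rewrite !mxE mul1r mulN1r => /eqP;
  rewrite subr_eq0 => /eqP.
Qed.

Lemma wgradP u G : is_weak_grad D u G -> is_weak_grad D u (wgrad D u).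
Proof. by move=> uG; exact: (getPex (ex_intro _ G uG)). Qed.

(** As [wgrad] is an arbitrary choice, this identity is the way to compute with it, and the
    computations hold only almost everywhere. *)
Lemma wgradE u G : is_weak_grad D u G ->
  {ae leb, forall x, D x -> wgrad D u x = G x}.
Proof. by move=> uG; exact: (is_weak_grad_unique (wgradP uG) uG). Qed.

Lemma wgrad_lin u v G G' (a b : R) :
  is_weak_grad D u G -> is_weak_grad D v G' ->
  {ae leb, forall x, D x -> wgrad D (fun x => a * u x + b * v x) x =
     a *: wgrad D u x + b *: wgrad D v x}.
Proof.
by move=> uG vG; apply: wgradE; apply: is_weak_grad_lin; [exact: wgradP uG|exact: wgradP vG].
Qed.

End weak_gradient.

(** * Power inequalities and J_p *)

Section real_powers.
Context {R : realType}.
Implicit Types (a b p d th : R).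

Lemma powR_young p a b : 1 < p -> 0 <= a -> 0 <= b ->
  a `^ (p - 1) * b <= (p - 1) / p * a `^ p + p^-1 * b `^ p.
Proof.
move=> p1 a0 b0; have p0 : 0 < p by lra.
have q0 : 0 < p / (p - 1) by rewrite divr_gt0// subr_gt0.
have pq : (p / (p - 1))^-1 + p^-1 = 1 by field; rewrite !gt_eqF ?subr_gt0.
have := conjugate_powR (powR_ge0 a (p - 1)) b0 q0 p0 pq.
rewrite -powRrM (_ : (p - 1) * _ = p); last by field; rewrite gt_eqF// subr_gt0.
by rewrite invf_div (mulrC (a `^ p)) (mulrC (b `^ p)).
Qed.

Lemma powR_am_gm d a b : 0 < d -> d < 1 -> 0 <= a -> 0 <= b ->
  a `^ (1 - d) * b `^ d <= (1 - d) * a + d * b.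
Proof.
move=> d0 d1 a0 b0; have d1' : 0 < 1 - d by rewrite subr_gt0.
have := @conjugate_powR _ (a `^ (1 - d)) (b `^ d) (1 - d)^-1 d^-1
  (powR_ge0 _ _) (powR_ge0 _ _).
rewrite !invr_gt0 !invrK subrK => /(_ d1' d0 erefl).
rewrite -!powRrM !mulfV ?gt_eqF// !powRr1//.
by rewrite (mulrC a) (mulrC b).
Qed.

(** Convexity of [t^p] at the combination [(1 - th) (a / (1 - th)) + th (b / th)]. As [th] tends to
    0 the coefficient of [a^p] tends to 1, which later controls the energy of a small
    perturbation. *)
Lemma powRD_convex p th a b : 1 < p -> 0 < th -> th < 1 -> 0 <= a -> 0 <= b ->
  (a + b) `^ p <= (1 - th) `^ (1 - p) * a `^ p + th `^ (1 - p) * b `^ p.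
Proof.
move=> p1 t0 t1 a0 b0; have t1' : 0 < 1 - th by rewrite subr_gt0.
have x0 : 0 <= a / (1 - th) by rewrite divr_ge0// ltW.
have y0 : 0 <= b / th by rewrite divr_ge0// ltW.
have t01 : th <= 1 by exact: ltW.
have := @convex_powR R p (ltW p1) (Itv01 (ltW t0) t01) (b / th) (a / (1 - th)).
rewrite !inE/= !in_itv/= !andbT => /(_ y0 x0).
rewrite !convRE/= /unstable.onem; set c := conv _ _ _.
have -> : (c : R) = a + b.
  transitivity (th * (b / th) + (1 - th) * (a / (1 - th))); first by [].
  by field; rewrite !gt_eqF.
move=> /le_trans; apply.
clear c; have E c y : 0 < c -> 0 <= y -> c * (y / c) `^ p = c `^ (1 - p) * y `^ p.
  move=> c0 y00; rewrite powRM ?invr_ge0 ?(ltW c0)//.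
  rewrite -(powR_inv1 (ltW c0)) -powRrM mulN1r.
  rewrite -{1}(powRr1 (ltW c0)) mulrCA -powRD ?(gt_eqF c0) ?implybT// mulrC.
  by congr (_ * _).
by rewrite !E// addrC.
Qed.

Lemma powR_monotone p a b : 1 < p -> 0 <= a -> 0 <= b ->
  0 <= (a `^ (p - 1) - b `^ (p - 1)) * (a - b).
Proof.
move=> p1; have p0 : 0 < p - 1 by rewrite subr_gt0.
wlog ab : a b / a <= b => [H a0 b0|a0 b0].
  have [ab|/ltW ab] := leP a b; first exact: H.
  by rewrite -mulrNN !opprB; exact: H.
rewrite mulr_le0// subr_le0//.
by apply: (ge0_ler_powR (ltW p0)).
Qed.

Lemma powR_monotone_eq0 p a b : 1 < p -> 0 <= a -> 0 <= b ->
  (a `^ (p - 1) - b `^ (p - 1)) * (a - b) = 0 -> a = b.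
Proof.
move=> p1 a0 b0 /eqP; have p0 : 0 < p - 1 by rewrite subr_gt0.
rewrite mulf_eq0 => /orP[]; rewrite subr_eq0 => /eqP //.
by apply: (powR_injective p0).
Qed.

Lemma J_p_mul p a : 1 < p -> J_p p a * a = `|a| `^ p.
Proof.
move=> p1; rewrite /J_p -mulrA -expr2 -real_normK ?num_real// expr2.
have [->|a0] := eqVneq a 0; first by rewrite normr0 !mulr0 powR0// gt_eqF//; lra.
have a00 : 0 < `|a| by rewrite normr_gt0.
rewrite mulrA -{2}(powRr1 (ltW a00)) -powRD ?(gt_eqF a00) ?implybT//.
rewrite -{2}(powRr1 (ltW a00)) -powRD ?(gt_eqF a00) ?implybT//.
by congr powR; ring.
Qed.

Lemma norm_J_p p a : 1 < p -> `|J_p p a| = `|a| `^ (p - 1).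
Proof.
move=> p1; rewrite /J_p normrM ger0_norm ?powR_ge0//.
have [->|a0] := eqVneq a 0.
  by rewrite normr0 mulr0 powR0// gt_eqF// subr_gt0.
have a00 : 0 < `|a| by rewrite normr_gt0.
rewrite -{2}(powRr1 (ltW a00)) -powRD ?(gt_eqF a00) ?implybT//.
by congr powR; ring.
Qed.

Lemma J_p_homog p a r : 1 < p -> 0 < r -> J_p p (r * a) = r `^ (p - 1) * J_p p a.
Proof.
move=> p1 r0; rewrite /J_p normrM (gtr0_norm r0) powRM// ?ltW//.
rewrite (_ : p - 1 = (p - 2) + 1); last by ring.
rewrite [in RHS]powRD ?(gt_eqF r0) ?implybT// powRr1 ?ltW//; ring.
Qed.

Lemma J_p_mul_le p a b : 1 < p -> J_p p a * b <= `|a| `^ (p - 1) * `|b|.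
Proof. by move=> p1; rewrite -norm_J_p// -normrM ler_norm. Qed.

(** The cross terms [J_p p a * b] are at most [|a|^(p-1) |b|], which reduces the claim to the
    monotonicity of [t^(p-1)] at [|a|] and [|b|]. *)
Lemma J_p_monotone p a b : 1 < p -> 0 <= (J_p p a - J_p p b) * (a - b).
Proof.
move=> p1; apply: le_trans (powR_monotone p1 (normr_ge0 a) (normr_ge0 b)) _.
rewrite !mulrBl !mulrBr !J_p_mul//.
have m c : `|c| `^ (p - 1) * `|c| = `|c| `^ p.
  by rewrite mulrC mulr_powRB1//; lra.
rewrite !m; have := J_p_mul_le a b p1; have := J_p_mul_le b a p1; lra.
Qed.

(** Equality in the comparison with absolute values forces [|a| = |b|]; the expression then equals
    [|a|^(p-2) (a - b)^2]. *)
Lemma J_p_monotone_eq0 p a b : 1 < p -> (J_p p a - J_p p b) * (a - b) = 0 -> a = b.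
Proof.
move=> p1 h.
have m c : `|c| `^ (p - 1) * `|c| = `|c| `^ p.
  by rewrite mulrC mulr_powRB1//; lra.
have ab : `|a| = `|b|.
  apply: (powR_monotone_eq0 p1) => //; apply/eqP.
  rewrite eq_le powR_monotone// andbT; move: h.
  rewrite !mulrBl !mulrBr !J_p_mul// !m.
  by have := J_p_mul_le a b p1; have := J_p_mul_le b a p1; lra.
have [a0|a0] := eqVneq a 0.
  by move: ab; rewrite a0 normr0 => /esym/eqP; rewrite normr_eq0 => /eqP.
have c0 : 0 < `|a| `^ (p - 2) by rewrite powR_gt0// normr_gt0.
move: h; rewrite /J_p -ab -mulrBr -mulrA -expr2 => /eqP.
by rewrite mulf_eq0 gt_eqF//= sqrf_eq0 subr_eq0 => /eqP.
Qed.

End real_powers.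

(** * Finsler--Minkowski norms *)

Section one_sided_derivative.
Context {R : realType}.

Lemma is_derive_ge (F : R -> R) (c d : R) : is_derive (0 : R) 1 F d ->
  (forall t, 0 < t -> F 0 + t * c <= F t) -> c <= d.
Proof.
move=> [dF <-] Fc.
have /cvg_dnbhs_at_right cF : h^-1 *: ((F \o shift 0) (h *: 1) - F 0) @[h --> (0:R)^'] --> 'D_1 F 0.
  exact: dF.
apply: (cvgr_to_ge cF); near=> h.
have h0 : 0 < h by near: h; exact: nbhs_right_gt.
rewrite /= /GRing.scale/= mulr1 addr0 ler_pdivlMl// lerBrDl.
exact: Fc.
Unshelve. all: by end_near. Qed.

End one_sided_derivative.
Section finsler.
Context {R : realType} {n : nat} (H : 'rV[R]_n -> R).
Hypothesis n_gt0 : (0 < n)%N.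
Hypothesis FH : finsler_minkowski H.
Implicit Types (x y : 'rV[R]_n).

Lemma finsler0 : H 0 = 0.
Proof. exact/(finsler_eq0 FH). Qed.

Lemma finslerN x : H (- x) = H x.
Proof. by rewrite -scaleN1r (finsler_homog FH) normrN1 mul1r. Qed.

(** Convexity at the midpoint of [2 x] and [2 y], with homogeneity; this includes the collinear
    pairs, which the strict inequality leaves out. *)
Lemma finslerD x y : H (x + y) <= H x + H y.
Proof.
have h : 0 <= (2^-1 : R) <= 1 by apply/andP; split; lra.
have := finsler_convex FH (2 *: x) (2 *: y) h.
rewrite !scalerA !(finsler_homog FH) (_ : (1 - 2^-1) * 2 = 1); last by field.
rewrite mulVf// !scale1r => /le_trans; apply.
rewrite (gtr0_norm (ltr0Sn _ _)).
by rewrite mulrA mulVf// mul1r mulrA (_ : (1 - 2^-1) * 2 = 1) ?mul1r//; field.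
Qed.

Lemma finsler_sum m (F : 'I_m -> 'rV[R]_n) : H (\sum_i F i) <= \sum_i H (F i).
Proof.
elim: m F => [|m IH] F; first by rewrite !big_ord0 finsler0.
rewrite !big_ord_recl; apply: le_trans (finslerD _ _) _.
by rewrite lerD2l.
Qed.

Lemma finsler_derivable x i : x != 0 ->
  is_derive x (basis_rV i) H ('D_(basis_rV i) H x).
Proof. by move=> x0; apply/derivableP; exact: (((finsler_C1 FH).2 i).1 x x0). Qed.

Lemma row_sum_basis y : y = \sum_i y 0 i *: basis_rV i.
Proof. exact: row_sum_delta. Qed.

(* Jensen's inequality along the coordinate axes bounds the variation of the
   convex function H in an arbitrary direction by its partial derivatives, so
   no differentiability beyond partial derivatives is needed. *)
Lemma finsler_grad_ge x y c : x != 0 ->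
  (forall t, 0 < t -> H x + t * c <= H (x + t *: y)) -> c <= edot (grad H x) y.
Proof.
move=> x0 Hc; have n0 : 0 < n%:R :> R by rewrite ltr0n.
(* The factor [n] on each component offsets the weight [1/n]: the mean of the points
   [x + t n y_i e_i] is [x + t y], and [F] has derivative [edot (grad H x) y] at 0. *)
pose F (t : R) := \sum_(i < n) n%:R^-1 * H ((t * (n%:R * y 0 i)) *: basis_rV i + x).
have dF : is_derive (0 : R) 1 F (edot (grad H x) y).
  rewrite /F /edot.
  have dFi (i : 'I_n) : is_derive (0 : R) 1
      (fun t => n%:R^-1 * H ((t * (n%:R * y 0 i)) *: basis_rV i + x))
      (grad H x 0 i * y 0 i).
    have d1 : is_derive (0 : R) 1 (fun t : R => t * (n%:R * y 0 i)) (n%:R * y 0 i).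
      have := is_deriveMf (is_derive_id (0 : R) 1)
        (is_derive_cst (n%:R * y 0 i) (0 : R) 1).
      by move=> /is_derive_eq; apply; rewrite /= mulr0 add0r mulr1.
    have /is_derive_line d2 := finsler_derivable i x0.
    have d3 := @is_derive1_comp R (fun h => H (h *: basis_rV i + x)) _ 0 _ _ _ d1.
    rewrite mul0r in d3; have {}d3 := d3 _ d2.
    have := is_deriveMf (is_derive_cst (n%:R^-1 : R) (0 : R) 1) d3.
    move=> /is_derive_eq; apply; rewrite /= mulr0 addr0 mxE.
    by field; rewrite gt_eqF.
  have := is_derive_sum dFi; congr (is_derive _ _ _ _).
  by apply/funext => t; rewrite fct_sumE.
apply: (is_derive_ge dF) => t t0.
have -> : F 0 = H x.
  rewrite /F; under eq_bigr do rewrite mul0r scale0r add0r.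
  by rewrite sumr_const card_ord -[LHS]mulr_natl mulrA mulfV ?mul1r// gt_eqF.
apply: (le_trans (Hc t t0)).
have -> : x + t *: y = \sum_(i < n) n%:R^-1 *: ((t * (n%:R * y 0 i)) *: basis_rV i + x).
  under eq_bigr do rewrite scalerDr.
  rewrite big_split/= sumr_const card_ord -[X in _ = _ + X]scaler_nat scalerA mulfV ?gt_eqF//.
  rewrite scale1r [LHS]addrC; congr (_ + _).
  rewrite {1}(row_sum_basis y) scaler_sumr; apply: eq_bigr => i _.
  by rewrite !scalerA; congr (_ *: _); field; rewrite gt_eqF.
apply: le_trans (finsler_sum _) _; apply: ler_sum => i _.
by rewrite (finsler_homog FH) ger0_norm// invr_ge0 ltW.
Qed.

Lemma edotN x y : edot x (- y) = - edot x y.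
Proof. by rewrite /edot -sumrN; apply: eq_bigr => i _; rewrite mxE mulrN. Qed.

(** The triangle inequality gives [H x - t H y <= H (x - t y)], a lower bound along the line in
    direction [-y]. *)
Lemma finsler_grad_le x y : x != 0 -> edot (grad H x) y <= H y.
Proof.
move=> x0; rewrite -[leLHS]opprK -edotN lerNl.
apply: finsler_grad_ge => // t t0; rewrite mulrN scalerN lerBlDr.
have := finslerD (x - t *: y) (t *: y).
by rewrite subrK (finsler_homog FH) gtr0_norm.
Qed.

(** Euler's identity: the missing inequality comes from homogeneity along the ray through [x]. *)
Lemma finsler_grad_id x : x != 0 -> edot (grad H x) x = H x.
Proof.
move=> x0; apply/eqP; rewrite eq_le finsler_grad_le//=.
apply: finsler_grad_ge => // t t0.
rewrite -[X in X + t *: x]scale1r -scalerDl (finsler_homog FH).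
by rewrite gtr0_norm ?addr_gt0// mulrDl mul1r.
Qed.

Lemma finsler_grad_abs_le x y : x != 0 -> `|edot (grad H x) y| <= H y.
Proof.
move=> x0; rewrite ler_norml finsler_grad_le// andbT lerNl -edotN.
by apply: le_trans (finsler_grad_le _ x0) _; rewrite finslerN.
Qed.

Variable p : R.
Hypothesis p1 : 1 < p.

Let p0 : 0 < p := lt_trans ltr01 p1.

Lemma edotZl (a : R) x y : edot (a *: x) y = a * edot x y.
Proof. by rewrite /edot mulr_sumr; apply: eq_bigr => i _; rewrite mxE mulrA. Qed.

Lemma edot0l x : edot 0 x = 0.
Proof. by rewrite /edot big1// => i _; rewrite mxE mul0r. Qed.

Lemma flux_id x : edot (flux p H x) x = H x `^ p.
Proof.
rewrite /flux; case: eqP => [->|/eqP x0].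
  by rewrite edot0l finsler0 powR0// gt_eqF.
rewrite edotZl finsler_grad_id// mulrC mulr_powRB1//.
exact: (finsler_ge0 FH).
Qed.

Lemma flux_le x y : `|edot (flux p H x) y| <= H x `^ (p - 1) * H y.
Proof.
rewrite /flux; case: eqP => [->|/eqP x0].
  by rewrite edot0l normr0 mulr_ge0 ?powR_ge0 ?(finsler_ge0 FH).
by rewrite edotZl normrM ger0_norm ?powR_ge0// ler_wpM2l ?powR_ge0 ?finsler_grad_abs_le.
Qed.

(** The cross terms are bounded by [flux_le], which leaves the monotonicity of [t^(p-1)] at [H x]
    and [H y]. The product of differences is expanded because each term is integrated against [w]
    separately. *)
Lemma flux_monotone x y :
  edot (flux p H x) y + edot (flux p H y) x <= H x `^ p + H y `^ p.
Proof.
have := powR_monotone p1 (finsler_ge0 FH x) (finsler_ge0 FH y).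
have m z : H z `^ (p - 1) * H z = H z `^ p.
  by rewrite mulrC mulr_powRB1 ?(finsler_ge0 FH).
rewrite mulrBl !mulrBr !m.
have := le_trans (ler_norm _) (flux_le x y).
have := le_trans (ler_norm _) (flux_le y x); lra.
Qed.

Lemma finsler_gradZ (r : R) x : 0 < r -> x != 0 -> grad H (r *: x) = grad H x.
Proof.
move=> r0 x0; apply/rowP => i; rewrite !mxE.
have rx0 : r *: x != 0 by rewrite scaler_eq0 negb_or gt_eqF//= x0.
have /is_derive_line d2 := finsler_derivable i x0.
have d1 : is_derive (0 : R) 1 (fun t : R => t * r^-1) r^-1.
  have := is_deriveMf (is_derive_id (0 : R) 1) (is_derive_cst r^-1 (0 : R) 1).
  by move=> /is_derive_eq; apply; rewrite /= mulr0 add0r mulr1.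
have d3 := @is_derive1_comp R (fun h => H (h *: basis_rV i + x)) _ 0 _ _ _ d1.
rewrite mul0r in d3; have {}d3 := d3 _ d2.
have := is_deriveMf (is_derive_cst r (0 : R) 1) d3.
rewrite (_ : (fun _ => _) = (fun h => H (h *: basis_rV i + r *: x))); last first.
  apply/funext => h /=; rewrite -{1}(gtr0_norm r0) -(finsler_homog FH).
  by rewrite scalerDr scalerA mulrCA mulfV ?mulr1// gt_eqF.
move=> /(@is_derive_line _ _ H (r *: x) _ _).2[_ ->]; rewrite /= mulr0 addr0 mulrCA mulfV ?mulr1//.
by rewrite gt_eqF.
Qed.

Lemma fluxZ (r : R) x : 0 < r -> flux p H (r *: x) = r `^ (p - 1) *: flux p H x.
Proof.
move=> r0; rewrite /flux scaler_eq0 gt_eqF//=; case: eqP => [_|/eqP x0].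
  by rewrite scaler0.
rewrite finsler_gradZ// (finsler_homog FH) gtr0_norm//.
by rewrite powRM ?(ltW r0) ?(finsler_ge0 FH)// scalerA.
Qed.

Let nz : set 'rV[R]_n := [set x | x != 0].

Let nz_open : open nz.
Proof.
rewrite (_ : nz = ~` [set 0]); last first.
  by apply/seteqP; split => x /eqP.
by rewrite openC; apply: accessible_closed_set1; apply: hausdorff_accessible;
  exact: norm_hausdorff.
Qed.

Let mnz : measurable nz := open_measurable_rV nz_open.

Let m0 : measurable ([set 0] : set 'rV[R]_n).
Proof.
rewrite (_ : [set 0] = ~` nz); first exact: measurableC.
apply/seteqP; split => [x -> /=|x /negP]; first by rewrite /nz/= eqxx.
by rewrite negbK => /eqP.
Qed.

(** [H] is of class [C^1], and the flux continuous by its formula, only away from the origin; the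
    origin is a measurable singleton. *)
Lemma measurable_fun_nz (F : 'rV[R]_n -> R) :
  measurable_fun nz F -> measurable_fun setT F.
Proof.
move=> mF; have -> : setT = nz `|` [set 0].
  apply/seteqP; split => // x _; rewrite /nz/=.
  by case: (eqVneq x 0); [right|left].
by apply/measurable_funU => //; split => //; exact: measurable_fun_set1.
Qed.

Lemma measurable_finsler : measurable_fun setT H.
Proof.
apply: measurable_fun_nz; apply: continuous_on_measurable => // x x0.
exact: ((finsler_C1 FH).1 x x0).
Qed.

Lemma measurable_flux i : measurable_fun setT (fun x => flux p H x 0 i).
Proof.
apply: measurable_fun_nz.
apply: (eq_measurable_fun (fun x => H x `^ (p - 1) * 'D_(basis_rV i) H x)).
  by move=> x; rewrite inE /nz/= /flux => /negbTE ->; rewrite !mxE.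
apply: measurable_funM.
  apply: (measurableT_comp (measurable_powR _)).
  exact: (measurable_funS measurableT (@subsetT _ _) measurable_finsler).
apply: continuous_on_measurable => // x x0.
exact: (((finsler_C1 FH).2 i).2.1 x x0).
Qed.

End finsler.

(** * Weights, the measure mu, and almost everywhere arguments *)

Section product_ae.
Context d1 d2 (T1 : measurableType d1) (T2 : measurableType d2) (R : realType).
Variables (m1 : {sigma_finite_measure set T1 -> \bar R})
  (m2 : {sigma_finite_measure set T2 -> \bar R}).

Lemma ae_prod1 (P : set T1) : {ae m1, forall x, P x} ->
  {ae (m1 \x m2)%E, forall z, P z.1}.
Proof.
move=> [A [mA A0 PA]]; exists (A `*` setT); split.
- exact: measurableX.
- transitivity (m1 A * m2 setT)%E; first exact: product_measure1E.
  by have -> : m1 A = 0%E by []; rewrite mul0e.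
- by move=> z /= nPz; split => //; exact: PA.
Qed.

Lemma ae_prod2 (P : set T2) : {ae m2, forall x, P x} ->
  {ae (m1 \x m2)%E, forall z, P z.2}.
Proof.
move=> [A [mA A0 PA]]; exists (setT `*` A); split.
- exact: measurableX.
- transitivity (m1 setT * m2 A)%E; first exact: product_measure1E.
  by have -> : m2 A = 0%E by []; rewrite mule0.
- by move=> z /= nPz; split => //; exact: PA.
Qed.

Lemma ae_section_lty (F : T1 * T2 -> \bar R) : measurable_fun setT F ->
  (forall z, 0 <= F z)%E -> (\int[m1 \x m2]_z F z < +oo)%E ->
  {ae m1, forall x, (\int[m2]_y F (x, y) < +oo)%E}.
Proof.
move=> mF F0; rewrite fubini_tonelli1// => Ffin.
have iF : m1.-integrable setT (fubini_F m2 F).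
  apply/integrableP; split; first exact: measurable_fun_fubini_tonelli_F.
  rewrite (eq_integral (fubini_F m2 F))// => x _.
  by rewrite gee0_abs// integral_ge0.
have := integrable_ae measurableT iF.
apply: filterS => x /(_ I); rewrite ge0_fin_numE//.
exact: integral_ge0.
Qed.

Lemma ae_section_eq0 (F : T1 * T2 -> \bar R) : measurable_fun setT F ->
  (forall z, 0 <= F z)%E -> (\int[m1 \x m2]_z F z = 0)%E ->
  {ae m1, forall x, {ae m2, forall y, F (x, y) = 0%E}}.
Proof.
move=> mF F0; rewrite fubini_tonelli1// => Feq0.
have mFF : measurable_fun setT (fubini_F m2 F).
  exact: measurable_fun_fubini_tonelli_F.
have : ae_eq m1 setT (fubini_F m2 F) (cst 0%E).
  apply/ae_eq_integral_abs => //; rewrite -[RHS]Feq0.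
  by apply: eq_integral => x _; rewrite gee0_abs// integral_ge0.
apply: filterS => x /(_ I) Fx0.
have mFx : measurable_fun setT (fun y => F (x, y)) by exact: measurableT_comp.
have : ae_eq m2 setT (fun y => F (x, y)) (cst 0%E).
  apply/ae_eq_integral_abs => //; rewrite -[RHS]Fx0.
  by apply: eq_integral => y _; rewrite gee0_abs.
by apply: filterS => y; exact.
Qed.

End product_ae.

Section weights.
Context {R : realType} {N : nat}.
Hypothesis N_gt0 : (0 < N)%N.
Local Notation leb := (lebesgue_rV N).
Variables (p s : R) (w : 'rV[R]_N -> R).
Hypothesis ww : weight w.

Lemma weight_measurable : measurable_fun setT w.
Proof. by have [[]] := ww. Qed.

Lemma weight_gt0 : {ae leb, forall x, 0 < w x}.
Proof. by have [] := ww. Qed.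

Lemma weight_ball_abs (c : 'rV[R]_N) r :
  (\int[leb]_(x in eball c r) (w x)%:E = \int[leb]_(x in eball c r) `|w x|%:E)%E.
Proof.
apply: ae_eq_integral.
- exact: measurable_eball.
- apply/measurable_EFinP.
  exact: (measurable_funS measurableT (@subsetT _ _) weight_measurable).
- apply/measurable_EFinP; apply: measurableT_comp => //.
  exact: (measurable_funS measurableT (@subsetT _ _) weight_measurable).
- by apply: filterS weight_gt0 => x w0 _; rewrite gtr0_norm.
Qed.

Lemma wmeas_ge0 (c : 'rV[R]_N) r : 0 <= wmeas w (eball c r).
Proof.
by rewrite /wmeas weight_ball_abs fine_ge0//; apply: integral_ge0 => x _; rewrite lee_fin.
Qed.

(** Since [wmeas] is a [fine], which sends [+oo] to 0, positivity includes finiteness; the latter is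
    local integrability on a closed box around the ball. *)
Lemma wmeas_gt0 (c : 'rV[R]_N) r : 0 < r -> 0 < wmeas w (eball c r).
Proof.
move=> r0; have [_ [_ [_ _ bQ]]] := eball_obox c r0.
have mB := measurable_eball c r.
have mwB : measurable_fun (eball c r) (EFin \o w).
  by apply/measurable_EFinP; exact: (measurable_funS measurableT (@subsetT _ _) weight_measurable).
have h0 : (0 <= \int[leb]_(x in eball c r) `|w x|%:E)%E.
  by apply: integral_ge0 => x _; rewrite lee_fin.
rewrite /wmeas weight_ball_abs fine_gt0//; apply/andP; split.
  rewrite lt_neqAle h0 andbT; apply/negP => /eqP/esym E0.
  have : ae_eq leb (eball c r) (EFin \o w) (cst 0%E).
    by apply/ae_eq_integral_abs.
  move=> hw; have := eball_gt0 c r0.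
  rewrite (_ : lebesgue_rV N (eball c r) = 0%E) ?ltxx//.
  apply/(negligibleP leb mB).
  have [A [mA A0 PA]] : {ae leb, forall x, ~ eball c r x}.
    move: hw weight_gt0; apply: filterS2 => x h1 h2 /h1 [w0].
    by move: h2; rewrite w0 ltxx.
  exists A; split => // x Bx; apply: PA => /=.
  by move=> /(_ Bx).
have [[_ wK] _] := ww.
have Qfin := wK _ (@subsetT _ _) (compact_cbox (a := c - const_mx r) (b := c + const_mx r)).
apply: le_lt_trans Qfin.
  apply: ge0_subset_integral => //.
  - exact: measurable_cbox.
  - apply/measurable_EFinP; apply: measurableT_comp => //.
    exact: (measurable_funS measurableT (@subsetT _ _) weight_measurable).
Qed.

Lemma mu_density_ge0 x y : 0 < w x -> 0 < w y -> 0 <= mu_density p s w x y.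
Proof.
move=> wx wy; rewrite /mu_density /kernel_K divr_ge0 ?powR_ge0//.
by rewrite divr_ge0 ?wmeas_ge0// mulr_ge0 ?ltW.
Qed.

Lemma mu_density_gt0 x y : x != y -> 0 < w x -> 0 < w y ->
  0 < mu_density p s w x y.
Proof.
move=> xy wx wy; have e0 : 0 < enorm (x - y) by rewrite enorm_gt0 subr_eq0.
rewrite /mu_density /kernel_K divr_gt0 ?powR_gt0//.
by rewrite divr_gt0 ?wmeas_gt0 ?mulr_gt0// divr_gt0.
Qed.

Lemma ae_mu_density_ge0 :
  {ae (leb \x leb)%E, forall z, 0 <= mu_density p s w z.1 z.2}.
Proof.
have := ae_prod1 leb weight_gt0; have := ae_prod2 leb weight_gt0.
by apply: filterS2 => z h2 h1; exact: mu_density_ge0.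
Qed.

Lemma ae_neq (x : 'rV[R]_N) : {ae leb, forall y, x != y}.
Proof.
exists [set x]; split.
- have -> : [set x] = cbox x x.
    apply/seteqP; split => [y -> i|y h]; first by rewrite /= in_itv/= lexx.
    apply/rowP => i; have := h i; rewrite /= in_itv/= => /andP[h1 h2].
    by apply/eqP; rewrite eq_le h1 h2.
  exact: measurable_cbox.
- have -> : [set x] = [set y : 'rV[R]_N | forall i, [set x 0 i] (y 0 i)].
    by apply/seteqP; split => [y ->//|y h]; apply/rowP => i; exact: h.
  have := lebesgue_rV_box (A := fun i => [set x 0 i] : set (measurableTypeR R)).
  move=> ->; last by move=> i; exact: measurable_set1.
  by rewrite (bigD1 (Ordinal N_gt0))//= lebesgue_measure_set1 mul0e.
- by move=> y /= /negP; rewrite negbK => /eqP.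
Qed.

Lemma ae_mu_density_gt0 x : 0 < w x ->
  {ae leb, forall y, 0 < mu_density p s w x y}.
Proof.
move=> wx; have := ae_neq x; have := weight_gt0.
by apply: filterS2 => y wy xy; exact: mu_density_gt0.
Qed.

Lemma measurable_mu_density :
  measurable_fun setT (fun z : 'rV[R]_N * 'rV[R]_N => mu_density p s w z.1 z.2).
Proof.
have mw := weight_measurable.
have m1 i : measurable_fun setT (fun z : 'rV[R]_N * 'rV[R]_N => z.1 0 i).
  exact: (measurableT_comp (measurable_coord i) measurable_fst).
have m2 i : measurable_fun setT (fun z : 'rV[R]_N * 'rV[R]_N => z.2 0 i).
  exact: (measurableT_comp (measurable_coord i) measurable_snd).
have mE : measurable_fun setT (fun z : 'rV[R]_N * 'rV[R]_N => enorm (z.1 - z.2)).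
  by apply: enorm_measurable => // i; under eq_fun do rewrite !mxE; exact: measurable_funB.
(* Divisions become negative powers, whose measurability is known; for [wmeas] this uses that it is
   nonnegative. *)
rewrite (_ : (fun z => _) = (fun z => w z.1 * w z.2 *
    wmeas w (eball (2^-1 *: (z.1 + z.2)) (enorm (z.1 - z.2) / 2)) `^ (-1) *
    enorm (z.1 - z.2) `^ (- (s * p)))); last first.
  apply/funext => z; rewrite /mu_density /kernel_K powRN.
  by rewrite (powR_inv1 (wmeas_ge0 _ _)).
apply: measurable_funM; last exact: (measurableT_comp (measurable_powR _) mE).
apply: measurable_funM.
  by apply: measurable_funM; [exact: (measurableT_comp mw measurable_fst)|
    exact: (measurableT_comp mw measurable_snd)].
apply: (measurableT_comp (measurable_powR _)).
(* The measure of the ball is a partial integral of [|w|] restricted to the set of triples whose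
   last point lies in the ball of the first two, so Tonelli's theorem gives its measurability. *)
pose F (q : ('rV[R]_N * 'rV[R]_N) * 'rV[R]_N) : \bar R :=
  (if enorm (q.2 - 2^-1 *: (q.1.1 + q.1.2)) < enorm (q.1.1 - q.1.2) / 2
   then `|w q.2| else 0)%:E.
have mF : measurable_fun setT F.
  apply/measurable_EFinP; apply: measurable_fun_ifT => //; last first.
    by apply: measurableT_comp => //; exact: (measurableT_comp mw measurable_snd).
  apply: measurable_fun_ltr.
    apply: enorm_measurable => // i; under eq_fun do rewrite !mxE.
    apply: measurable_funB; first exact: (measurableT_comp (measurable_coord i) measurable_snd).
    apply: measurable_funM => //; apply: measurable_funD.
      exact: (measurableT_comp (m1 i) measurable_fst).
    exact: (measurableT_comp (m2 i) measurable_fst).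
  by apply: measurable_funM => //; exact: (measurableT_comp mE measurable_fst).
have F0 q : (0 <= F q)%E by rewrite lee_fin; case: ifP.
have := @measurable_fun_fubini_tonelli_F _ _ _ _ _ leb F mF F0.
move=> /(measurableT_comp (fine_measurable (R := R) measurableT)).
congr (measurable_fun _ _); apply/funext => z /=.
rewrite /wmeas weight_ball_abs [in RHS]integral_mkcond; congr fine.
apply: eq_integral => x _; rewrite /F/= patchE.
rewrite (_ : (x \in _) = (enorm (x - 2^-1 *: (z.1 + z.2)) < enorm (z.1 - z.2) / 2)).
  by case: ifP.
by apply/idP/idP; rewrite inE.
Qed.

End weights.

(** * Integrals under almost everywhere hypotheses *)

Section ae_integral.
Context d (T : measurableType d) (R : realType).
Variables (mu : {measure set T -> \bar R}) (D : set T).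
Hypothesis mD : measurable D.
Implicit Types f g h : T -> R.

Lemma ae_eq_Rintegral f g : measurable_fun D f -> measurable_fun D g ->
  {ae mu, forall x, D x -> f x = g x} ->
  \int[mu]_(x in D) f x = \int[mu]_(x in D) g x.
Proof.
move=> mf mg fg; congr fine; apply: ae_eq_integral => //.
- exact/measurable_EFinP.
- exact/measurable_EFinP.
- by apply: filterS fg => x h Dx; rewrite h.
Qed.

(** The maximum of [|h|] and [|g|] dominates [|h|] at every point and agrees with [|g|] almost
    everywhere, which brings the claim back to a pointwise comparison. *)
Lemma ae_dominated_integrable h g : measurable_fun D h ->
  {ae mu, forall x, D x -> `|h x| <= g x} ->
  mu.-integrable D (EFin \o g) -> mu.-integrable D (EFin \o h).
Proof.
move=> mh hg ig; have mg : measurable_fun D g.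
  by apply/measurable_EFinP; exact: measurable_int ig.
apply/integrableP; split; first exact/measurable_EFinP.
have /integrableP[_] := ig; apply: le_lt_trans.
have mx : measurable_fun D (fun x => Num.max `|h x| `|g x|).
  by apply: measurable_maxr; apply: measurableT_comp.
rewrite [leRHS](_ : _ = \int[mu]_(x in D) (Num.max `|h x| `|g x|)%:E)%E.
  apply: ge0_le_integral => //.
  - by apply/measurable_EFinP; exact: measurableT_comp.
  - exact/measurable_EFinP.
  - by move=> x _; rewrite lee_fin le_max lexx.
apply: ae_eq_integral => //.
- by apply/measurable_EFinP; exact: measurableT_comp.
- exact/measurable_EFinP.
apply: filterS hg => x h1 /h1 {}h1; rewrite /= max_r//.
exact: le_trans h1 (ler_norm _).
Qed.

Lemma ae_le_Rintegral f g :
  mu.-integrable D (EFin \o f) -> mu.-integrable D (EFin \o g) ->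
  {ae mu, forall x, D x -> f x <= g x} ->
  \int[mu]_(x in D) f x <= \int[mu]_(x in D) g x.
Proof.
move=> fi gi fg.
have mf : measurable_fun D f by apply/measurable_EFinP; exact: measurable_int fi.
have mg : measurable_fun D g by apply/measurable_EFinP; exact: measurable_int gi.
have mx : measurable_fun D (fun x => Num.max (f x) (g x)) by exact: measurable_maxr.
have E : {ae mu, forall x, D x -> g x = Num.max (f x) (g x)}.
  by apply: filterS fg => x h /h fgx; rewrite max_r.
rewrite (ae_eq_Rintegral mg mx E); apply: le_Rintegral => //; last first.
  by move=> x _; rewrite le_max lexx.
apply: (@ae_dominated_integrable _ (fun x => `|g x|)) => //.
  by move: E; apply: filterS => x h /h <-.
exact: (integrable_abse gi).
Qed.

Lemma integrable_lin f g (a b : R) :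
  mu.-integrable D (EFin \o f) -> mu.-integrable D (EFin \o g) ->
  mu.-integrable D (EFin \o (fun x => a * f x + b * g x)).
Proof.
move=> fi gi.
exact: (integrableD mD (integrableZl mD a fi) (integrableZl mD b gi)).
Qed.

Lemma Rintegral_lin f g (a b : R) :
  mu.-integrable D (EFin \o f) -> mu.-integrable D (EFin \o g) ->
  \int[mu]_(x in D) (a * f x + b * g x) =
  a * \int[mu]_(x in D) f x + b * \int[mu]_(x in D) g x.
Proof.
move=> fi gi.
rewrite (RintegralD mD (integrableZl mD a fi) (integrableZl mD b gi)).
by rewrite !RintegralZl.
Qed.

Lemma integralE_Rintegral f : mu.-integrable D (EFin \o f) ->
  (\int[mu]_(x in D) (f x)%:E = (\int[mu]_(x in D) f x)%R%:E)%E.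
Proof. by move=> fi; rewrite fineK//; exact: integrable_fin_num. Qed.

Lemma ge0_integrable f : measurable_fun D f -> (forall x, 0 <= f x) ->
  (\int[mu]_(x in D) (f x)%:E < +oo)%E -> mu.-integrable D (EFin \o f).
Proof.
move=> mf f0 ffin; apply/integrableP; split; first exact/measurable_EFinP.
apply: le_lt_trans ffin; rewrite (eq_integral (fun x => (f x)%:E))// => x _.
by rewrite /= ger0_norm.
Qed.

Lemma fatou_bound (f_ : nat -> T -> R) f (C : R) :
  (forall m, measurable_fun D (f_ m)) -> measurable_fun D f ->
  (forall m x, D x -> 0 <= f_ m x) ->
  {ae mu, forall x, D x -> f_ ^~ x @ \oo --> f x} ->
  (forall m, (\int[mu]_(x in D) (f_ m x)%:E <= C%:E)%E) ->
  (\int[mu]_(x in D) (f x)%:E <= C%:E)%E.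
Proof.
move=> mf_ mf f_0 f_f f_C.
have mE m : measurable_fun D (fun x => (f_ m x)%:E) by exact/measurable_EFinP.
(* The lower limit is measurable and equals [f] almost everywhere, so Fatou's lemma applies though
   convergence may fail on a null set. *)
pose F x := limn_einf (fun m => (f_ m x)%:E).
have mF : measurable_fun D F.
  apply: (emeasurable_fun_cvg (fun m x => einfs (fun m => (f_ m x)%:E) m)).
    by move=> m; exact: measurable_fun_einfs.
  by move=> x _; rewrite /F limn_einf_lim; exact: is_cvg_einfs.
have -> : (\int[mu]_(x in D) (f x)%:E = \int[mu]_(x in D) F x)%E.
  apply: ae_eq_integral => //; first exact/measurable_EFinP.
  apply: filterS f_f => x h /h {}h; apply/esym.
  have {}h : (fun m => (f_ m x)%:E) @ \oo --> (f x)%:E by apply/cvg_EFin => //; near=> m.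
  by rewrite /F is_cvg_limn_einfE; [exact/cvg_lim|apply/cvg_ex; exists (f x)%:E].
have f_0' m x : D x -> (0 <= (f_ m x)%:E)%E by move=> Dx; rewrite lee_fin f_0.
apply: (le_trans (fatou mu mD mE f_0')).
rewrite limn_einf_lim; apply: lime_le; first exact: is_cvg_einfs.
apply: nearW => m; apply: le_trans (f_C m).
by apply: ereal_inf_lbound; exists m => //=.
Unshelve. all: by end_near. Qed.

End ae_integral.

(** * Energies and pairings *)

Lemma edot_linr (R : realType) (n : nat) (x y z : 'rV[R]_n) (a b : R) :
  edot x (a *: y + b *: z) = a * edot x y + b * edot x z.
Proof.
rewrite /edot !mulr_sumr -big_split/=; apply: eq_bigr => i _.
by rewrite !mxE; ring.
Qed.

Lemma lin_combinationE (R : comPzRingType) (a b c x1 x2 y1 y2 : R) :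
  (a * x1 + b * x2) + c * (a * y1 + b * y2) =
  a * (x1 + c * y1) + b * (x2 + c * y2).
Proof. by rewrite !mulrDr addrACA (mulrCA c a) (mulrCA c b). Qed.

Lemma ler_lin_combination (R : realDomainType) (a b c x1 x2 y1 y2 x y : R) :
  0 <= c -> x <= a * x1 + b * x2 -> y <= a * y1 + b * y2 ->
  x + c * y <= a * (x1 + c * y1) + b * (x2 + c * y2).
Proof. by move=> c0 hx hy; rewrite -lin_combinationE lerD// ler_wpM2l. Qed.

Lemma ler_lin1 (R : numDomainType) (a b c d : R) :
  a + b <= c + d -> 1 * a + 1 * b <= 1 * c + 1 * d.
Proof. by rewrite !mul1r. Qed.

(** The scalar core of uniqueness: the local parts are monotone by the first premise, so the
    reversed inequality between the totals makes the nonlocal gap nonpositive. *)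
Lemma gap_le0 (R : realFieldType) (al a b c d e f g h : R) :
  1 * e + 1 * f <= 1 * a + 1 * b ->
  (a + al * c) + (b + al * d) <= (e + al * g) + (f + al * h) ->
  al * (1 * (1 * c + 1 * d) + (- 1) * (1 * g + 1 * h)) <= 0.
Proof. lra. Qed.

Local Opaque wgrad Rintegral.

Section energy.
Context {R : realType} {N : nat}.
Local Notation leb := (lebesgue_rV N).
Local Notation leb2 := (leb \x leb)%E.
Variables (Omega : set 'rV[R]_N) (p s alpha : R) (H w : 'rV[R]_N -> R).
Hypotheses (N_gt0 : (0 < N)%N) (oO : open Omega) (bO : bounded_set Omega).
Hypotheses (p1 : 1 < p) (alpha0 : 0 < alpha).
Hypotheses (FH : finsler_minkowski H) (ww : weight w).
Implicit Types u v phi : 'rV[R]_N -> R.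

Let mO : measurable Omega := open_measurable_rV oO.
Let p0 : 0 < p := lt_trans ltr01 p1.
Let H0 x : 0 <= H x := finsler_ge0 FH x.
Let mw := weight_measurable ww.
Let mk := measurable_mu_density p s ww.
Local Notation D := (wgrad Omega).
Local Notation k z := (mu_density p s w z.1 z.2).

(** A box of positive measure lies beyond the bounded set [Omega], so it meets every set of full
    measure. Such an exterior point anchors functions that vanish outside [Omega]. *)
Lemma exists_outside (P : set 'rV[R]_N) : {ae leb, forall x, P x} ->
  exists2 x, ~ Omega x & P x.
Proof.
move=> aeP; have [M M0 hM] := bounded_cbox bO.
pose a : 'rV[R]_N := const_mx M; pose b : 'rV[R]_N := const_mx (M + 1).
have ab i : a 0 i < b 0 i by rewrite !mxE ltrDl.
apply: contrapT => noP.
have [A [mA A0 PA]] := aeP.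
have sA : obox a b `<=` A.
  move=> x xab; apply: PA => Px; apply: noP; exists x => // /hM /(_ (Ordinal N_gt0)).
  have := xab (Ordinal N_gt0); rewrite /= !mxE !in_itv/= => /andP[h _] /andP[_].
  by rewrite leNgt h.
have := lebesgue_obox_gt0 ab; rewrite ltNge => /negP; apply.
have : (leb (obox a b) <= leb A)%E.
  by apply: le_measure => //; rewrite inE//; exact: measurable_obox.
by rewrite A0.
Qed.

(* w and mu_density are nonnegative only almost everywhere; the absolute values
   make the densities nonnegative everywhere. *)
Definition local_density u (x : 'rV[R]_N) : R := H (D u x) `^ p * `|w x|.

Definition nonlocal_density u (z : 'rV[R]_N * 'rV[R]_N) : R :=
  `|u z.1 - u z.2| `^ p * `|k z|.

Definition local_pairing u v (x : 'rV[R]_N) : R :=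
  edot (flux p H (D u x)) (D v x) * w x.

Definition nonlocal_pairing u v (z : 'rV[R]_N * 'rV[R]_N) : R :=
  J_p p (u z.1 - u z.2) * (v z.1 - v z.2) * k z.

Definition has_wgrad u := exists G, is_weak_grad Omega u G.

(** The part of membership in [W0] that makes the integrals below real numbers, so that energies and
    pairings are computed in [R]. *)
Record finite_energy u : Prop := FiniteEnergy {
  fe_measurable : measurable_fun setT u ;
  fe_wgrad : has_wgrad u ;
  fe_local : leb.-integrable Omega (EFin \o local_density u) ;
  fe_nonlocal : leb2.-integrable setT (EFin \o nonlocal_density u) }.

Definition local_renergy u : R := \int[leb]_(x in Omega) local_density u x.

Definition nonlocal_renergy u : R := \int[leb2]_z nonlocal_density u z.

Definition local_form u v : R := \int[leb]_(x in Omega) local_pairing u v x.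

Definition nonlocal_form u v : R := \int[leb2]_z nonlocal_pairing u v z.

Definition renergy u : R := local_renergy u + alpha * nonlocal_renergy u.

Definition pairing u v : R := local_form u v + alpha * nonlocal_form u v.

Lemma measurable_wgrad u : has_wgrad u -> measurable_fun Omega (D u).
Proof.
move=> [G /wgradP [_ LG _]]; apply: measurable_fun_rV_on => // i.
exact: (LG i).1.
Qed.

Lemma measurable_local_density u : has_wgrad u ->
  measurable_fun Omega (local_density u).
Proof.
move=> uG; apply: measurable_funM.
  apply: (measurableT_comp (measurable_powR _)).
  exact: (measurableT_comp (measurable_finsler FH) (measurable_wgrad uG)).
apply: measurableT_comp => //; exact: (measurable_funS measurableT (@subsetT _ _) mw).
Qed.

Lemma measurable_difference u : measurable_fun setT u ->
  measurable_fun setT (fun z : 'rV[R]_N * 'rV[R]_N => u z.1 - u z.2).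
Proof.
move=> mu; apply: measurable_funB.
  exact: (measurableT_comp mu measurable_fst).
exact: (measurableT_comp mu measurable_snd).
Qed.

Lemma measurable_nonlocal_density u : measurable_fun setT u ->
  measurable_fun setT (nonlocal_density u).
Proof.
move=> mu; apply: measurable_funM; last exact: measurableT_comp.
apply: (measurableT_comp (measurable_powR _)).
apply: measurableT_comp => //; exact: measurable_difference.
Qed.

Lemma measurable_local_pairing u v : has_wgrad u -> has_wgrad v ->
  measurable_fun Omega (local_pairing u v).
Proof.
move=> uG vG; apply: measurable_funM; last first.
  exact: (measurable_funS measurableT (@subsetT _ _) mw).
apply: (edot_measurable mO) => i.
  exact: (measurableT_comp (measurable_flux FH p i) (measurable_wgrad uG)).
exact: (measurableT_comp (measurable_coord i) (measurable_wgrad vG)).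
Qed.

Lemma measurable_nonlocal_pairing u v : measurable_fun setT u ->
  measurable_fun setT v -> measurable_fun setT (nonlocal_pairing u v).
Proof.
move=> mu mv; apply: measurable_funM => //; apply: measurable_funM; last first.
  exact: measurable_difference.
rewrite /J_p; apply: measurable_funM; last exact: measurable_difference.
apply: (measurableT_comp (measurable_powR _)).
apply: measurableT_comp => //; exact: measurable_difference.
Qed.

Lemma local_density_ge0 u x : 0 <= local_density u x.
Proof. by rewrite mulr_ge0 ?powR_ge0. Qed.

Lemma nonlocal_density_ge0 u z : 0 <= nonlocal_density u z.
Proof. by rewrite mulr_ge0 ?powR_ge0. Qed.

Lemma renergy_ge0 u : 0 <= renergy u.
Proof.
rewrite addr_ge0 ?mulr_ge0 ?(ltW alpha0)//; apply: Rintegral_ge0 => x _.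
  exact: local_density_ge0.
exact: nonlocal_density_ge0.
Qed.

Lemma energyE u : measurable_fun setT u -> has_wgrad u ->
  (energy Omega p s alpha H w u = \int[leb]_(x in Omega) (local_density u x)%:E +
    alpha%:E * \int[leb2]_z (nonlocal_density u z)%:E)%E.
Proof.
move=> mu uG; rewrite /energy /nonlocal_energy; congr (_ + _ * _)%E.
  apply: ae_eq_integral => //.
  - apply/measurable_EFinP; apply: measurable_funM.
      apply: (measurableT_comp (measurable_powR _)).
      exact: (measurableT_comp (measurable_finsler FH) (measurable_wgrad uG)).
    exact: (measurable_funS measurableT (@subsetT _ _) mw).
  - by apply/measurable_EFinP; exact: measurable_local_density.
  - apply: filterS (weight_gt0 ww) => x wx _.
    by rewrite /local_density gtr0_norm.
apply: ae_eq_integral => //.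
- apply/measurable_EFinP; apply: measurable_funM => //.
  apply: (measurableT_comp (measurable_powR _)).
  apply: measurableT_comp => //; exact: measurable_difference.
- by apply/measurable_EFinP; exact: measurable_nonlocal_density.
- apply: filterS (ae_mu_density_ge0 p s ww) => z kz _.
  by rewrite /nonlocal_density (ger0_norm kz).
Qed.

Lemma finite_energyE u : finite_energy u ->
  energy Omega p s alpha H w u = (renergy u)%:E.
Proof.
move=> [mu uG il inl].
by rewrite energyE// (integralE_Rintegral mO il) (integralE_Rintegral measurableT inl).
Qed.

Lemma finite_energy_lty u : measurable_fun setT u -> has_wgrad u ->
  (energy Omega p s alpha H w u < +oo)%E -> finite_energy u.
Proof.
move=> mu uG; rewrite energyE//.
set A := integral _ _ _; set B := integral _ _ _ => AB.
have A0 : (0 <= A)%E by apply: integral_ge0 => x _; rewrite lee_fin local_density_ge0.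
have B0 : (0 <= B)%E by apply: integral_ge0 => x _; rewrite lee_fin nonlocal_density_ge0.
have aB0 : (0 <= alpha%:E * B)%E by rewrite mule_ge0// lee_fin ltW.
split => //.
- apply: ge0_integrable => //; first exact: measurable_local_density.
    exact: local_density_ge0.
  by apply: le_lt_trans AB; rewrite leeDl.
- apply: ge0_integrable => //; first exact: measurable_nonlocal_density.
    exact: nonlocal_density_ge0.
  have : (alpha%:E * B < +oo)%E by apply: le_lt_trans AB; rewrite leeDr.
  rewrite -/B [in X in _ -> X]ltNge leye_eq => h; apply/negP => /eqP Boo.
  by move: h; rewrite Boo gt0_muley ?lte_fin ?ltxx.
Qed.

Lemma W_finite_finite_energy u : W_finite Omega p s alpha H w u -> finite_energy u.
Proof.
move=> [mu _ uG]; rewrite /Wnorm => Wu; apply: finite_energy_lty => //.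
rewrite ltNge leye_eq; apply/negP => /eqP Eoo; move: Wu.
by rewrite Eoo poweRyr ?ltxx// invr_eq0 gt_eqF.
Qed.

Lemma finite_energy_W_finite u : finite_energy u ->
  {ae leb, forall x, ~ Omega x -> u x = 0} -> W_finite Omega p s alpha H w u.
Proof.
move=> fu u0; have [mu uG _ _] := fu; split => //.
by rewrite /Wnorm finite_energyE// poweR_EFin ltry.
Qed.

Lemma finsler_lin_le (a b : R) (x y : 'rV[R]_N) :
  H (a *: x + b *: y) <= `|a| * H x + `|b| * H y.
Proof. by apply: le_trans (finslerD FH _ _) _; rewrite !(finsler_homog FH). Qed.

Lemma local_density_lin_le u v (a b th : R) : 0 < th -> th < 1 ->
  has_wgrad u -> has_wgrad v ->
  {ae leb, forall x, Omega x ->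
    local_density (fun x => a * u x + b * v x) x <=
    (1 - th) `^ (1 - p) * `|a| `^ p * local_density u x +
    th `^ (1 - p) * `|b| `^ p * local_density v x}.
Proof.
move=> t0 t1 [G uG] [G' vG]; apply: filterS (wgrad_lin oO a b uG vG) => x h /h.
rewrite /local_density => ->.
rewrite !mulrA -mulrDl ler_wpM2r//.
have := powRD_convex p1 t0 t1 (mulr_ge0 (normr_ge0 a) (H0 (D u x)))
  (mulr_ge0 (normr_ge0 b) (H0 (D v x))).
rewrite !powRM// !mulrA; apply: le_trans.
apply: (ge0_ler_powR (ltW p0)); rewrite ?nnegrE; [exact: H0| |exact: finsler_lin_le].
by apply: addr_ge0; apply: mulr_ge0.
Qed.

Lemma nonlocal_density_lin_le u v (a b th : R) z : 0 < th -> th < 1 ->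
  nonlocal_density (fun x => a * u x + b * v x) z <=
    (1 - th) `^ (1 - p) * `|a| `^ p * nonlocal_density u z +
    th `^ (1 - p) * `|b| `^ p * nonlocal_density v z.
Proof.
move=> t0 t1; rewrite /nonlocal_density !mulrA -mulrDl ler_wpM2r//.
have := powRD_convex p1 t0 t1
  (mulr_ge0 (normr_ge0 a) (normr_ge0 (u z.1 - u z.2)))
  (mulr_ge0 (normr_ge0 b) (normr_ge0 (v z.1 - v z.2))).
rewrite !powRM// !mulrA; apply: le_trans.
apply: (ge0_ler_powR (ltW p0)); rewrite ?nnegrE//.
rewrite -!normrM; apply: le_trans (ler_normD _ _).
by rewrite (_ : _ - _ = a * (u z.1 - u z.2) + b * (v z.1 - v z.2))//; ring.
Qed.

Lemma finite_energy_lin u v (a b : R) : finite_energy u -> finite_energy v ->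
  finite_energy (fun x => a * u x + b * v x).
Proof.
move=> [mu uG ul un] [mv vG vl vn].
have h0 : 0 < 2^-1 :> R by rewrite invr_gt0.
have h1 : 2^-1 < 1 :> R by rewrite invf_lt1 ?ltr1n.
have muv : measurable_fun setT (fun x => a * u x + b * v x).
  by apply: measurable_funD; apply: measurable_funM.
have uvG : has_wgrad (fun x => a * u x + b * v x).
  have [G hG] := uG; have [G' hG'] := vG; eexists; exact: (is_weak_grad_lin oO a b hG hG').
split; [exact: muv|exact: uvG| |].
- apply: (ae_dominated_integrable mO _ _ (integrable_lin mO
    ((1 - 2^-1) `^ (1 - p) * `|a| `^ p) (2^-1 `^ (1 - p) * `|b| `^ p) ul vl)).
    exact: measurable_local_density.
  apply: filterS (local_density_lin_le a b h0 h1 uG vG) => x h /h.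
  by rewrite (ger0_norm (local_density_ge0 _ _)).
- apply: (ae_dominated_integrable measurableT _ _ (integrable_lin measurableT
    ((1 - 2^-1) `^ (1 - p) * `|a| `^ p) (2^-1 `^ (1 - p) * `|b| `^ p) un vn)).
    exact: measurable_nonlocal_density.
  apply: aeW => z _; rewrite (ger0_norm (nonlocal_density_ge0 _ _)).
  exact: nonlocal_density_lin_le.
Qed.

(** The parameter [th] serves two purposes: the value 1/2 gives stability of [W0] under linear
    combinations, and small values give the control of the energy near a given function. *)
Lemma renergy_lin_le u v (a b th : R) : 0 < th -> th < 1 ->
  finite_energy u -> finite_energy v ->
  renergy (fun x => a * u x + b * v x) <=
    (1 - th) `^ (1 - p) * `|a| `^ p * renergy u +
    th `^ (1 - p) * `|b| `^ p * renergy v.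
Proof.
move=> t0 t1 fu fv; have [_ _ l n] := finite_energy_lin a b fu fv.
have [mu uG ul un] := fu; have [mv vG vl vn] := fv.
have hl : local_renergy (fun x => a * u x + b * v x) <=
    (1 - th) `^ (1 - p) * `|a| `^ p * local_renergy u +
    th `^ (1 - p) * `|b| `^ p * local_renergy v.
  rewrite -(Rintegral_lin mO _ _ ul vl); apply: (ae_le_Rintegral mO l).
    exact: (integrable_lin mO _ _ ul vl).
  exact: local_density_lin_le.
have hn : nonlocal_renergy (fun x => a * u x + b * v x) <=
    (1 - th) `^ (1 - p) * `|a| `^ p * nonlocal_renergy u +
    th `^ (1 - p) * `|b| `^ p * nonlocal_renergy v.
  rewrite -(Rintegral_lin measurableT _ _ un vn); apply: (ae_le_Rintegral measurableT n).
    exact: (integrable_lin measurableT _ _ un vn).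
  by apply: aeW => z _; exact: nonlocal_density_lin_le.
exact: ler_lin_combination (ltW alpha0) hl hn.
Qed.

Lemma wgradZ u (r : R) : has_wgrad u ->
  has_wgrad (fun x => r * u x) /\
  {ae leb, forall x, Omega x -> D (fun x => r * u x) x = r *: D u x}.
Proof.
move=> [G uG]; have E : (fun x => r * u x) = (fun x => r * u x + 0 * u x).
  by apply/funext => x; rewrite mul0r addr0.
rewrite E; split; first by eexists; exact: (is_weak_grad_lin oO r 0 uG uG).
by apply: filterS (wgrad_lin oO r 0 uG uG) => x h /h ->; rewrite scale0r addr0.
Qed.

Lemma finite_energyZ u (r : R) : finite_energy u ->
  finite_energy (fun x => r * u x).
Proof.
move=> fu; rewrite (_ : (fun x => r * u x) = (fun x => r * u x + 0 * u x)).
  exact: finite_energy_lin.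
by apply/funext => x; rewrite mul0r addr0.
Qed.

Lemma renergyZ u (r : R) : finite_energy u ->
  renergy (fun x => r * u x) = `|r| `^ p * renergy u.
Proof.
move=> fu; have [mu uG ul un] := fu; have [mru ruG rul run] := finite_energyZ r fu.
have e1 : local_renergy (fun x => r * u x) = `|r| `^ p * local_renergy u.
  rewrite -(RintegralZl (`|r| `^ p) mO ul); apply: (ae_eq_Rintegral mO).
  - exact: measurable_local_density.
  - by apply: measurable_funM; [exact: measurable_cst|exact: measurable_local_density].
  apply: filterS (wgradZ r uG).2 => x h /h; rewrite /local_density => ->.
  by rewrite (finsler_homog FH) (powRM _ (normr_ge0 r) (H0 _)) mulrA.
have e2 : nonlocal_renergy (fun x => r * u x) = `|r| `^ p * nonlocal_renergy u.
  rewrite -(RintegralZl (`|r| `^ p) measurableT un); apply: eq_Rintegral => z _.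
  by rewrite /nonlocal_density -mulrBr normrM (powRM _ (normr_ge0 r) (normr_ge0 _)) mulrA.
by rewrite /renergy e1 e2 mulrDr (mulrCA alpha).
Qed.

Lemma local_pairing_le u v : {ae leb, forall x, Omega x ->
  `|local_pairing u v x| <=
    (p - 1) / p * local_density u x + p^-1 * local_density v x}.
Proof.
apply: aeW => x _; rewrite /local_pairing /local_density normrM !mulrA -mulrDl.
rewrite ler_wpM2r//; apply: le_trans (flux_le N_gt0 FH p _ _) _.
exact: powR_young.
Qed.

Lemma nonlocal_pairing_le u v : {ae leb2, forall z, [set: _] z ->
  `|nonlocal_pairing u v z| <=
    (p - 1) / p * nonlocal_density u z + p^-1 * nonlocal_density v z}.
Proof.
apply: aeW => z _; rewrite /nonlocal_pairing /nonlocal_density normrM !mulrA -mulrDl.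
by rewrite ler_wpM2r// normrM norm_J_p// powR_young.
Qed.

Lemma local_pairing_integrable u v : finite_energy u -> finite_energy v ->
  leb.-integrable Omega (EFin \o local_pairing u v).
Proof.
move=> [mu uG ul un] [mv vG vl vn].
apply: (ae_dominated_integrable mO _ (local_pairing_le u v)).
  exact: measurable_local_pairing.
exact: (integrable_lin mO _ _ ul vl).
Qed.

Lemma nonlocal_pairing_integrable u v : finite_energy u -> finite_energy v ->
  leb2.-integrable setT (EFin \o nonlocal_pairing u v).
Proof.
move=> [mu uG ul un] [mv vG vl vn].
apply: (ae_dominated_integrable measurableT _ (nonlocal_pairing_le u v)).
  exact: measurable_nonlocal_pairing.
exact: (integrable_lin measurableT _ _ un vn).
Qed.

(** Young's inequality holds pointwise and is linear in the two densities, so the local and nonlocal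
    estimates add up with the same coefficients. *)
Lemma norm_pairing_le u v : finite_energy u -> finite_energy v ->
  `|pairing u v| <= (p - 1) / p * renergy u + p^-1 * renergy v.
Proof.
move=> fu fv; have il := local_pairing_integrable fu fv.
have inl := nonlocal_pairing_integrable fu fv.
have [mu uG ul un] := fu; have [mv vG vl vn] := fv.
have hl : `|local_form u v| <=
    (p - 1) / p * local_renergy u + p^-1 * local_renergy v.
  apply: le_trans (le_normr_Rintegral mO il) _.
  rewrite -(Rintegral_lin mO _ _ ul vl); apply: (ae_le_Rintegral mO).
  - exact: (integrable_abse il).
  - exact: (integrable_lin mO _ _ ul vl).
  - exact: local_pairing_le.
have hn : `|nonlocal_form u v| <=
    (p - 1) / p * nonlocal_renergy u + p^-1 * nonlocal_renergy v.
  apply: le_trans (le_normr_Rintegral measurableT inl) _.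
  rewrite -(Rintegral_lin measurableT _ _ un vn); apply: (ae_le_Rintegral measurableT).
  - exact: (integrable_abse inl).
  - exact: (integrable_lin measurableT _ _ un vn).
  - exact: nonlocal_pairing_le.
rewrite /pairing; apply: le_trans (ler_normD _ _) _.
rewrite normrM (gtr0_norm alpha0).
exact: ler_lin_combination (ltW alpha0) hl hn.
Qed.

Lemma pairing_lin u v v' (a b : R) : finite_energy u -> finite_energy v ->
  finite_energy v' ->
  pairing u (fun x => a * v x + b * v' x) = a * pairing u v + b * pairing u v'.
Proof.
move=> fu fv fv'; rewrite /pairing.
have il := local_pairing_integrable fu fv.
have inl := nonlocal_pairing_integrable fu fv.
have il' := local_pairing_integrable fu fv'.
have inl' := nonlocal_pairing_integrable fu fv'.
have [mu uG _ _] := fu; have [mv vG _ _] := fv; have [mv' vG' _ _] := fv'.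
have [_ lG _ _] := finite_energy_lin a b fv fv'.
have -> : local_form u (fun x => a * v x + b * v' x) =
    a * local_form u v + b * local_form u v'.
  rewrite -(Rintegral_lin mO _ _ il il'); apply: (ae_eq_Rintegral mO).
  - exact: measurable_local_pairing.
  - apply: measurable_funD; apply: measurable_funM;
      first [exact: measurable_cst|exact: measurable_local_pairing].
  have [G hG] := vG; have [G' hG'] := vG'.
  apply: filterS (wgrad_lin oO a b hG hG') => x h /h; rewrite /local_pairing => ->.
  by rewrite edot_linr; ring.
have -> : nonlocal_form u (fun x => a * v x + b * v' x) =
    a * nonlocal_form u v + b * nonlocal_form u v'.
  rewrite -(Rintegral_lin measurableT _ _ inl inl').
  by apply: eq_Rintegral => z _; rewrite /nonlocal_pairing; ring.
exact: lin_combinationE.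
Qed.

Lemma pairing_id u : finite_energy u -> pairing u u = renergy u.
Proof.
move=> [mu uG ul un]; congr (_ + _ * _).
  apply: (ae_eq_Rintegral mO).
  - exact: measurable_local_pairing.
  - exact: measurable_local_density.
  apply: filterS (weight_gt0 ww) => x wx _.
  by rewrite /local_pairing /local_density flux_id// gtr0_norm.
apply: (ae_eq_Rintegral measurableT).
- exact: measurable_nonlocal_pairing.
- exact: measurable_nonlocal_density.
apply: filterS (ae_mu_density_ge0 p s ww) => z kz _.
by rewrite /nonlocal_pairing /nonlocal_density (ger0_norm kz) J_p_mul.
Qed.

Lemma local_pairing_monotone u v : {ae leb, forall x, Omega x ->
  1 * local_pairing u v x + 1 * local_pairing v u x <=
  1 * local_density u x + 1 * local_density v x}.
Proof.
apply: filterS (weight_gt0 ww) => x wx _.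
apply: ler_lin1; rewrite /local_pairing /local_density (gtr0_norm wx).
have := ler_wpM2r (ltW wx) (flux_monotone N_gt0 FH p1 (D u x) (D v x)).
by rewrite !mulrDl.
Qed.

(** The nonlocal integrand of the pairing of the difference of two operators with [u - v]; the
    absolute value of the kernel makes it nonnegative at every point. *)
Definition monotone_gap u v (z : 'rV[R]_N * 'rV[R]_N) : R :=
  (J_p p (u z.1 - u z.2) - J_p p (v z.1 - v z.2)) *
  ((u z.1 - u z.2) - (v z.1 - v z.2)) * `|k z|.

Lemma monotone_gap_ge0 u v z : 0 <= monotone_gap u v z.
Proof. by rewrite mulr_ge0 ?J_p_monotone. Qed.

Lemma monotone_gapE u v : {ae leb2, forall z, [set: _] z -> monotone_gap u v z =
  1 * (1 * nonlocal_density u z + 1 * nonlocal_density v z) +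
  (- 1) * (1 * nonlocal_pairing u v z + 1 * nonlocal_pairing v u z)}.
Proof.
apply: filterS (ae_mu_density_ge0 p s ww) => z kz _.
rewrite /monotone_gap /nonlocal_density /nonlocal_pairing (ger0_norm kz).
by rewrite -!(J_p_mul _ p1); ring.
Qed.

Lemma measurable_monotone_gap u v : measurable_fun setT u -> measurable_fun setT v ->
  measurable_fun setT (monotone_gap u v).
Proof.
move=> mu mv; have du := measurable_difference mu; have dv := measurable_difference mv.
have mJ f : measurable_fun setT f -> measurable_fun setT
    (fun z : 'rV[R]_N * 'rV[R]_N => J_p p (f z)).
  move=> mf; apply: measurable_funM => //.
  apply: (measurableT_comp (measurable_powR _)); exact: measurableT_comp.
apply: measurable_funM; last exact: measurableT_comp.
apply: measurable_funM; apply: measurable_funB => //; exact: mJ.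
Qed.

Lemma monotone_gap_integral u v : finite_energy u -> finite_energy v ->
  leb2.-integrable setT (EFin \o monotone_gap u v) /\
  \int[leb2]_z monotone_gap u v z =
    1 * (1 * nonlocal_renergy u + 1 * nonlocal_renergy v) +
    (- 1) * (1 * nonlocal_form u v + 1 * nonlocal_form v u).
Proof.
move=> fu fv; have i1 := nonlocal_pairing_integrable fu fv.
have i2 := nonlocal_pairing_integrable fv fu.
have [mu uG _ un] := fu; have [mv vG _ vn] := fv.
have j1 := integrable_lin measurableT 1 1 un vn.
have j2 := integrable_lin measurableT 1 1 i1 i2.
have j := integrable_lin measurableT 1 (- 1) j1 j2.
have mg := measurable_monotone_gap mu mv.
split.
  apply: (ae_dominated_integrable measurableT mg _ j).
  apply: filterS (monotone_gapE u v) => z h hz; rewrite -h//.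
  by rewrite ger0_norm ?monotone_gap_ge0.
rewrite -(Rintegral_lin measurableT _ _ un vn) -(Rintegral_lin measurableT _ _ i1 i2).
rewrite -(Rintegral_lin measurableT _ _ j1 j2).
apply: (ae_eq_Rintegral measurableT) => //; last exact: monotone_gapE.
by apply/measurable_EFinP; exact: measurable_int j.
Qed.

Lemma local_form_monotone u v : finite_energy u -> finite_energy v ->
  1 * local_form u v + 1 * local_form v u <= 1 * local_renergy u + 1 * local_renergy v.
Proof.
move=> fu fv; have i1 := local_pairing_integrable fu fv.
have i2 := local_pairing_integrable fv fu.
have [mu uG ul _] := fu; have [mv vG vl _] := fv.
rewrite -(Rintegral_lin mO _ _ ul vl) -(Rintegral_lin mO _ _ i1 i2).
apply: (ae_le_Rintegral mO).
- exact: (integrable_lin mO _ _ i1 i2).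
- exact: (integrable_lin mO _ _ ul vl).
- exact: local_pairing_monotone.
Qed.

(** The hypothesis forces the nonlocal gap to have integral 0, hence to vanish almost everywhere on
    almost every section. On the section at an exterior point this reads
    [J_p p (- u y) = J_p p (- v y)], up to a positive factor and the strict monotonicity of
    [J_p]. *)
Lemma pairing_monotone_eq u v : finite_energy u -> finite_energy v ->
  {ae leb, forall x, ~ Omega x -> u x = 0} ->
  {ae leb, forall x, ~ Omega x -> v x = 0} ->
  renergy u + renergy v <= pairing u v + pairing v u ->
  {ae leb, forall x, u x = v x}.
Proof.
move=> fu fv u0 v0 uv; have [mu _ _ _] := fu; have [mv _ _ _] := fv.
have [ig gE] := monotone_gap_integral fu fv.
have hl := local_form_monotone fu fv.
have g0 : \int[leb2]_z monotone_gap u v z = 0.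
  apply/eqP; rewrite eq_le Rintegral_ge0 ?andbT; last by move=> z _; exact: monotone_gap_ge0.
  rewrite -(pmulr_rle0 _ alpha0) gE; exact: gap_le0 hl uv.
have G0 : (\int[leb2]_z (monotone_gap u v z)%:E = 0)%E.
  by rewrite (integralE_Rintegral measurableT ig) g0.
have mg : measurable_fun setT (EFin \o monotone_gap u v).
  by apply/measurable_EFinP; exact: measurable_monotone_gap.
have G0' z : (0 <= (EFin \o monotone_gap u v) z)%E by rewrite lee_fin monotone_gap_ge0.
have aeg := ae_section_eq0 mg G0' G0.
(* All four conditions hold almost everywhere outside [Omega], so one exterior point satisfies them
   together. *)
have [x0 x0O [[wx0 ux0 vx0] gx0]] : exists2 x, ~ Omega x &
    [/\ 0 < w x, u x = 0 & v x = 0] /\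
    {ae leb, forall y, (EFin \o monotone_gap u v) (x, y) = 0%E}.
  have [x xO [h1 [h2 [h3 h4]]]] := exists_outside (filterI (weight_gt0 ww)
    (filterI u0 (filterI v0 aeg))).
  by exists x => //; split => //; split => //; [exact: h2|exact: h3].
move: gx0 (ae_mu_density_gt0 N_gt0 p s ww wx0); apply: filterS2 => y.
move=> [/eqP] + ky; rewrite /monotone_gap/= (gtr0_norm ky) mulf_eq0 (gt_eqF ky) orbF.
rewrite ux0 vx0 => /eqP /(J_p_monotone_eq0 p1).
by rewrite !sub0r => /oppr_inj.
Qed.

(** * The space [W0] and approximation in energy *)

Local Notation W0 := (W0 Omega p s alpha H w).

Lemma W0_finite_energy v : W0 v -> finite_energy v.
Proof. by move=> [/W_finite_finite_energy]. Qed.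

Lemma W0_out v : W0 v -> {ae leb, forall x, ~ Omega x -> v x = 0}.
Proof. by move=> [[]]. Qed.

Lemma finite_energyB u v : finite_energy u -> finite_energy v ->
  finite_energy (u \- v)%R.
Proof.
move=> fu fv; rewrite (_ : (u \- v) = (fun x => 1 * u x + (- 1) * v x)).
  exact: finite_energy_lin.
by apply/funext => x; rewrite mul1r mulN1r.
Qed.

Lemma W0_approx v e : W0 v -> 0 < e ->
  exists phi, [/\ class_Cc_oo Omega phi, finite_energy phi,
    finite_energy (v \- phi)%R & renergy (v \- phi)%R < e].
Proof.
move=> Wv e0; have fv := W0_finite_energy Wv; have [mv vG _ _] := fv.
have [phi Cphi] := Wv.2 _ (powR_gt0 p^-1 e0).
rewrite /Wnorm => Ephi; exists phi.
have mphi := class_Cc_measurable (Cphi 0%N).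
have dE : (v \- phi) = (fun x => 1 * v x + (- 1) * phi x).
  by apply/funext => x; rewrite mul1r mulN1r.
have Gd : has_wgrad (v \- phi)%R.
  rewrite dE; have [G hG] := vG; eexists.
  exact: (is_weak_grad_lin oO 1 (-1) hG (is_weak_grad_classic oO (Cphi 1%N))).
have fd : finite_energy (v \- phi)%R.
  apply: finite_energy_lty => //; first exact: measurable_funB.
  rewrite ltNge leye_eq; apply/negP => /eqP Eoo; move: Ephi.
  by rewrite Eoo poweRyr// invr_eq0 gt_eqF.
split => //.
  rewrite (_ : phi = (v \- (v \- phi))%R); first exact: finite_energyB.
  by apply/funext => x; rewrite /= opprB addrC subrK.
move: Ephi; rewrite (finite_energyE fd) poweR_EFin lte_fin => h.
rewrite ltNge; apply/negP => he; move: h; rewrite ltNge => /negP; apply.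
by apply: ge0_ler_powR; rewrite ?nnegrE ?invr_ge0 ?(ltW p0) ?(ltW e0) ?renergy_ge0.
Qed.

Lemma W0_intro v : finite_energy v ->
  {ae leb, forall x, ~ Omega x -> v x = 0} ->
  (forall e, 0 < e -> exists phi, [/\ class_Cc_oo Omega phi,
    finite_energy phi & renergy (v \- phi)%R < e]) -> W0 v.
Proof.
move=> fv v0 h; split; first exact: finite_energy_W_finite.
move=> e e0; have [phi [Cphi fphi hphi]] := h _ (powR_gt0 p e0).
exists phi => //; rewrite /Wnorm (finite_energyE (finite_energyB fv fphi)).
rewrite poweR_EFin lte_fin; have -> : e = (e `^ p) `^ p^-1.
  by rewrite -powRrM mulfV ?gt_eqF// powRr1 ?ltW.
by apply: gt0_ltr_powR; rewrite ?nnegrE ?invr_gt0 ?powR_ge0 ?renergy_ge0.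
Qed.

Lemma class_Cc_oo_lin (phi psi : 'rV[R]_N -> R) (a b : R) : class_Cc_oo Omega phi ->
  class_Cc_oo Omega psi -> class_Cc_oo Omega (fun x => a * phi x + b * psi x).
Proof.
move=> Cphi Cpsi m.
rewrite (_ : (fun x => _) = (fun x => phi x * a - psi x * (- b))).
  by apply: class_CcB; apply: class_CcM => //; exact: class_C_cst.
by apply/funext => x; rewrite mulrN opprK mulrC (mulrC b).
Qed.

Lemma W0_lin u v (a b : R) : W0 u -> W0 v -> W0 (fun x => a * u x + b * v x).
Proof.
move=> Wu Wv; have fu := W0_finite_energy Wu; have fv := W0_finite_energy Wv.
apply: W0_intro; first exact: finite_energy_lin.
  move: (W0_out Wu) (W0_out Wv); apply: filterS2 => x hu hv xO.
  by rewrite hu// hv// !mulr0 addr0.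
move=> e e0.
have h0 : 0 < 2^-1 :> R by rewrite invr_gt0.
have h1 : 2^-1 < 1 :> R by rewrite invf_lt1 ?ltr1n.
pose ca := (1 - 2^-1) `^ (1 - p) * `|a| `^ p; pose cb := 2^-1 `^ (1 - p) * `|b| `^ p.
have ca0 : 0 <= ca by rewrite mulr_ge0 ?powR_ge0.
have cb0 : 0 <= cb by rewrite mulr_ge0 ?powR_ge0.
have ea : 0 < e / 2 / (ca + 1) by rewrite divr_gt0 ?divr_gt0 ?ltr_wpDl.
have eb : 0 < e / 2 / (cb + 1) by rewrite divr_gt0 ?divr_gt0 ?ltr_wpDl.
have [phi [Cphi fphi fd hphi]] := W0_approx Wu ea.
have [psi [Cpsi fpsi fd' hpsi]] := W0_approx Wv eb.
exists (fun x => a * phi x + b * psi x); split.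
- exact: class_Cc_oo_lin.
- exact: finite_energy_lin.
rewrite (_ : (_ \- _) = (fun x => a * (u \- phi) x + b * (v \- psi) x)); last first.
  by apply/funext => x /=; rewrite !mulrBr opprD addrACA.
apply: le_lt_trans (renergy_lin_le a b h0 h1 fd fd') _.
rewrite -/ca -/cb (splitr e); apply: ltrD.
  apply: le_lt_trans (ler_wpM2l ca0 (ltW hphi)) _.
  by rewrite mulrCA gtr_pMr ?divr_gt0// ltr_pdivrMr ?ltr_wpDl// mul1r ltrDl.
apply: le_lt_trans (ler_wpM2l cb0 (ltW hpsi)) _.
by rewrite mulrCA gtr_pMr ?divr_gt0// ltr_pdivrMr ?ltr_wpDl// mul1r ltrDl.
Qed.

Lemma W0Z u (r : R) : W0 u -> W0 (fun x => r * u x).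
Proof.
move=> Wu; rewrite (_ : (fun x => r * u x) = (fun x => r * u x + 0 * u x)).
  exact: W0_lin.
by apply/funext => x; rewrite mul0r addr0.
Qed.

Lemma W0B u v : W0 u -> W0 v -> W0 (u \- v)%R.
Proof.
move=> Wu Wv; rewrite (_ : (u \- v) = (fun x => 1 * u x + (- 1) * v x)).
  exact: W0_lin.
by apply/funext => x; rewrite mul1r mulN1r.
Qed.

Lemma class_Cc_oo_W0 phi : class_Cc_oo Omega phi -> finite_energy phi -> W0 phi.
Proof.
move=> Cphi fphi; apply: W0_intro => //.
  by apply: aeW => x xO; exact: class_Cc_out_dom (Cphi 0%N) xO.
move=> e e0; exists phi; split => //.
rewrite (_ : (phi \- phi) = (fun x => 0 * phi x)); last first.
  by apply/funext => x /=; rewrite subrr mul0r.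
by rewrite renergyZ// normr0 powR0 ?gt_eqF// mul0r.
Qed.

(** Upper semicontinuity of the energy at [v], read off from [renergy_lin_le] for
    [phi = v - (v - phi)] with a suitable parameter. *)
Lemma renergy_near v (e : R) : finite_energy v -> 0 < e ->
  exists2 eta : R, 0 < eta & forall phi, finite_energy phi ->
    renergy (v \- phi)%R <= eta -> renergy phi <= renergy v + e.
Proof.
move=> fv e0; have E0 := renergy_ge0 v.
(* The error [e] is halved. The parameter [1 - q] is such that the coefficient [q^(1-p)] of the
   energy of [v] equals [1 + c], and [c] times this energy is at most [e / 2], with 1 added to the
   denominator in case the energy is 0; [eta] absorbs the coefficient of the energy of [v - phi]. *)
have c0 : 0 < e / 2 / (renergy v + 1) by rewrite divr_gt0 ?divr_gt0 ?ltr_wpDl.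
set c := e / 2 / _ in c0.
have p10 : 0 < p - 1 by rewrite subr_gt0.
pose q := (1 + c) `^ (- (p - 1)^-1).
have q0 : 0 < q by rewrite powR_gt0// addr_gt0.
have q1 : q < 1.
  rewrite /q powRN invf_lt1 ?powR_gt0 ?addr_gt0//.
  have := @gt0_ltr_powR R (p - 1)^-1; rewrite invr_gt0 => /(_ p10 1 (1 + c)).
  by rewrite !nnegrE powR1 ltrDl; apply => //; rewrite addr_ge0 ?ltW.
have t0 : 0 < 1 - q by rewrite subr_gt0.
have t1 : 1 - q < 1 by rewrite ltrBlDr ltrDl.
have tp : 0 < (1 - q) `^ (1 - p) by rewrite powR_gt0.
exists (e / 2 / (1 - q) `^ (1 - p)); first by rewrite !divr_gt0.
move=> phi fphi hphi; have fd := finite_energyB fv fphi.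
rewrite [in leLHS](_ : phi = (fun x => 1 * v x + (- 1) * (v \- phi) x)); last first.
  by apply/funext => x /=; rewrite mul1r mulN1r opprB addrC subrK.
apply: le_trans (renergy_lin_le 1 (-1) t0 t1 fv fd) _.
rewrite subKr normrN1 normr1 powR1 !mulr1.
have -> : q `^ (1 - p) = 1 + c.
  rewrite /q -powRrM mulrC mulrN -mulNr opprB mulfV ?gt_eqF// powRr1//.
  by rewrite addr_ge0 ?ltW.
rewrite mulrDl mul1r (splitr e) addrA; apply: lerD.
  rewrite lerD2l /c mulrAC ler_pdivrMr ?ltr_wpDl//.
  by rewrite ler_wpM2l ?divr_ge0 ?(ltW e0)// lerDl.
by apply: le_trans (ler_wpM2l (ltW tp) hphi) _; rewrite mulrCA mulfV ?mulr1// gt_eqF.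
Qed.

(** Geometric decay makes the sum of the nonlocal densities integrable. On the section at an
    exterior point [x0] its terms are [|v y - phi_m y|^p] times a positive kernel, so they tend to 0
    for almost every [y], for the whole sequence and not just a subsequence. *)
Lemma fast_approx_ae v (phi_ : nat -> 'rV[R]_N -> R) :
  (forall m, finite_energy (v \- phi_ m)%R) ->
  {ae leb, forall x, ~ Omega x -> v x = 0} ->
  (forall m x, ~ Omega x -> phi_ m x = 0) ->
  (forall m, renergy (v \- phi_ m)%R <= geometric 1 2^-1 m) ->
  {ae leb, forall x, phi_ ^~ x @ \oo --> v x}.
Proof.
move=> fd v0 phi0 hE.
pose f m z := (nonlocal_density (v \- phi_ m)%R z)%:E.
have f0 m z : (0 <= f m z)%E by rewrite lee_fin nonlocal_density_ge0.
have mf m : measurable_fun setT (f m).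
  by apply/measurable_EFinP; apply: measurable_nonlocal_density; have [] := fd m.
pose F z := (\sum_(0 <= m <oo) f m z)%E.
have mF : measurable_fun setT F by apply: ge0_emeasurable_sum.
have F0 z : (0 <= F z)%E by apply: nneseries_ge0.
have hn m : (\int[leb2]_z f m z <= (geometric alpha^-1 2^-1 m)%:E)%E.
  have [_ _ _ nl] := fd m; rewrite /f (integralE_Rintegral measurableT nl) lee_fin.
  have : local_renergy (v \- phi_ m)%R + alpha * nonlocal_renergy (v \- phi_ m)%R <=
    geometric 1 2^-1 m by exact: hE.
  have l0 : 0 <= local_renergy (v \- phi_ m)%R.
    by apply: Rintegral_ge0 => x _; exact: local_density_ge0.
  rewrite /geometric/= mul1r => h; rewrite ler_pdivlMl//.
  by apply: le_trans h; rewrite lerDr.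
have Ffin : (\int[leb2]_z F z < +oo)%E.
  rewrite integral_nneseries//.
  apply: (@le_lt_trans _ _ (\sum_(0 <= m <oo) (geometric alpha^-1 2^-1 m)%:E)%E).
    apply: lee_nneseries => [m _ _|m _]; last exact: hn.
    by apply: integral_ge0 => z _; exact: f0.
  apply: (@le_lt_trans _ _ (alpha^-1 * (1 - 2^-1)^-1)%:E); last by rewrite ltry.
  apply: lime_le.
    by apply: is_cvg_nneseries => m _ _; rewrite lee_fin mulr_ge0 ?invr_ge0 ?(ltW alpha0)// exprn_ge0.
  apply: nearW => m; rewrite sumEFin lee_fin.
  apply: geometric_le_lim; rewrite ?invr_ge0 ?(ltW alpha0)//.
  by rewrite ger0_norm// invf_lt1 ?ltr1n.
have aeF := ae_section_lty mF F0 Ffin.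
have [x0 x0O [wx0 [vx0 Fx0]]] := exists_outside (filterI (weight_gt0 ww) (filterI v0 aeF)).
have mFx : measurable_fun setT (fun y => F (x0, y)) by exact: measurableT_comp.
have iF : leb.-integrable setT (fun y => F (x0, y)).
  apply/integrableP; split => //; apply: le_lt_trans Fx0.
  by rewrite (eq_integral (fun y => F (x0, y)))// => y _; rewrite gee0_abs.
move: (integrable_ae measurableT iF) (ae_mu_density_gt0 N_gt0 p s ww wx0).
apply: filterS2 => y /(_ I) Fy ky.
have Fy' : (\sum_(0 <= m <oo) f m (x0, y) < +oo)%E.
  by move: Fy; rewrite /F ge0_fin_numE//; exact: nneseries_ge0.
have tl := nneseries_tail_cvg Fy' (fun m _ => f0 m (x0, y)).
have fc : f ^~ (x0, y) @ \oo --> 0%E.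
  have sq : \forall m \near \oo,
      (cst 0 m <= f m (x0, y) <= \sum_(m <= i <oo) f i (x0, y))%E.
    near=> m; rewrite f0/=.
    have := @nneseries_lim_ge R (f ^~ (x0, y)) xpredT m m.+1.
    by rewrite big_nat1; apply => k _ _; exact: f0.
  exact: (squeeze_cvge sq (cvg_cst _) tl).
have {}fc : nonlocal_density (v \- phi_ m)%R (x0, y) @[m --> \oo] --> 0.
  by move/fine_cvgP : fc => [].
apply/cvgrPdist_lt => e e0.
have ep : 0 < e `^ p * `|mu_density p s w x0 y|.
  by rewrite mulr_gt0 ?powR_gt0// normr_gt0 gt_eqF.
move/cvgrPdist_lt : fc => /(_ _ ep); apply: filterS => m.
rewrite sub0r normrN (ger0_norm (nonlocal_density_ge0 _ _)) /nonlocal_density/=.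
rewrite ltr_pM2r ?normr_gt0 ?gt_eqF// vx0// phi0// subrr sub0r normrN => h.
rewrite ltNge; apply/negP => he; move: h; rewrite ltNge => /negP; apply.
by apply: (ge0_ler_powR (ltW p0)); rewrite ?nnegrE ?(ltW e0).
Unshelve. all: by end_near. Qed.

(** The slope is at most 1 in absolute value, so homogeneity of [H] handles the gradient term, and
    the Lipschitz constant 1 handles the nonlocal differences. *)
Lemma finite_energy_smooth_abs (phi : 'rV[R]_N -> R) e : 0 < e ->
  class_Cc 1 Omega phi -> finite_energy phi ->
  finite_energy (fun x => smooth_abs e (phi x)) /\
  renergy (fun x => smooth_abs e (phi x)) <= renergy phi.
Proof.
move=> e0 Cphi fphi; have [mphi phiG phil phin] := fphi.
pose psi x := smooth_abs e (phi x).
have Cpsi : class_Cc 1 Omega psi by exact: class_Cc_smooth_abs.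
have mpsi := class_Cc_measurable Cpsi.
have psiG : has_wgrad psi by exists (grad psi); exact: is_weak_grad_classic.
have hl : {ae leb, forall x, Omega x -> local_density psi x <= local_density phi x}.
  move: (wgradE oO (is_weak_grad_classic oO Cphi)) (wgradE oO (is_weak_grad_classic oO Cpsi)).
  apply: filterS2 => x h1 h2 xO; rewrite /local_density (h1 xO) (h2 xO).
  apply: (ler_wpM2r (normr_ge0 _)); apply: (ge0_ler_powR (ltW p0)); rewrite ?nnegrE ?H0//.
  rewrite (grad_smooth_abs x e0); last by case: Cphi.
  rewrite (finsler_homog FH); apply: ler_piMl; first exact: H0.
  exact: smooth_abs_slope.
have hn z : nonlocal_density psi z <= nonlocal_density phi z.
  rewrite /nonlocal_density ler_wpM2r//; apply: (ge0_ler_powR (ltW p0)); rewrite ?nnegrE//.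
  exact: smooth_abs_lip.
have il : leb.-integrable Omega (EFin \o local_density psi).
  apply: (ae_dominated_integrable mO _ _ phil).
    exact: measurable_local_density.
  by apply: filterS hl => x h /h; rewrite (ger0_norm (local_density_ge0 _ _)).
have inl : leb2.-integrable setT (EFin \o nonlocal_density psi).
  apply: (ae_dominated_integrable measurableT _ _ phin).
    exact: measurable_nonlocal_density.
  by apply: aeW => z _; rewrite (ger0_norm (nonlocal_density_ge0 _ _)).
split; first by split.
apply: lerD; first exact: (ae_le_Rintegral mO il phil hl).
apply: ler_wpM2l; first exact: ltW.
by apply: (ae_le_Rintegral measurableT inl phin); apply: aeW => z _; exact: hn.
Qed.

End energy.

(** * Weak solutions of the singular problem *)

(** The hypothesis compares mass and energy of all dilates at the level [c]. The dilation with
    [r^p E = c] yields the homogeneous inequality; if [E = 0], every dilation is admissible and [m]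
    must be 0. *)
Lemma homogeneous_le (R : realType) (p e c m E : R) :
  0 < p -> 0 < e -> 0 < c -> 0 <= m -> 0 <= E ->
  (forall r, 0 < r -> r `^ p * E <= c -> r `^ e * m <= c) ->
  c `^ (1 - p / e) * m `^ (p / e) <= E.
Proof.
move=> p0 e0 c0 m0 E0 hr; have q0 : 0 < p / e by rewrite divr_gt0.
have [Ev0|En0] := eqVneq E 0.
  suff -> : m = 0 by rewrite powR0 ?mulr0// gt_eqF.
  apply/eqP; rewrite eq_le m0 andbT leNgt; apply/negP => mv0.
  have b0 : 0 < 2 * c / m by rewrite divr_gt0 ?mulr_gt0.
  have := hr _ (powR_gt0 e^-1 b0); rewrite Ev0 mulr0 => /(_ (ltW c0)).
  rewrite -powRrM mulVf ?gt_eqF// powRr1 ?(ltW b0)// divfK ?gt_eqF//.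
  by rewrite leNgt ltr_pMl ?ltr1n.
have {En0}E0 : 0 < E by rewrite lt_neqAle eq_sym En0.
have b0 : 0 < c / E by rewrite divr_gt0.
pose r := (c / E) `^ p^-1; have r0 : 0 < r by rewrite powR_gt0.
have rp : r `^ p = c / E by rewrite /r -powRrM mulVf ?gt_eqF// powRr1 ?(ltW b0).
have := hr _ r0; rewrite rp divfK ?gt_eqF// => /(_ (lexx _)) hm.
have := @ge0_ler_powR R _ (ltW q0) (r `^ e * m) c.
rewrite !nnegrE mulr_ge0 ?powR_ge0// => /(_ isT (ltW c0) hm).
rewrite (powRM _ (powR_ge0 _ _) m0) -powRrM mulrCA mulfV ?gt_eqF// mulr1 rp.
rewrite powRB ?(gt_eqF c0) ?implybT// powRr1 ?(ltW c0)//.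
move: (m `^ _) (c `^ _) (powR_gt0 (p / e) c0) => M C C0.
by rewrite mulrAC ler_pdivrMr// (mulrAC c) ler_pdivrMr// (mulrC C).
Qed.

Section singular_problem.
Context {R : realType} {N : nat}.
Local Notation leb := (lebesgue_rV N).
Local Notation leb2 := (leb \x leb)%E.
Variables (Omega : set 'rV[R]_N) (p s alpha : R) (H w : 'rV[R]_N -> R).
Hypotheses (N_gt0 : (0 < N)%N) (oO : open Omega) (bO : bounded_set Omega).
Hypotheses (p1 : 1 < p) (alpha0 : 0 < alpha).
Hypotheses (FH : finsler_minkowski H) (ww : weight w).
Variables (delta : R) (g u : 'rV[R]_N -> R).
Hypothesis su : weak_solution Omega p s alpha H w delta g u.
Implicit Types v phi : 'rV[R]_N -> R.

Let mO : measurable Omega := open_measurable_rV oO.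
Let p0 : 0 < p := lt_trans ltr01 p1.
Local Notation W0 := (W0 Omega p s alpha H w).
Local Notation finite_energy := (finite_energy Omega p s H w).
Local Notation renergy := (renergy Omega p s alpha H w).
Local Notation pairing := (pairing Omega p s alpha H w).

Lemma weak_solution_W0 : W0 u.
Proof. by have [] := su. Qed.

Let Wu := weak_solution_W0.
Let fu : finite_energy u := W0_finite_energy oO p1 alpha0 FH ww Wu.

Lemma weak_solution_measurable_rhs : measurable_fun Omega g.
Proof. by have [[/measurable_int/measurable_EFinP]] := su. Qed.

(** The lower bounds are given on compactly contained sets only; countably many rational boxes
    exhaust [Omega]. *)
Lemma weak_solution_gt0 : {ae leb, forall x, Omega x -> 0 < u x}.
Proof.
have [_ _ lb _] := su.
have hb (ab : 'rV[rat]_N * 'rV[rat]_N) : {ae leb, forall x,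
    cbox (ratrV ab.1) (ratrV ab.2) `<=` Omega ->
    obox (ratrV ab.1) (ratrV ab.2) x -> 0 < u x}.
  have [abO|abO] := pselect (cbox (@ratrV R N ab.1) (ratrV ab.2) `<=` Omega); last exact: aeW.
  have sub : closure (obox (@ratrV R N ab.1) (ratrV ab.2)) `<=`
      cbox (ratrV ab.1) (ratrV ab.2).
    have /closure_id cE := closed_cbox (a := @ratrV R N ab.1) (b := ratrV ab.2).
    by rewrite [X in _ `<=` X]cE; apply: closure_subset; exact: obox_sub_cbox.
  have cQ : compact (closure (obox (@ratrV R N ab.1) (ratrV ab.2))).
    apply: (subclosed_compact _ _ sub); first exact: closed_closure.
    exact: compact_cbox.
  have [C C0 hC] := lb _ cQ (subset_trans sub abO).
  by apply: filterS hC => x h _ /h; exact: lt_le_trans.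
have := ae_forall_countable hb; apply: filterS.
by move=> x h Dx; have [ab [_ h1 h2]] := obox_dense oO Dx; exact: (h ab h2 h1).
Qed.

(** The density of the functional on the right-hand side; with [|g|] in place of [g] it is
    nonnegative at every point, and [g] is nonnegative almost everywhere in [Omega]. *)
Definition rhs_weight (x : 'rV[R]_N) : R := `|g x| * u x `^ (- delta).
Local Notation h := rhs_weight.

Lemma rhs_weight_ge0 x : 0 <= h x.
Proof. by rewrite mulr_ge0 ?powR_ge0. Qed.

Lemma measurable_rhs_weight : measurable_fun Omega h.
Proof.
apply: measurable_funM.
  by apply: measurableT_comp => //; exact: weak_solution_measurable_rhs.
apply: (measurableT_comp (measurable_powR _)).
exact: (measurable_funS measurableT (@subsetT _ _) (fe_measurable fu)).
Qed.

Lemma weak_form phi : class_Cc 1 Omega phi -> finite_energy phi ->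
  (\int[leb]_(x in Omega) (h x * phi x)%:E = (pairing u phi)%:E)%E.
Proof.
move=> Cphi fphi; have mphi := class_Cc_measurable Cphi.
have [[_ g0 _] _ _ weq] := su.
have mphiO : measurable_fun Omega phi.
  exact: (measurable_funS measurableT (@subsetT _ _) mphi).
transitivity (\int[leb]_(x in Omega) (g x * u x `^ (- delta) * phi x)%:E)%E.
  apply: ae_eq_integral => //.
  - by apply/measurable_EFinP; apply: measurable_funM => //; exact: measurable_rhs_weight.
  - apply/measurable_EFinP; apply: measurable_funM => //; apply: measurable_funM.
      exact: weak_solution_measurable_rhs.
    apply: (measurableT_comp (measurable_powR _)).
    exact: (measurable_funS measurableT (@subsetT _ _) (fe_measurable fu)).
  by apply: filterS g0 => x gx xO; rewrite /rhs_weight ger0_norm ?gx.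
rewrite -(weq _ Cphi).
have il := local_pairing_integrable N_gt0 oO p1 FH ww fu fphi.
have inl := nonlocal_pairing_integrable p1 ww fu fphi.
rewrite /pairing EFinD EFinM /local_form /nonlocal_form.
rewrite -(integralE_Rintegral mO il) -(integralE_Rintegral measurableT inl).
congr (_ + _)%E; apply: ae_eq_integral => //.
- apply/measurable_EFinP; apply: measurable_funM; last first.
    exact: (measurable_funS measurableT (@subsetT _ _) (weight_measurable ww)).
  apply: (edot_measurable mO) => i.
    exact: (measurableT_comp (measurable_flux FH p i) (measurable_wgrad oO (fe_wgrad fu))).
  apply: (measurable_funS measurableT (@subsetT _ _)).
  exact: class_Cc_measurable (class_Cc_grad i Cphi).
- exact: measurable_int il.
apply: filterS (wgradE oO (is_weak_grad_classic oO Cphi)) => x hx xO.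
by rewrite /local_pairing hx.
Qed.

Local Notation bound v := ((p - 1) / p * renergy u + p^-1 * renergy v).

(** Testing with [phi] bounds only a signed integral, whereas Fatou's lemma on the way to [W0] needs
    nonnegative integrands. Smoothing [|phi|] gives admissible test functions without raising the
    energy. *)
Lemma weak_solution_abs_smooth phi : class_Cc 1 Omega phi -> finite_energy phi ->
  (\int[leb]_(x in Omega) (h x * `|phi x|)%:E <= (bound phi)%:E)%E.
Proof.
move=> Cphi fphi; have mphi := class_Cc_measurable Cphi.
have e0 m : 0 < (m.+1%:R^-1 : R) by rewrite invr_gt0.
pose psi m x := smooth_abs m.+1%:R^-1 (phi x).
have Cpsi m : class_Cc 1 Omega (psi m) := class_Cc_smooth_abs (e0 m) Cphi.
have Epsi m := finite_energy_smooth_abs oO p1 alpha0 FH ww (e0 m) Cphi fphi.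
have mh := measurable_rhs_weight.
apply: (fatou_bound mO (f_ := fun m x => h x * psi m x)).
- move=> m; apply: measurable_funM => //.
  exact: (measurable_funS measurableT (@subsetT _ _) (class_Cc_measurable (Cpsi m))).
- apply: measurable_funM => //; apply: measurableT_comp => //.
  exact: (measurable_funS measurableT (@subsetT _ _) mphi).
- by move=> m x _; rewrite mulr_ge0 ?rhs_weight_ge0 ?smooth_abs_ge0.
- apply: aeW => x _; apply: cvgM; first exact: cvg_cst.
  exact: smooth_abs_cvg.
move=> m; have [fpsi lepsi] := Epsi m.
rewrite (weak_form (Cpsi m) fpsi) lee_fin; apply: le_trans (ler_norm _) _.
apply: le_trans (norm_pairing_le N_gt0 oO p1 alpha0 FH ww fu fpsi) _.
by rewrite lerD2l ler_wpM2l// invr_ge0 ltW.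
Qed.

Lemma weak_solution_abs_W0 v : W0 v ->
  (\int[leb]_(x in Omega) (h x * `|v x|)%:E <= (bound v)%:E)%E.
Proof.
move=> Wv; have fv := W0_finite_energy oO p1 alpha0 FH ww Wv.
apply/lee_addgt0Pr => e e0.
(* The energy of [v] enters the bound with the factor [1/p], so an excess of [p * e] in it costs
   exactly [e]. *)
have pe0 : 0 < p * e by rewrite mulr_gt0.
have [eta eta0 near_v] := renergy_near oO p1 alpha0 FH ww fv pe0.
(* The two thresholds have different uses: [eta] keeps the energies of the approximants near that of
   [v], and the geometric one gives almost everywhere convergence. *)
have /choice[phi_ hphi] : forall m : nat, exists phi,
    [/\ class_Cc_oo Omega phi, finite_energy phi, finite_energy (v \- phi)%R &
     renergy (v \- phi)%R < Num.min eta (geometric 1 2^-1 m)].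
  move=> m; apply: (W0_approx oO p1 alpha0 FH ww Wv).
  by rewrite lt_min eta0/= mul1r exprn_gt0// invr_gt0.
have ae_cvg : {ae leb, forall x, phi_ ^~ x @ \oo --> v x}.
  apply: (fast_approx_ae N_gt0 bO p1 alpha0 ww).
  - by move=> m; have [_ _ fd _] := hphi m; exact: fd.
  - exact: W0_out Wv.
  - by move=> m x; have [Cphi _ _ _] := hphi m; exact: class_Cc_out_dom (Cphi 0%N).
  - by move=> m; have [_ _ _] := hphi m; rewrite lt_min => /andP[_ /ltW].
have mh := measurable_rhs_weight.
rewrite -EFinD; apply: (fatou_bound mO (f_ := fun m x => h x * `|phi_ m x|)).
- move=> m; apply: measurable_funM => //; apply: measurableT_comp => //.
  have [Cphi _ _ _] := hphi m.
  exact: (measurable_funS measurableT (@subsetT _ _) (class_Cc_measurable (Cphi 0%N))).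
- apply: measurable_funM => //; apply: measurableT_comp => //.
  exact: (measurable_funS measurableT (@subsetT _ _) (fe_measurable fv)).
- by move=> m x _; rewrite mulr_ge0 ?rhs_weight_ge0.
- apply: filterS ae_cvg => x hx _; apply: cvgM; first exact: cvg_cst.
  exact: cvg_norm.
move=> m; have [Cphi fphi _] := hphi m; rewrite lt_min => /andP[/ltW le_eta _].
apply: le_trans (weak_solution_abs_smooth (Cphi 1%N) fphi) _.
rewrite lee_fin -addrA lerD2l; apply: le_trans (ler_wpM2l _ (near_v _ fphi le_eta)) _.
  by rewrite invr_ge0 ltW.
by rewrite mulrDr lerD2l mulrA mulVf ?mul1r// gt_eqF.
Qed.

Lemma rhs_weightM_integrable v : W0 v ->
  leb.-integrable Omega (EFin \o (fun x => h x * v x)).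
Proof.
move=> Wv; have mv := fe_measurable (W0_finite_energy oO p1 alpha0 FH ww Wv).
have mvO : measurable_fun Omega v by exact: (measurable_funS measurableT (@subsetT _ _) mv).
have mh := measurable_rhs_weight; apply/integrableP; split.
  by apply/measurable_EFinP; exact: measurable_funM.
apply: le_lt_trans (ltry (bound v)); apply: le_trans (weak_solution_abs_W0 Wv).
rewrite le_eqVlt; apply/orP; left; apply/eqP; apply: eq_integral => x _.
by rewrite /= normrM (ger0_norm (rhs_weight_ge0 x)).
Qed.

Lemma rhs_weightM_abs_integrable v : W0 v ->
  leb.-integrable Omega (EFin \o (fun x => h x * `|v x|)).
Proof.
move=> Wv; have := integrable_abse (rhs_weightM_integrable Wv).
congr (_.-integrable _ _); apply/funext => x /=.
by rewrite normrM (ger0_norm (rhs_weight_ge0 x)).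
Qed.

Lemma norm_rhs_weightM_le v : W0 v ->
  `|\int[leb]_(x in Omega) (h x * v x)| <= bound v.
Proof.
move=> Wv; apply: le_trans (le_normr_Rintegral mO (rhs_weightM_integrable Wv)) _.
have -> : \int[leb]_(x in Omega) `|h x * v x| = \int[leb]_(x in Omega) (h x * `|v x|).
  by apply: eq_Rintegral => x _; rewrite normrM (ger0_norm (rhs_weight_ge0 x)).
rewrite -lee_fin -(integralE_Rintegral mO (rhs_weightM_abs_integrable Wv)).
exact: weak_solution_abs_W0.
Qed.

(* The weak formulation extends from smooth test functions to W0: both sides
   are continuous for the energy, by the bound on the right-hand side. *)
Lemma weak_solution_test v : W0 v ->
  \int[leb]_(x in Omega) (h x * v x) = pairing u v.
Proof.
move=> Wv; have fv := W0_finite_energy oO p1 alpha0 FH ww Wv.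
pose B := (p - 1) / p * renergy u + p^-1.
have Eu0 := renergy_ge0 Omega p s H w alpha0 u.
have B0 : 0 <= B.
  by rewrite addr_ge0 ?mulr_ge0 ?invr_ge0 ?subr_ge0 ?(ltW p0) ?(ltW p1).
apply/eqP; rewrite -subr_eq0 -normr_le0; set d := `|_|.
rewrite leNgt; apply/negP => d0.
(* The bounds are not homogeneous, so the discrepancy is tested on [r (v - phi)], where the energy
   of [v - phi] is below [r^-p]: each side is then at most [B]. As [phi] contributes nothing,
   linearity gives [d * r <= 2 * B], which this [r] violates. *)
pose r := (2 * B + 1) / d.
have r0 : 0 < r by rewrite divr_gt0// ltr_wpDl// mulr_ge0.
suff : d * r <= 2 * B.
  by rewrite /r mulrCA mulfV ?gt_eqF// mulr1 leNgt ltrDl ltr01.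
have [phi [Cphi fphi fd hd]] := W0_approx oO p1 alpha0 FH ww Wv (powR_gt0 (- p) r0).
have Wphi := class_Cc_oo_W0 oO p1 alpha0 FH ww Cphi fphi.
have Wd := W0B oO p1 alpha0 FH ww Wv Wphi.
have Wrd := W0Z oO p1 alpha0 FH ww r Wd.
have frd := W0_finite_energy oO p1 alpha0 FH ww Wrd.
have brd : bound (fun x => r * (v \- phi)%R x) <= B.
  rewrite lerD2l (renergyZ alpha oO p1 FH ww r fd) (gtr0_norm r0).
  rewrite -[leRHS]mulr1 ler_wpM2l ?invr_ge0 ?(ltW p0)//.
  rewrite -(mulfV (lt0r_neq0 (powR_gt0 p r0))) -powRN.
  by rewrite ler_wpM2l ?powR_ge0 ?(ltW hd).
have h1 := le_trans (norm_rhs_weightM_le Wrd) brd.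
have h2 := le_trans (norm_pairing_le N_gt0 oO p1 alpha0 FH ww fu frd) brd.
have vE : v = (fun x => 1 * phi x + r^-1 * (r * (v \- phi)%R x)).
  apply/funext => x; rewrite mul1r mulrA mulVf ?gt_eqF// mul1r /=.
  by rewrite addrC subrK.
have E1 : \int[leb]_(x in Omega) (h x * v x) = pairing u phi +
    r^-1 * \int[leb]_(x in Omega) (h x * (r * (v \- phi)%R x)).
  have i1 := rhs_weightM_integrable Wphi.
  have i2 := rhs_weightM_integrable Wrd.
  have Ephi : \int[leb]_(x in Omega) (h x * phi x) = pairing u phi.
    have := weak_form (Cphi 1%N) fphi; rewrite (integralE_Rintegral mO i1).
    by case.
  rewrite -Ephi -[X in X + _]mul1r -(Rintegral_lin mO 1 r^-1 i1 i2).
  apply: eq_Rintegral => x _; rewrite {1}vE; ring.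
have E2 : pairing u v = pairing u phi + r^-1 * pairing u (fun x => r * (v \- phi)%R x).
  by rewrite {1}vE (pairing_lin alpha N_gt0 oO p1 FH ww 1 r^-1 fu fphi frd) mul1r.
rewrite /d E1 E2 opprD addrACA subrr add0r -mulrBr normrM gtr0_norm ?invr_gt0//.
rewrite mulrAC mulVf ?gt_eqF// mul1r (_ : 2 * B = B + B); last by ring.
exact: le_trans (ler_normB _ _) (lerD h1 h2).
Qed.

Hypotheses (delta0 : 0 < delta) (delta1 : delta < 1).

Let d10 : 0 < 1 - delta. Proof. by rewrite subr_gt0. Qed.

Definition mass_density v (x : 'rV[R]_N) : R := `|v x| `^ (1 - delta) * g x.

Definition mass v : R := \int[leb]_(x in Omega) mass_density v x.

Lemma weak_solution_rhs_ge0 : {ae leb, forall x, Omega x -> 0 <= g x}.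
Proof. by have [[]] := su. Qed.

Lemma measurable_mass_density v : measurable_fun setT v ->
  measurable_fun Omega (mass_density v).
Proof.
move=> mv; apply: measurable_funM; last exact: weak_solution_measurable_rhs.
apply: (measurableT_comp (measurable_powR _)); apply: measurableT_comp => //.
exact: (measurable_funS measurableT (@subsetT _ _) mv).
Qed.

Lemma mass_density_le v : {ae leb, forall x, Omega x ->
  `|mass_density v x| <= (1 - delta) * (h x * `|v x|) + delta * (h x * u x)}.
Proof.
move: weak_solution_rhs_ge0 weak_solution_gt0; apply: filterS2 => x g0 u0 xO.
have {}g0 := g0 xO; have {}u0 := u0 xO.
rewrite /mass_density /rhs_weight normrM (ger0_norm (powR_ge0 _ _)) (ger0_norm g0).
have := powR_am_gm delta0 delta1 (normr_ge0 (v x)) (ltW u0) => agm.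
have gu : 0 <= g x * u x `^ (- delta) by rewrite mulr_ge0 ?powR_ge0.
have := ler_wpM2l gu agm.
have -> : g x * u x `^ (- delta) * (`|v x| `^ (1 - delta) * u x `^ delta) =
    `|v x| `^ (1 - delta) * g x.
  rewrite powRN; have : u x `^ delta != 0 by rewrite gt_eqF// powR_gt0.
  by move: (u x `^ delta) => y y0; field.
move=> /le_trans; apply; rewrite le_eqVlt; apply/orP; left; apply/eqP; ring.
Qed.

Lemma mass_density_integrable v : W0 v ->
  leb.-integrable Omega (EFin \o mass_density v).
Proof.
move=> Wv; have mv := fe_measurable (W0_finite_energy oO p1 alpha0 FH ww Wv).
apply: (ae_dominated_integrable mO (measurable_mass_density mv) (mass_density_le v)).
exact: (integrable_lin mO _ _ (rhs_weightM_abs_integrable Wv) (rhs_weightM_integrable Wu)).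
Qed.

Lemma constraintE v : W0 v -> constraint Omega delta g v = (mass v)%:E.
Proof. by move=> Wv; rewrite -(integralE_Rintegral mO (mass_density_integrable Wv)). Qed.

Lemma mass_ge0 v : W0 v -> 0 <= mass v.
Proof.
move=> Wv; have i0 : leb.-integrable Omega (EFin \o (fun=> 0 : R)) by exact: integrable0.
have := ae_le_Rintegral mO i0 (mass_density_integrable Wv).
rewrite Rintegral_cst// mul0r; apply.
apply: filterS weak_solution_rhs_ge0 => x g0 xO.
by rewrite mulr_ge0 ?powR_ge0 ?g0.
Qed.

Lemma mass_id : mass u = renergy u.
Proof.
rewrite -(pairing_id alpha N_gt0 oO p1 FH ww fu) -(weak_solution_test Wu).
apply: (ae_eq_Rintegral mO).
- by apply: measurable_mass_density; exact: fe_measurable fu.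
- apply/measurable_EFinP; exact: measurable_int (rhs_weightM_integrable Wu).
move: weak_solution_rhs_ge0 weak_solution_gt0; apply: filterS2 => x g0 u0 xO.
have {}g0 := g0 xO; have {}u0 := u0 xO.
rewrite /mass_density /rhs_weight (gtr0_norm u0) (ger0_norm g0) powRB ?(gt_eqF u0) ?implybT//.
by rewrite powRr1 ?(ltW u0)// powRN; ring.
Qed.

Lemma mass_le v : W0 v ->
  mass v <= (1 - delta) * bound v + delta * renergy u.
Proof.
move=> Wv; have i1 := rhs_weightM_abs_integrable Wv.
have i2 := rhs_weightM_integrable Wu.
have iv := mass_density_integrable Wv.
apply: le_trans (ler_norm _) _; apply: le_trans (le_normr_Rintegral mO iv) _.
have := ae_le_Rintegral mO (integrable_abse iv) (integrable_lin mO (1 - delta) delta i1 i2)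
  (mass_density_le v).
rewrite (Rintegral_lin mO _ _ i1 i2) => /le_trans; apply; apply: lerD.
  rewrite ler_pM2l// -lee_fin -(integralE_Rintegral mO i1).
  exact: weak_solution_abs_W0.
by rewrite (weak_solution_test Wu) (pairing_id alpha N_gt0 oO p1 FH ww fu).
Qed.

Lemma massZ v r : W0 v -> 0 < r ->
  mass (fun x => r * v x) = r `^ (1 - delta) * mass v.
Proof.
move=> Wv r0; rewrite -(RintegralZl (r `^ (1 - delta)) mO (mass_density_integrable Wv)).
apply: eq_Rintegral => x _; rewrite /mass_density normrM (gtr0_norm r0).
by rewrite (powRM _ (ltW r0) (normr_ge0 _)) mulrA.
Qed.

(** The energy equals the integral of [g u^(1-delta)]; were it 0, positivity of [u] would force
    [g = 0] almost everywhere in [Omega]. *)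
Lemma weak_solution_energy_gt0 : 0 < renergy u.
Proof.
rewrite lt_neqAle renergy_ge0 ?andbT//; apply/negP => /eqP/esym E0.
have [[_ g0 gN0] _ _ _] := su; apply: gN0.
have iu := mass_density_integrable Wu.
have : (\int[leb]_(x in Omega) `|(EFin \o mass_density u) x| = 0)%E.
  rewrite -[RHS](_ : (mass u)%:E = 0%E); last by rewrite mass_id E0.
  rewrite -(constraintE Wu); apply: ae_eq_integral => //.
  - by apply: measurableT_comp => //; exact: measurable_int iu.
  - exact: measurable_int iu.
  apply: filterS g0 => x gx xO; rewrite /= ger0_norm//.
  by rewrite mulr_ge0 ?powR_ge0 ?gx.
move/(ae_eq_integral_abs _ mO (measurable_int _ iu)).
move: weak_solution_gt0; apply: filterS2 => x u0 h0 xO.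
have a0 : 0 < `|u x| `^ (1 - delta) by rewrite powR_gt0// normr_gt0 gt_eqF// u0.
have /= [/eqP] := h0 xO.
by rewrite mulf_eq0 (gt_eqF a0)/= => /eqP.
Qed.

Lemma mass_energy_le v r : W0 v -> 0 < r -> r `^ p * renergy v <= renergy u ->
  r `^ (1 - delta) * mass v <= renergy u.
Proof.
move=> Wv r0 rE; have fv := W0_finite_energy oO p1 alpha0 FH ww Wv.
rewrite -(massZ Wv r0); apply: le_trans (mass_le (W0Z oO p1 alpha0 FH ww r Wv)) _.
rewrite (renergyZ alpha oO p1 FH ww r fv) (gtr0_norm r0).
have hb : (p - 1) / p * renergy u + p^-1 * (r `^ p * renergy v) <= renergy u.
  apply: (@le_trans _ _ ((p - 1) / p * renergy u + p^-1 * renergy u)).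
    by rewrite lerD2l ler_pM2l ?invr_gt0.
  rewrite -mulrDl (_ : (p - 1) / p + p^-1 = 1) ?mul1r//.
  by field; rewrite gt_eqF.
apply: (@le_trans _ _ ((1 - delta) * renergy u + delta * renergy u)).
  by rewrite lerD2r ler_pM2l.
by rewrite -mulrDl subrK mul1r.
Qed.

(** The constant is the energy of the normalized solution, as [renergy_V_delta] shows. *)
Lemma extremal_inequality v : W0 v ->
  renergy u `^ (1 - p / (1 - delta)) * mass v `^ (p / (1 - delta)) <= renergy v.
Proof.
move=> Wv; apply: (homogeneous_le p0 d10 weak_solution_energy_gt0 (mass_ge0 Wv)).
  exact: renergy_ge0.
by move=> r; exact: mass_energy_le.
Qed.

End singular_problem.

(** * Uniqueness and the normalized solution *)

(** The expanded form of [(x^-d - y^-d) (x - y) <= 0]: each of the four products is integrated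
    separately. *)
Lemma powR_antitone (R : realType) (d x y : R) : 0 < d -> 0 < x -> 0 < y ->
  x `^ (- d) * x + y `^ (- d) * y <= x `^ (- d) * y + y `^ (- d) * x.
Proof.
move=> d0; wlog xy : x y / x <= y => [th x0 y0|x0 y0].
  have [xy|/ltW yx] := leP x y; first exact: th.
  by rewrite addrC [leRHS]addrC; exact: th.
have : y `^ (- d) <= x `^ (- d).
  rewrite !powRN lef_pV2 ?posrE ?powR_gt0//.
  by rewrite ge0_ler_powR ?nnegrE ?(ltW d0) ?(ltW x0) ?(ltW y0).
by move: (x `^ _) (y `^ _) => a b ab; nra.
Qed.

(** A finite positive factor distributes over every extended sum, those of opposite infinities
    included. *)
Lemma gt0_muleD (R : realDomainType) (k : R) (a b : \bar R) : 0 < k ->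
  (k%:E * (a + b) = k%:E * a + k%:E * b)%E.
Proof.
move=> k0; case: a b => [a| |] [b| |] //=;
  rewrite ?(gt0_muley, gt0_muleNy, lte_fin)//.
by congr EFin; rewrite mulrDr.
Qed.

(** Positive and negative parts scale separately, so integrability is not asked for. The equation of
    [V_delta] is tested with all of [C_c^1], with no assumption that the test function has finite
    energy. *)
Lemma gt0_integralZ d (T : measurableType d) (R : realType)
    (mu : {measure set T -> \bar R}) (D : set T) (f : T -> R) (k : R) :
  measurable D -> measurable_fun D f -> 0 < k ->
  (\int[mu]_(x in D) (k * f x)%:E = k%:E * \int[mu]_(x in D) (f x)%:E)%E.
Proof.
move=> mD mf k0; under eq_integral do rewrite EFinM.
have mF : measurable_fun D (EFin \o f) by exact/measurable_EFinP.
rewrite integralE [in RHS]integralE gt0_muleD// muleN; congr (_ - _)%E.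
  rewrite (ge0_funeposM _ (ltW k0)) ge0_integralZl_EFin ?ltW//.
  exact: measurable_funepos.
rewrite (ge0_funenegM _ (ltW k0)) ge0_integralZl_EFin ?ltW//.
exact: measurable_funeneg.
Qed.

Lemma ae_le_RintegralD d (T : measurableType d) (R : realType)
    (mu : {measure set T -> \bar R}) (D : set T) (f1 f2 g1 g2 : T -> R) :
  measurable D ->
  mu.-integrable D (EFin \o f1) -> mu.-integrable D (EFin \o f2) ->
  mu.-integrable D (EFin \o g1) -> mu.-integrable D (EFin \o g2) ->
  {ae mu, forall x, D x -> f1 x + f2 x <= g1 x + g2 x} ->
  \int[mu]_(x in D) f1 x + \int[mu]_(x in D) f2 x <=
  \int[mu]_(x in D) g1 x + \int[mu]_(x in D) g2 x.
Proof.
move=> mD if1 if2 ig1 ig2 h; rewrite -!RintegralD//.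
apply: (ae_le_Rintegral mD) h; first exact: (integrableD mD if1 if2).
exact: (integrableD mD ig1 ig2).
Qed.

Section uniqueness.
Context {R : realType} {N : nat}.
Local Notation leb := (lebesgue_rV N).
Variables (Omega : set 'rV[R]_N) (p s alpha : R) (H w : 'rV[R]_N -> R).
Hypotheses (N_gt0 : (0 < N)%N) (oO : open Omega) (bO : bounded_set Omega).
Hypotheses (p1 : 1 < p) (alpha0 : 0 < alpha).
Hypotheses (FH : finsler_minkowski H) (ww : weight w).
Variables (delta : R) (g u v : 'rV[R]_N -> R).
Hypothesis delta0 : 0 < delta.
Hypothesis su : weak_solution Omega p s alpha H w delta g u.
Hypothesis sv : weak_solution Omega p s alpha H w delta g v.

Let mO : measurable Omega := open_measurable_rV oO.

(** Both equations are tested with both solutions. The sum of the two energies becomes an integral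
    of diagonal terms, and [powR_antitone] bounds it by the mixed terms, which are the two cross
    pairings. *)
Lemma weak_solution_unique : {ae leb, forall x, u x = v x}.
Proof.
have Wu := weak_solution_W0 su; have Wv := weak_solution_W0 sv.
have fu := W0_finite_energy oO p1 alpha0 FH ww Wu.
have fv := W0_finite_energy oO p1 alpha0 FH ww Wv.
apply: (pairing_monotone_eq N_gt0 oO bO p1 alpha0 FH ww fu fv (W0_out Wu) (W0_out Wv)).
rewrite -(pairing_id alpha N_gt0 oO p1 FH ww fu) -(pairing_id alpha N_gt0 oO p1 FH ww fv).
have T a b : weak_solution Omega p s alpha H w delta g a ->
    W0 Omega p s alpha H w b -> _ := fun sa Wb =>
  @weak_solution_test R N Omega p s alpha H w N_gt0 oO bO p1 alpha0 FH ww delta g a sa b Wb.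
rewrite -(T _ _ su Wu) -(T _ _ sv Wv) -(T _ _ su Wv) -(T _ _ sv Wu) {T}.
have I a b : weak_solution Omega p s alpha H w delta g a ->
    W0 Omega p s alpha H w b -> _ := fun sa Wb =>
  @rhs_weightM_integrable R N Omega p s alpha H w N_gt0 oO bO p1 alpha0 FH ww delta g a sa b Wb.
apply: (ae_le_RintegralD mO (I _ _ su Wu) (I _ _ sv Wv) (I _ _ su Wv) (I _ _ sv Wu)).
move: (weak_solution_rhs_ge0 su) (weak_solution_gt0 oO su) (weak_solution_gt0 oO sv).
apply: filterS3 => x g0 u0 v0 xO; rewrite /rhs_weight -!mulrA -!mulrDr.
by rewrite ler_wpM2l// powR_antitone ?u0 ?v0.
Qed.

End uniqueness.

Section normalized_solution.
Context {R : realType} {N : nat}.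
Local Notation leb := (lebesgue_rV N).
Local Notation leb2 := (leb \x leb)%E.
Variables (Omega : set 'rV[R]_N) (p s alpha : R) (H w : 'rV[R]_N -> R).
Hypotheses (N_gt0 : (0 < N)%N) (oO : open Omega) (bO : bounded_set Omega).
Hypotheses (p1 : 1 < p) (alpha0 : 0 < alpha).
Hypotheses (FH : finsler_minkowski H) (ww : weight w).
Variables (delta : R) (g u : 'rV[R]_N -> R).
Hypotheses (delta0 : 0 < delta) (delta1 : delta < 1).
Hypothesis su : weak_solution Omega p s alpha H w delta g u.

Let mO : measurable Omega := open_measurable_rV oO.
Let d10 : 0 < 1 - delta. Proof. by rewrite subr_gt0. Qed.
Local Notation W0 := (W0 Omega p s alpha H w).
Local Notation renergy := (renergy Omega p s alpha H w).
Local Notation mass := (mass Omega delta g).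
Local Notation V := (V_delta Omega delta g u).
Local Notation zeta := (zeta_delta Omega delta g u).

Let Wu : W0 u := weak_solution_W0 su.
Let fu := W0_finite_energy oO p1 alpha0 FH ww Wu.
Let mu_ : measurable_fun Omega u :=
  measurable_funS measurableT (@subsetT _ _) (fe_measurable fu).

Let c_gt0 : 0 < renergy u :=
  weak_solution_energy_gt0 N_gt0 oO bO p1 alpha0 FH ww su delta0 delta1.

Lemma zeta_deltaE : zeta = renergy u `^ (- (1 - delta)^-1).
Proof.
rewrite /zeta_delta; congr (_ `^ _).
rewrite -(mass_id N_gt0 oO bO p1 alpha0 FH ww su).
transitivity (fine (constraint Omega delta g u)).
  apply: f_equal; apply: ae_eq_integral.
  - exact: mO.
  - apply/measurable_EFinP; apply: measurable_funM (weak_solution_measurable_rhs su).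
    exact: (measurableT_comp (measurable_powR _)).
  - apply/measurable_EFinP.
    exact: (measurable_mass_density su (fe_measurable fu)).
  by apply: filterS (weak_solution_gt0 oO su) => x u0 /u0 /gtr0_norm ->.
by rewrite (constraintE N_gt0 oO bO p1 alpha0 FH ww su delta0 delta1 Wu).
Qed.

Lemma zeta_delta_gt0 : 0 < zeta.
Proof. by rewrite zeta_deltaE powR_gt0. Qed.

Lemma W0_V_delta : W0 V.
Proof. exact: W0Z. Qed.

Lemma mass_V_delta : mass V = 1.
Proof.
rewrite (massZ N_gt0 oO bO p1 alpha0 FH ww su delta0 delta1 Wu zeta_delta_gt0).
rewrite (mass_id N_gt0 oO bO p1 alpha0 FH ww su).
rewrite zeta_deltaE -powRrM mulNr mulVf ?gt_eqF// powRN powRr1 ?(ltW c_gt0)//.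
by rewrite mulVf// gt_eqF.
Qed.

Lemma renergy_V_delta : renergy V = renergy u `^ (1 - p / (1 - delta)).
Proof.
rewrite (renergyZ alpha oO p1 FH ww zeta fu) (gtr0_norm zeta_delta_gt0).
rewrite zeta_deltaE; move: (renergy u) c_gt0 => c c0.
rewrite -powRrM -{2}(powRr1 (ltW c0)) -powRD ?(gt_eqF c0) ?implybT//.
by congr (_ `^ _); rewrite mulNr addrC (mulrC p).
Qed.

Lemma ThetaE : Theta Omega p s alpha H w delta g = (renergy V)%:E.
Proof.
apply/eqP; rewrite eq_le; apply/andP; split.
  apply: ereal_inf_lbound; exists V.
    split; first exact: W0_V_delta.
    by rewrite (constraintE N_gt0 oO bO p1 alpha0 FH ww su delta0 delta1 W0_V_delta) mass_V_delta.
  exact: (finite_energyE alpha oO FH ww (W0_finite_energy oO p1 alpha0 FH ww W0_V_delta)).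
apply: le_ereal_inf_tmp => _ [v [Wv cv] <-].
rewrite (finite_energyE alpha oO FH ww (W0_finite_energy oO p1 alpha0 FH ww Wv)).
rewrite lee_fin renergy_V_delta.
have := extremal_inequality N_gt0 oO bO p1 alpha0 FH ww su delta0 delta1 Wv.
move: cv; rewrite (constraintE N_gt0 oO bO p1 alpha0 FH ww su delta0 delta1 Wv).
by move=> [->]; rewrite powR1 mulr1.
Qed.

(** Multiplying [u] by [zeta] scales the operator by [zeta^(p-1)] and the singular power by
    [zeta^-delta]; this identity says that the energy of [V] is the constant that balances the
    two. *)
Lemma renergy_V_delta_zeta : renergy V * zeta `^ (- delta) = zeta `^ (p - 1).
Proof.
rewrite renergy_V_delta zeta_deltaE; move: (renergy u) c_gt0 => c c0.
rewrite -!powRrM -powRD ?(gt_eqF c0) ?implybT//; congr (_ `^ _).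
by field; rewrite gt_eqF.
Qed.

Lemma V_delta_local_term phi : class_Cc 1 Omega phi ->
  (\int[leb]_(x in Omega) (edot (flux p H (wgrad Omega V x)) (grad phi x) * w x)%:E =
   (zeta `^ (p - 1))%:E * \int[leb]_(x in Omega)
     (edot (flux p H (wgrad Omega u x)) (grad phi x) * w x)%:E)%E.
Proof.
move=> Cphi.
have m a : has_wgrad Omega a -> measurable_fun Omega (fun x : 'rV[R]_N =>
    edot (flux p H (wgrad Omega a x)) (grad phi x) * w x).
  move=> ha; apply: measurable_funM; last first.
    exact: (measurable_funS measurableT (@subsetT _ _) (weight_measurable ww)).
  apply: (edot_measurable mO) => i.
    exact: (measurableT_comp (measurable_flux FH p i) (measurable_wgrad oO ha)).
  apply: (measurable_funS measurableT (@subsetT _ _)).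
  exact: class_Cc_measurable (class_Cc_grad i Cphi).
have [hV VE] := wgradZ oO zeta (fe_wgrad fu).
have mu1 := m _ (fe_wgrad fu).
rewrite -(gt0_integralZ leb mO mu1 (powR_gt0 (p - 1) zeta_delta_gt0)).
apply: ae_eq_integral.
- exact: mO.
- by apply/measurable_EFinP; exact: m.
- by apply/measurable_EFinP; exact: measurable_funM (measurable_cst _) mu1.
apply: filterS VE => x hx xO; rewrite (hx xO) (fluxZ FH p _ zeta_delta_gt0) edotZl.
by rewrite mulrA.
Qed.

Lemma V_delta_nonlocal_term (phi : 'rV[R]_N -> R) : measurable_fun setT phi ->
  (\int[leb2]_z (J_p p (V z.1 - V z.2) * (phi z.1 - phi z.2) *
      mu_density p s w z.1 z.2)%:E =
   (zeta `^ (p - 1))%:E * \int[leb2]_z (J_p p (u z.1 - u z.2) *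
      (phi z.1 - phi z.2) * mu_density p s w z.1 z.2)%:E)%E.
Proof.
move=> mphi.
have md := measurable_nonlocal_pairing p s ww (fe_measurable fu) mphi.
rewrite -(gt0_integralZ leb2 measurableT md (powR_gt0 (p - 1) zeta_delta_gt0)).
apply: eq_integral => z _; congr EFin.
by rewrite /V_delta -mulrBr (J_p_homog _ p1 zeta_delta_gt0) !mulrA.
Qed.

Lemma V_delta_rhs_term (phi : 'rV[R]_N -> R) : measurable_fun setT phi ->
  (\int[leb]_(x in Omega) (renergy V * g x * V x `^ (- delta) * phi x)%:E =
   (zeta `^ (p - 1))%:E *
     \int[leb]_(x in Omega) (g x * u x `^ (- delta) * phi x)%:E)%E.
Proof.
move=> mphi; have mg := weak_solution_measurable_rhs su.
have mphiO : measurable_fun Omega phi.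
  exact: (measurable_funS measurableT (@subsetT _ _) mphi).
have m (k : R) (a : 'rV[R]_N -> R) : measurable_fun Omega a ->
    measurable_fun Omega (fun x => k * g x * a x `^ (- delta) * phi x).
  move=> ma; apply: measurable_funM mphiO; apply: measurable_funM.
    exact: measurable_funM (measurable_cst _) mg.
  exact: (measurableT_comp (measurable_powR _)).
have mu1 : measurable_fun Omega (fun x => g x * u x `^ (- delta) * phi x).
  apply: measurable_funM mphiO; apply: measurable_funM mg _.
  exact: (measurableT_comp (measurable_powR _)).
rewrite -(gt0_integralZ leb mO mu1 (powR_gt0 (p - 1) zeta_delta_gt0)).
apply: ae_eq_integral.
- exact: mO.
- apply/measurable_EFinP; apply: m; exact: measurable_funM (measurable_cst _) mu_.
- by apply/measurable_EFinP; exact: measurable_funM (measurable_cst _) mu1.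
apply: filterS (weak_solution_gt0 oO su) => x u0 xO; congr EFin.
rewrite /V_delta (powRM _ (ltW zeta_delta_gt0) (ltW (u0 xO))) -renergy_V_delta_zeta.
by move: (renergy _) (zeta `^ _) (u x `^ _) => a b c; ring.
Qed.

Lemma weak_solution_V_delta :
  weak_solution Omega p s alpha H w delta (fun x => renergy V * g x) V.
Proof.
have [[ig g0 gN0] _ lb weq] := su.
have E0 : 0 < renergy V by rewrite renergy_V_delta powR_gt0.
have z0 := zeta_delta_gt0.
split; first split.
- exact: (integrableZl mO (renergy V) ig).
- by apply: filterS g0 => x h /h; exact: mulr_ge0 (ltW E0).
- move=> h; apply: gN0; apply: filterS h => x h /h /eqP.
  by rewrite mulf_eq0 (gt_eqF E0) => /eqP.
- exact: W0_V_delta.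
- move=> om com omO; have [C C0 hC] := lb om com omO.
  exists (zeta * C); first exact: mulr_gt0.
  by apply: filterS hC => x h /h; rewrite /V_delta (ler_pM2l z0).
move=> phi Cphi; have mphi := class_Cc_measurable Cphi.
rewrite (V_delta_local_term Cphi) (V_delta_nonlocal_term mphi) (V_delta_rhs_term mphi).
by rewrite muleCA -(gt0_muleD _ _ (powR_gt0 (p - 1) z0)) weq.
Qed.

End normalized_solution.

Theorem corollary1p3 (R : realType) (N : nat) (Omega : set 'rV[R]_N)
    (alpha s p delta t m : R) (H w f u : 'rV[R]_N -> R) :
  (2 <= N)%N ->
  bounded_lipschitz_domain Omega ->
  0 < alpha ->
  0 < s -> s < 1 -> 1 < p ->
  0 < delta -> delta < 1 ->
  finsler_minkowski H ->
  range_t N p t ->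
  Apt p t Omega w ->
  admissible_m N p t delta m ->
  Lp m Omega f ->
  {ae lebesgue_rV N, forall x, Omega x -> 0 <= f x} ->
  ~ {ae lebesgue_rV N, forall x, Omega x -> f x = 0} ->
  weak_solution Omega p s alpha H w delta f u ->
  let E := energy Omega p s alpha H w in
  let W := W0 Omega p s alpha H w in
  let Th := Theta Omega p s alpha H w delta f in
  let V := V_delta Omega delta f u in
  [/\ S_delta Omega p s alpha H w delta f V,
      Th = E V,
      (forall v, W v ->
         Th * constraint Omega delta f v `^ (p / (1 - delta)) <= E v)%E,
      (Th * constraint Omega delta f V `^ (p / (1 - delta)) = E V)%E &
      weak_solution Omega p s alpha H w delta (fun x => fine Th * f x) V /\
      forall v,
        weak_solution Omega p s alpha H w delta (fun x => fine Th * f x) v ->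
        {ae lebesgue_rV N, forall x, v x = V x}].
Proof.
move=> N2 [_ oO _ bO _] alpha0 s0 s1 p1 delta0 delta1 FH _ [[ww _] _] _ _ _ _ su E W Th V.
have N_gt0 : (0 < N)%N by exact: ltnW.
have WV : W V := W0_V_delta oO p1 alpha0 FH ww su.
have EE v : W v -> E v = (renergy Omega p s alpha H w v)%:E.
  by move=> /(W0_finite_energy oO p1 alpha0 FH ww) /(finite_energyE alpha oO FH ww).
have CE := constraintE N_gt0 oO bO p1 alpha0 FH ww su delta0 delta1.
have mV : mass Omega delta f V = 1 := mass_V_delta N_gt0 oO bO p1 alpha0 FH ww delta0 delta1 su.
have ThE : Th = (renergy Omega p s alpha H w V)%:E :=
  ThetaE N_gt0 oO bO p1 alpha0 FH ww delta0 delta1 su.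
have sV : weak_solution Omega p s alpha H w delta (fun x => fine Th * f x) V.
  by rewrite ThE; exact: weak_solution_V_delta.
split.
- by split=> //; rewrite CE// mV.
- by rewrite ThE EE.
- move=> v Wv; rewrite ThE CE// EE// poweR_EFin -EFinM lee_fin.
  rewrite [renergy _ _ _ _ _ _ V](renergy_V_delta N_gt0 oO bO p1 alpha0 FH ww delta0 delta1 su).
  exact: extremal_inequality.
- by rewrite CE// mV poweR_EFin powR1 mule1 ThE EE.
split=> // v sv; exact: (weak_solution_unique N_gt0 oO bO p1 alpha0 FH ww delta0 sv sV).
Qed.
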